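(* For degenerate Kundt metrics in dimension $n=4$, let $$I_1=\frac{(W_1)_v^2h_{22}-2(W_1)_v(W_2)_vh_{12}+(W_2)_v^2h_{11}}{h_{11}h_{22}-h_{12}^2},\qquad I_{2a}=H_{vv},\qquad I_{2b}=\frac{\left((W_1)_{x^2v}-(W_2)_{x^1v}\right)^2}{h_{11}h_{22}-h_{12}^2},$$ let $\nabla_1,\nabla_2,\nabla_3,\nabla_4$ be the invariant horizontal frame described in the context, and let $c^1_{23}$ be the coefficient of $\nabla_1$ in $[\nabla_2,\nabla_3]=c^k_{23}\nabla_k$. The differential invariants $I_1,I_{2a},I_{2b},c^1_{23}$ are horizontally independent, and thus sufficient for solving the equivalence problem.
   Context: Four-dimensional degenerate Kundt metrics in adapted coordinates $(u,x^1,x^2,v)$ are $g=du\,(dv+H\,du+W_1\,dx^1+W_2\,dx^2)+\sum_{i,j=1}^2h_{ij}\,dx^i\,dx^j$ with $H,W_i$ functions of $(u,x,v)$, $h_{ij}=h_{ji}$ functions of $(u,x)$, $(h_{ij})$ positive definite, and $(W_i)_{vv}=0$, $H_{vvv}=0$. Let $\pi$ be the trivial bundle over $\mathbb{R}^4(u,x^1,x^2,v)$ with fiber coordinates $H,W_1,W_2,h_{11},h_{12},h_{22}$ ($(h_{ij})$ positive definite). $\tilde{\mathcal{E}}^k\subset J^k\pi$ is given by those of the equations $(h_{ij})_v=0$, $(W_i)_{vv}=0$, $H_{vvv}=0$ and all their total derivatives that have order $\le k$; $\tilde{\mathcal{E}}^\infty$ is the infinite prolongation. $\mathcal{G}$ is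 the Lie pseudogroup of local diffeomorphisms $(u,x^i,v)\mapsto(C(u),A^i(u,x),v/C'(u)+B(u,x))$ with $\det[A^i_{x^j}]\neq0$, $C'\ne0$; it acts on Kundt metrics of the form $g=du\,(dv+H\,du+W_1\,dx^1+W_2\,dx^2)+\sum_{i,j=1}^2h_{ij}\,dx^i\,dx^j$, hence on $J^0\pi$ (so that $g$, viewed as a horizontal symmetric 2-form on $\pi$, is invariant), and the action prolongs to jets preserving $\tilde{\mathcal{E}}^k$. Subscripts on $H,W_i,h_{ij}$ denote jet variables; $\mathcal{D}_u,\mathcal{D}_{x^i},\mathcal{D}_v$ are the total derivatives; the horizontal differential is $\hat df=\mathcal{D}_u(f)du+\mathcal{D}_{x^i}(f)dx^i+\mathcal{D}_v(f)dv$; for a horizontal 1-form $\omega$, $g^{-1}\omega$ is the horizontal vector field $X$ with $g(X,\cdot)=\omega$. The frame: let $a_1,a_2$ solve $(\hat dI_1+a_1\hat dI_{2a}+a_2\hat dI_{2b})(\mathcal{D}_{x^i})=0$ for $i=1,2$; set $\nabla_1=g^{-1}(\hat dI_1+a_1\hat dI_{2a}+a_2\hat dI_{2b})$, $\nabla_2=g^{-1}\hat dI_{2a}$, $\nabla_3=g^{-1}\hat dI_{2b}$, and let $\nabla_4$ be determined by $g(\nabla_1,\nabla_4)=1$, $g(\nabla_2,\nabla_4)=g(\nabla_3,\nabla_4)=g(\nabla_4,\nabla_4)=0$. The structure functions $c^k_{ij}$ are defined by $[\nabla_i,\nabla_j]=c^k_{ij}\nabla_k$. Differential invariants are functions on some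 $\tilde{\mathcal{E}}^k$, rational in the jet variables (and polynomial in jet variables of sufficiently high order), constant on $\mathcal{G}$-orbits; they form the algebra $\mathcal{A}$. Invariants $J_1,\dots,J_4$ are horizontally independent if $\hat dJ_1\wedge\hat dJ_2\wedge\hat dJ_3\wedge\hat dJ_4\not\equiv0$. ''Sufficient for solving the equivalence problem'' means: writing $g=G_{ij}\,\hat dJ_i\,\hat dJ_j$ and letting $\mathcal{D}_{J_i}$ be the horizontal frame dual to $\hat dJ_i$ (Tresse derivatives), the algebra $\mathcal{A}$ is generated by $J_i,G_{ij}$ and the derivations $\mathcal{D}_{J_i}$, i.e. these invariants and all their iterated Tresse derivatives generate $\mathcal{A}$ and separate generic $\mathcal{G}$-orbits in $\tilde{\mathcal{E}}^\infty$. *)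

(* Defs.v *)
(* MathComp / MathComp-Analysis; the reals are an arbitrary R : realType. *)
From HB Require Import structures.
From mathcomp Require Import all_boot all_order all_algebra.
From mathcomp Require Import all_classical all_reals all_analysis.
Set Implicit Arguments.
Unset Strict Implicit.
Unset Printing Implicit Defensive.
Import Order.TTheory GRing.Theory Num.Theory numFieldNormedType.Exports.
Local Open Scope classical_set_scope.
Local Open Scope ring_scope.

(* The base coordinates (u, x^1, x^2, v), in this order. *)
Definition iu : 'I_4 := @Ordinal 4 0 isT.
Definition ix1 : 'I_4 := @Ordinal 4 1 isT.
Definition ix2 : 'I_4 := @Ordinal 4 2 isT.
Definition iv : 'I_4 := @Ordinal 4 3 isT.
Definition ix (i : 'I_2) : 'I_4 := if i == ord0 then ix1 else ix2.

(* Fibre coordinates of the bundle pi over R^4. *)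
Inductive fibre := fH | fW1 | fW2 | fh11 | fh12 | fh22.

Definition midx := {ffun 'I_4 -> nat}.
Definition midx_order (al : midx) : nat := (\sum_a al a)%N.
Definition midx0 : midx := [ffun => 0%N].
Definition midxS (a : 'I_4) (al : midx) : midx := [ffun b => (al b + (b == a))%N].

(* Points of J^oo pi. A point of J^k pi is such a jet taken up to equality of
   the base point and of the coordinates of order <= k, see [agree]. *)
Record jet (R : realType) :=
  Jet { base : 'rV[R]_4; jcoord : fibre -> midx -> R }.

Section Kundt.
Variable R : realType.
Implicit Types (th : jet R) (f : jet R -> R) (p : 'rV[R]_4).

(* Symmetric products: du dv = (du (x) dv + dv (x) du) / 2, so that
   h_ij dx^i dx^j has matrix (h_ij). *)
Definition metric_mx (y : fibre -> R) : 'M[R]_4 :=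
  \matrix_(a, b) nth 0 (nth [::]
    [:: [:: y fH;        y fW1 / 2;  y fW2 / 2;  1 / 2];
        [:: y fW1 / 2;   y fh11;     y fh12;     0    ];
        [:: y fW2 / 2;   y fh12;     y fh22;     0    ];
        [:: 1 / 2;       0;          0;          0    ]] a) b.

Definition posdef (y : fibre -> R) : Prop :=
  forall s t : R, (s, t) != (0, 0) ->
    0 < y fh11 * s ^+ 2 + 2 * y fh12 * s * t + y fh22 * t ^+ 2.

(* The highest power of v allowed in each component of a Kundt metric. *)
Definition vdeg (c : fibre) : nat :=
  match c with fH => 2 | fW1 | fW2 => 1 | _ => 0 end.

Definition jet0 th : fibre -> R := fun c => jcoord th c midx0.

Definition Ek (k : nat) th : Prop :=
  posdef (jet0 th) /\
  forall c al, (midx_order al <= k)%N -> (vdeg c < al iv)%N -> jcoord th c al = 0.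

Definition Eoo th : Prop := forall k, Ek k th.

Definition agree (k : nat) th th' : Prop :=
  base th = base th' /\
  forall c al, (midx_order al <= k)%N -> jcoord th c al = jcoord th' c al.

(** Local sections, their jets, and the pseudogroup *)

Definition pder (a : 'I_4) (F : 'rV[R]_4 -> R) : 'rV[R]_4 -> R :=
  fun p => 'D_(delta_mx 0 a) F p.

Definition pder_midx (al : midx) (F : 'rV[R]_4 -> R) : 'rV[R]_4 -> R :=
  foldr (fun a G => iter (al a) (pder a) G) F (enum 'I_4).

(* C^oo on a neighbourhood of p. *)
Definition smooth_at p (F : 'rV[R]_4 -> R) : Prop :=
  \forall q \near p, forall w : seq 'I_4, differentiable (foldr pder F w) q.

Definition section_at p (s : 'rV[R]_4 -> fibre -> R) : Prop :=
  (forall c, smooth_at p (fun q => s q c)) /\ (\forall q \near p, posdef (s q)).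

Definition jet_of (s : 'rV[R]_4 -> fibre -> R) p : jet R :=
  Jet p (fun c al => pder_midx al (fun q => s q c) p).

Definition row4 (x y z t : R) : 'rV[R]_4 := \row_a nth 0 [:: x; y; z; t] a.

(* phi is, near p, an element of the pseudogroup G. The two nonvanishing
   conditions make its Jacobian determinant det[A^i_{x^j}] nonzero. *)
Definition pseudogroup_at p (phi : 'rV[R]_4 -> 'rV[R]_4) : Prop :=
  (forall b, smooth_at p (fun q => phi q 0 b)) /\
  exists (C : R -> R) (A1 A2 B : R -> R -> R -> R), \forall q \near p,
    [/\ phi q = row4 (C (q 0 iu))
                     (A1 (q 0 iu) (q 0 ix1) (q 0 ix2))
                     (A2 (q 0 iu) (q 0 ix1) (q 0 ix2))
                     (q 0 iv / derive1 C (q 0 iu) + B (q 0 iu) (q 0 ix1) (q 0 ix2)),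
        \det (\matrix_(i < 2, j < 2) pder (ix j) (fun z => phi z 0 (ix i)) q) != 0
      & derive1 C (q 0 iu) != 0].

Definition jacobian (phi : 'rV[R]_4 -> 'rV[R]_4) p : 'M[R]_4 :=
  \matrix_(a, b) pder a (fun z => phi z 0 b) p.

(* The prolonged action: phi^(k) maps the k-jet of th to the k-jet of th' when
   these are the k-jets of sections s, s' with phi^* g' = g near the base point
   of th, g and g' being the metrics of s and s'. *)
Definition prolong (k : nat) (phi : 'rV[R]_4 -> 'rV[R]_4) th th' : Prop :=
  phi (base th) = base th' /\
  exists s s' : 'rV[R]_4 -> fibre -> R,
    [/\ section_at (base th) s, section_at (base th') s',
        \forall q \near base th,
          metric_mx (s q) =
            jacobian phi q *m metric_mx (s' (phi q)) *m (jacobian phi q)^T,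
        agree k th (jet_of s (base th))
      & agree k th' (jet_of s' (base th'))].

Definition same_orbit (k : nat) th th' : Prop :=
  exists phi, pseudogroup_at (base th) phi /\ prolong k phi th th'.

Definition same_orbit_oo th th' : Prop :=
  exists phi, pseudogroup_at (base th) phi /\ forall k, prolong k phi th th'.

(** Polynomial and rational functions on jets, differential invariants *)

(* The algebra of functions generated by S over the constants. *)
Inductive alg (S : (jet R -> R) -> Prop) : (jet R -> R) -> Prop :=
| alg_cst (r : R) : alg S (fun=> r)
| alg_gen f : S f -> alg S f
| alg_add f g : alg S f -> alg S g -> alg S (fun th => f th + g th)
| alg_mul f g : alg S f -> alg S g -> alg S (fun th => f th * g th).

Inductive jet_coord (k : nat) : (jet R -> R) -> Prop :=
| jet_coord_base a : jet_coord k (fun th => base th 0 a)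
| jet_coord_fibre c al :
    (midx_order al <= k)%N -> jet_coord k (fun th => jcoord th c al).

Definition polyfun (k : nat) : (jet R -> R) -> Prop := alg (jet_coord k).

Definition nonzero_on_E f : Prop := exists th, Eoo th /\ f th != 0.

(* P holds on a nonempty Zariski open subset of some E^k (pulled back to E^oo).
   In particular a rational function f is not identically zero iff
   [generically (fun th => f th != 0)]. *)
Definition generically (P : jet R -> Prop) : Prop :=
  exists (k : nat) (q : jet R -> R), [/\ polyfun k q, nonzero_on_E q
    & forall th, Eoo th -> q th != 0 -> P th].

(* f is a differential invariant which is rational in the jet variables of
   order <= l and polynomial in those of order > l. *)
Definition diff_invariant (l : nat) f : Prop :=
  exists (k : nat) (p q : jet R -> R),
    [/\ (l <= k)%N, polyfun k p, polyfun l q /\ nonzero_on_E q,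
        forall th, Eoo th -> q th != 0 -> f th = p th / q th
      & forall th th', Ek k th -> Ek k th' -> same_orbit k th th' ->
          q th != 0 -> q th' != 0 -> p th / q th = p th' / q th'].

(** Horizontal calculus *)

(* The straight line through th in the direction of the total derivative
   D_a = d/dx^a + \sum_(c, al) y^c_(al + 1_a) d/dy^c_al at th. *)
Definition flow (a : 'I_4) (t : R) th : jet R :=
  Jet (base th + t *: delta_mx 0 a)
      (fun c al => jcoord th c al + t * jcoord th c (midxS a al)).

(* The directional derivative along D_a, for functions of finite order. *)
Definition Dt (a : 'I_4) f : jet R -> R :=
  fun th => derive1 (fun t : R => f (flow a t th)) 0.

Definition hd f th : 'rV[R]_4 := \row_a Dt a f th.

(* A horizontal vector field is given by its components on D_u, ..., D_v. *)
Definition vapp (X : jet R -> 'rV[R]_4) f : jet R -> R :=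
  fun th => \sum_a X th 0 a * Dt a f th.

Definition bracket (X Y : jet R -> 'rV[R]_4) : jet R -> 'rV[R]_4 := fun th =>
  \row_a (vapp X (fun z => Y z 0 a) th - vapp Y (fun z => X z 0 a) th).

Definition gmx th : 'M[R]_4 := metric_mx (jet0 th).

Definition gdot th (X Y : 'rV[R]_4) : R := (X *m gmx th *m Y^T) 0 0.

(* g^{-1} om *)
Definition sharp th (om : 'rV[R]_4) : 'rV[R]_4 := om *m invmx (gmx th).

(** The invariants I_1, I_2a, I_2b *)

Definition dv : midx := midxS iv midx0.

Definition I1 : jet R -> R := fun th =>
  let h c := jcoord th c midx0 in
  let w1 := jcoord th fW1 dv in let w2 := jcoord th fW2 dv in
  (w1 ^+ 2 * h fh22 - 2 * w1 * w2 * h fh12 + w2 ^+ 2 * h fh11) /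
    (h fh11 * h fh22 - h fh12 ^+ 2).

Definition I2a : jet R -> R := fun th => jcoord th fH (midxS iv dv).

Definition I2b : jet R -> R := fun th =>
  let h c := jcoord th c midx0 in
  (jcoord th fW1 (midxS ix2 dv) - jcoord th fW2 (midxS ix1 dv)) ^+ 2 /
    (h fh11 * h fh22 - h fh12 ^+ 2).

(** The frame; [xget 0 A] is the (generically unique) element of A *)

Definition omega (a : 'rV[R]_2) th : 'rV[R]_4 :=
  hd I1 th + a 0 0 *: hd I2a th + a 0 1 *: hd I2b th.

Definition acoef th : 'rV[R]_2 :=
  xget 0 [set a | forall i : 'I_2, omega a th 0 (ix i) = 0].

Definition nabla1 th : 'rV[R]_4 := sharp th (omega (acoef th) th).
Definition nabla2 th : 'rV[R]_4 := sharp th (hd I2a th).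
Definition nabla3 th : 'rV[R]_4 := sharp th (hd I2b th).
Definition nabla4 th : 'rV[R]_4 :=
  xget 0 [set X | [/\ gdot th (nabla1 th) X = 1, gdot th (nabla2 th) X = 0,
                      gdot th (nabla3 th) X = 0 & gdot th X X = 0]].

(* nabla i is the frame field numbered i + 1. *)
Definition nabla (i : 'I_4) : jet R -> 'rV[R]_4 :=
  nth nabla1 [:: nabla1; nabla2; nabla3; nabla4] i.

(* The coefficient of nabla k in [nabla i, nabla j]. *)
Definition structure_fun (i j k : 'I_4) : jet R -> R := fun th =>
  (bracket (nabla i) (nabla j) th *m invmx (\matrix_b nabla b th)) 0 k.

Definition c1_23 : jet R -> R :=
  structure_fun (@Ordinal 4 1 isT) (@Ordinal 4 2 isT) (@Ordinal 4 0 isT).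

Definition kundt_invariants (i : 'I_4) : jet R -> R :=
  nth I1 [:: I1; I2a; I2b; c1_23] i.

(** Horizontal independence and sufficiency for the equivalence problem *)

Definition dJ_mx (J : 'I_4 -> jet R -> R) th : 'M[R]_4 :=
  \matrix_(a, i) Dt a (J i) th.

Definition horizontally_independent (J : 'I_4 -> jet R -> R) : Prop :=
  generically (fun th => \det (dJ_mx J th) != 0).

(* Row i holds the components of D_{J_i}, where \hat dJ_j (D_{J_i}) = delta_ij. *)
Definition tresse_frame (J : 'I_4 -> jet R -> R) th : 'M[R]_4 :=
  invmx (dJ_mx J th).

Definition tresse (J : 'I_4 -> jet R -> R) (i : 'I_4) f : jet R -> R :=
  vapp (fun th => row i (tresse_frame J th)) f.

(* The components of g = G_ij \hat dJ_i \hat dJ_j. *)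
Definition Gcomp (J : 'I_4 -> jet R -> R) (i j : 'I_4) : jet R -> R := fun th =>
  gdot th (row i (tresse_frame J th)) (row j (tresse_frame J th)).

(* At most m-fold iterated Tresse derivatives of the J_i and G_ij. *)
Inductive tresse_gen (J : 'I_4 -> jet R -> R) : nat -> (jet R -> R) -> Prop :=
| tresse_gen_J m i : tresse_gen J m (J i)
| tresse_gen_G m i j : tresse_gen J m (Gcomp J i j)
| tresse_gen_D m i f : tresse_gen J m f -> tresse_gen J m.+1 (tresse J i f).

(* Generation is understood as in the global Lie-Tresse theorem: invariants are
   polynomials in the iterated Tresse derivatives, with coefficients rational in
   those of bounded order; the bound m depends only on l. *)
Definition generate (J : 'I_4 -> jet R -> R) : Prop :=
  exists l0 : nat,
    (forall m f, tresse_gen J m f -> diff_invariant l0 f) /\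
    forall l, (l0 <= l)%N -> exists m : nat, forall f, diff_invariant l f ->
      exists (n : nat) (P Q : jet R -> R),
        [/\ alg (tresse_gen J n) P, alg (tresse_gen J m) Q
          & generically (fun th => Q th != 0 /\ f th = P th / Q th)].

Definition separate (J : 'I_4 -> jet R -> R) : Prop :=
  exists (k : nat) (q : jet R -> R), [/\ polyfun k q, nonzero_on_E q
    & forall th th', Eoo th -> Eoo th' -> q th != 0 -> q th' != 0 ->
        (forall m f, tresse_gen J m f -> f th = f th') ->
        same_orbit_oo th th'].

Definition sufficient_for_equivalence (J : 'I_4 -> jet R -> R) : Prop :=
  generate J /\ separate J.

End Kundt.

(* Main.v *)
(** On the open set where K = (W_1)_{x^2 v} - (W_2)_{x^1 v}, det d(I_2a, I_2b)/d(x^1, x^2) and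
    det d(I_1, I_2a, I_2b)/d(u, x^1, x^2) do not vanish, the frame is given by explicit formulas.
    Since I_1, I_2a, I_2b do not depend on v, horizontal independence reduces to D_v c^1_23 <> 0,
    and a computation gives 2 alpha D_v c^1_23 = (X /\ Y) K, where X and Y are the x-parts of
    nabla_2 and nabla_3 and alpha du is the 1-form dual to nabla_1.

    For the equivalence problem write g = G_ij dJ_i dJ_j. The equations g(D_v, D_v) = 0,
    g(D_v, D_xi) = 0 and g(D_v, D_u) = 1/2 express D_v J_4 and D_xi J_1 through the other derivatives
    of the J_k, so every jet coordinate is a polynomial in the iterated Tresse derivatives of the J_k
    and G_ij, the derivatives of J_2, J_3, J_4 along u and x, those of J_1 along u, and two inverses.
    The pseudogroup acts freely enough to prescribe all these derivatives of the J_k at a point: the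
    jets of C, A^i and B solve, order by order, linear systems with the invertible matrix (D_b J_k),
    and Borel's theorem realizes them. Evaluating an invariant at the normalized jet writes it in
    terms of Tresse derivatives, and jets with equal Tresse derivatives have equal normal forms. *)
From HB Require Import structures.
From mathcomp Require Import all_boot all_order all_algebra.
From mathcomp Require Import all_classical all_reals all_analysis.
From mathcomp Require Import ring.
Require Import Defs.
Set Implicit Arguments.
Unset Strict Implicit.
Unset Printing Implicit Defensive.
Import Order.TTheory GRing.Theory Num.Theory numFieldNormedType.Exports.
Local Open Scope classical_set_scope.
Local Open Scope ring_scope.

(** [Dt] is a derivative along straight lines in the space of infinite jets, where symmetry of
    second derivatives is not directly at hand. Facts about total derivatives are therefore
    transported to functions on R^4: every jet of the equation is the jet of a genuine Kundt section
    (Borel's theorem, then truncation to a polynomial in v), along which [Dt] is a partial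
    derivative. The [good] sets of jets are those where this works. Orbits are defined by sections
    that match k-jets at one point and need not be Kundt nearby; they are replaced by isometric
    pairs of Kundt sections before invariance is used. The shape of the normalization comes from C
    depending on u alone: a multi-index containing x leaves three unknowns for four equations, so
    one equation has to be given up. Normalization also makes denominators uniform: at a normalized
    jet the two inverted quantities become polynomials in the invariants, and the level of Tresse
    derivatives in the denominator of an invariant is governed by the order of its own denominator
    alone. *)

Section Smooth.
Variable R : realType.
Notation V4 := 'rV[R]_4.
Notation E a := (delta_mx 0 a : V4).
Implicit Types (F G : V4 -> R) (O : set V4) (p q : V4) (w : seq 'I_4).

(** * Smooth functions on open subsets of R^4 *)

Definition Dw w F : V4 -> R := foldr (@pder R) F w.

(** Words instead of multi-indices, as in [smooth_at]: the order of differentiation matters until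
    symmetry of second derivatives is proved. *)
Definition smooth_on O F := forall q, O q -> forall w, differentiable (Dw w F) q.

Lemma Dw_rcons w a F : Dw (rcons w a) F = Dw w (pder a F).
Proof. by rewrite /Dw foldr_rcons. Qed.

Lemma Dw_cat w1 w2 F : Dw (w1 ++ w2) F = Dw w1 (Dw w2 F).
Proof. by rewrite /Dw foldr_cat. Qed.

Lemma smooth_onS O O' F : O' `<=` O -> smooth_on O F -> smooth_on O' F.
Proof. by move=> sO sF q /sO /sF. Qed.

Lemma smooth_on_pder O a F : smooth_on O F -> smooth_on O (pder a F).
Proof. by move=> sF q Oq w; rewrite -Dw_rcons; exact: sF. Qed.

Lemma smooth_on_Dw O w F : smooth_on O F -> smooth_on O (Dw w F).
Proof. by move=> sF q Oq w'; rewrite -Dw_cat; exact: sF. Qed.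

Lemma smooth_on_diff O F q : smooth_on O F -> O q -> differentiable F q.
Proof. by move=> sF Oq; exact: (sF q Oq [::]). Qed.

(** The linear map with coefficients [c] satisfies the little-o condition, and differentials are
    unique. Later it yields differentiability for germs, coordinates and sums of series. *)
Lemma diff_crit F (c : 'I_4 -> R) p :
  (forall e, 0 < e -> \forall h \near (0 : V4),
     `|F (h + p) - F p - \sum_a h 0 a * c a| <= e * `|h|) ->
  differentiable F p /\ forall a, pder a F p = c a.
Proof.
move=> hF; pose L (v : V4) : R := \sum_a v 0 a * c a.
have L_lin : linear L.
  move=> k u v; rewrite /L scaler_sumr -big_split; apply: eq_bigr => a _ /=.
  by rewrite !mxE mulrDl scalerAl.
pose LM := GRing.isLinear.Build _ _ _ _ L L_lin.
pose LL : {linear V4 -> R} := HB.pack L LM.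
have Lc : continuous LL.
  move=> v; apply: differentiable_continuous.
  rewrite (_ : (LL : V4 -> R) = \sum_a (fun v : V4 => v 0 a * c a)).
    apply: differentiable_sum => a; apply: differentiableM => //.
    exact: differentiable_coord.
  by apply/funext => u; rewrite fct_sumE.
have FL : F \o shift p = cst (F p) + LL +o_ (0 : V4) id.
  apply/eqaddoP => e /hF; apply: filterS => h.
  by rewrite /= opprD addrA.
have dF : differentiable F p.
  apply/diffP => /=.
  (* The differential is a chosen linear map, so one continuous candidate suffices. Its expansion is
     centred at [lim (nbhs p)], which has to be identified with p. *)
  apply: (@getPex _ (fun df : {linear V4 -> R} => continuous df /\
    forall y, F y = F (lim (nbhs p)) + df (y - lim (nbhs p))
                  +o_(y \near p) (y - lim (nbhs p)))).
  suff FLp : F = (fun y => F (lim (nbhs p)) + LL (y - lim (nbhs p)))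
                  +o_ p (center (lim (nbhs p))).
    by exists LL; split=> // y; rewrite {1}FLp.
  apply/eqaddoP => e /hF; rewrite lim_id // (near_shift p); apply: filterS => y /=.
  rewrite sub0r subrK.
  have -> : (F - (fun y => F p + LL (y - p))) y = F y - F p - LL (y - p).
    by rewrite -addrA -opprD.
  exact.
split=> // a; rewrite /pder deriveE // (diff_unique Lc FL) /LL /= /L.
rewrite (bigD1 a) //= big1 ?addr0 => [|b ba]; rewrite !mxE eqxx /= ?eqxx ?mul1r //.
by rewrite (negbTE ba) mul0r.
Qed.

Lemma diff_est F p : differentiable F p -> forall e, 0 < e ->
  \forall h \near (0 : V4),
     `|F (h + p) - F p - \sum_a h 0 a * pder a F p| <= e * `|h|.
Proof.
move=> dF e e0; have /eqaddoP/(_ e e0) := diff_locally dF; apply: filterS => h /=.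
have -> : (F \o shift p - (cst (F p) + 'd F p)) h = F (h + p) - F p - 'd F p h.
  by rewrite -addrA -opprD.
suff -> : 'd F p h = \sum_a h 0 a * pder a F p by [].
rewrite {1}(row_sum_delta h) linear_sum; apply: eq_bigr => a _.
by rewrite linearZ /= /pder deriveE.
Qed.

Lemma near_shift0 p (P : V4 -> Prop) : (\forall q \near p, P q) ->
  \forall h \near (0 : V4), P (h + p).
Proof. rewrite (near_shift 0); apply: filterS => h /=; by rewrite subr0. Qed.

Lemma near_diff F G p : (\near p, F p = G p) -> differentiable F p -> differentiable G p.
Proof.
move=> FG dF; have FGp : F p = G p by apply: (nbhs_singleton FG).
apply: (diff_crit (c := fun a => pder a F p) _).1 => e e0.
have h1 := diff_est dF e0; have h2 := near_shift0 FG.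
by near=> h; rewrite -FGp -(near h2 h) //; near: h.
Unshelve. all: by end_near. Qed.

Lemma pder_near F G p a : (\near p, F p = G p) -> pder a F p = pder a G p.
Proof. exact: near_eq_derive. Qed.

Lemma near_open O p (P : V4 -> Prop) : open O -> O p -> (forall q, O q -> P q) ->
  \forall q \near p, P q.
Proof. by move=> oO Op OP; apply: filterS (open_nbhs_nbhs (conj oO Op)). Qed.

Lemma pder_on O F G a : open O -> (forall q, O q -> F q = G q) ->
  forall q, O q -> pder a F q = pder a G q.
Proof. by move=> oO FG q Oq; apply/pder_near/(near_open oO). Qed.

Lemma Dw_on O F G w : open O -> (forall q, O q -> F q = G q) ->
  forall q, O q -> Dw w F q = Dw w G q.
Proof. by move=> oO FG; elim: w => //= a w IH; apply: pder_on. Qed.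

(** By induction on the word, each iterated derivative of F agrees on O with a member of P, and
    differentiability depends only on the germ. Equality on O is the right strength, since product,
    quotient and chain rules hold only where the functions are differentiable. *)
Lemma smooth_coind O (P : (V4 -> R) -> Prop) : open O ->
  (forall F, P F -> (forall q, O q -> differentiable F q) /\
     forall a, exists2 G, P G & forall q, O q -> pder a F q = G q) ->
  forall F, P F -> smooth_on O F.
Proof.
move=> oO hP F PF q Oq w.
have [G PG FG] : exists2 G, P G & forall q, O q -> Dw w F q = G q.
  elim: w => [|a w [G PG FG]]; first by exists F.
  have [_ /(_ a)[G' PG' GG']] := hP _ PG.
  by exists G' => // z Oz; rewrite -GG' //; apply: (@pder_on O (Dw w F) G a).
apply: (@near_diff G); last exact: (hP _ PG).1.
by apply: (near_open oO Oq) => z /FG.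
Qed.

Lemma pderE F a p : differentiable F p -> pder a F p = 'd F p (E a).
Proof. exact: deriveE. Qed.

Lemma diff_pder F p v : differentiable F p -> 'd F p v = \sum_a v 0 a * pder a F p.
Proof.
move=> dF; rewrite {1}(row_sum_delta v) linear_sum; apply: eq_bigr => a _.
by rewrite linearZ /= pderE.
Qed.

Lemma pderD F G a p : differentiable F p -> differentiable G p ->
  pder a (fun q => F q + G q) p = pder a F p + pder a G p.
Proof. by move=> dF dG; rewrite /pder deriveD //; apply: diff_derivable. Qed.

Lemma pderM F G a p : differentiable F p -> differentiable G p ->
  pder a (fun q => F q * G q) p = pder a F p * G p + F p * pder a G p.
Proof.
move=> dF dG; rewrite /pder deriveM //; try exact: diff_derivable.
by rewrite addrC /GRing.scale /= mulrC.
Qed.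

Lemma pderV F a p : differentiable F p -> F p != 0 ->
  pder a (fun q => (F q)^-1) p = - (F p) ^- 2 * pder a F p.
Proof. by move=> dF F0; rewrite /pder deriveV //; exact: diff_derivable. Qed.

Lemma pder_cst c a p : pder a (fun=> c) p = 0.
Proof. exact: derive_cst. Qed.

Lemma differentiable_row (phi : V4 -> V4) p :
  (forall b, differentiable (fun q => phi q 0 b) p) -> differentiable phi p.
Proof.
move=> dphi.
rewrite (_ : phi = \sum_b (fun q => phi q 0 b *: E b)).
  by apply: differentiable_sum => b; exact: differentiableZl.
by apply/funext => q; rewrite fct_sumE [LHS]row_sum_delta.
Qed.

Lemma pder_coord a b p : pder a (fun q : V4 => q 0 b) p = (a == b)%:R.
Proof.
apply: (diff_crit (c := fun a => (a == b)%:R) _).2 => e e0; near=> h.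
rewrite (bigD1 b) //= big1 => [|i /negbTE ->]; last by rewrite mulr0.
by rewrite eqxx mulr1 addr0 mxE addrK subrr normr0 mulr_ge0 // ltW.
Unshelve. all: by end_near. Qed.

Lemma rowmx_scalar_comp (phi : V4 -> V4) a p :
  (forall b, differentiable (fun q => phi q 0 b) p) ->
  'D_(E a) phi p = \row_b pder a (fun q => phi q 0 b) p.
Proof.
move=> dphi; rewrite derive_mx; last exact/diff_derivable/differentiable_row.
by apply/rowP => b; rewrite !mxE.
Qed.

Lemma pder_comp F (phi : V4 -> V4) a p : differentiable F (phi p) ->
  (forall b, differentiable (fun q => phi q 0 b) p) ->
  pder a (fun q => F (phi q)) p =
    \sum_b pder b F (phi p) * pder a (fun q => phi q 0 b) p.
Proof.
move=> dF dphi; have dp := differentiable_row dphi.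
rewrite pderE; last exact: differentiable_comp.
rewrite (@diff_comp _ _ _ _ phi F) //= -(deriveE _ dp) rowmx_scalar_comp // diff_pder //.
by apply: eq_bigr => b _; rewrite mxE mulrC.
Qed.

(* This class is stable under [pder], hence consists of smooth functions. *)
Inductive smooth_expr O : (V4 -> R) -> Prop :=
| se_gen F : smooth_on O F -> smooth_expr O F
| se_add F G : smooth_expr O F -> smooth_expr O G -> smooth_expr O (fun q => F q + G q)
| se_mul F G : smooth_expr O F -> smooth_expr O G -> smooth_expr O (fun q => F q * G q)
| se_inv F : smooth_expr O F -> (forall q, O q -> F q != 0) ->
    smooth_expr O (fun q => (F q)^-1)
| se_comp O' F (phi : V4 -> V4) : smooth_on O' F ->
    (forall b, smooth_expr O (fun q => phi q 0 b)) -> (forall q, O q -> O' (phi q)) ->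
    smooth_expr O (fun q => F (phi q)).

Lemma smooth_cst O c : smooth_on O (fun=> c).
Proof.
move=> q _ w; suff [c' ->] : exists c', Dw w (fun=> c) = (fun=> c') by [].
elim: w => [|a w [c' ih]]; first by exists c.
exists 0; rewrite /= /Dw /= in ih *; rewrite ih; apply/funext => z; exact: pder_cst.
Qed.

Lemma smooth_coord O b : smooth_on O (fun q => q 0 b).
Proof.
move=> q Oq; elim/last_ind => [|w a _]; first exact: differentiable_coord.
rewrite Dw_rcons (_ : pder a _ = fun=> (a == b)%:R).
  exact: (@smooth_cst setT).
by apply/funext => z; rewrite pder_coord.
Qed.

Lemma smooth_expr_diff O F : smooth_expr O F -> forall q, O q -> differentiable F q.
Proof.
elim=> {F} [F sF q Oq|F G _ dF _ dG q Oq|F G _ dF _ dG q Oq|F _ dF F0 q Oq|].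
- exact: smooth_on_diff Oq.
- by apply: differentiableD; [exact: dF|exact: dG].
- by apply: differentiableM; [exact: dF|exact: dG].
- by apply: differentiableV; [exact: dF|exact: F0].
move=> O' F phi sF _ dphi OO' q Oq; apply: (@differentiable_comp _ _ _ _ phi F).
  by apply: differentiable_row => b; exact: dphi.
by apply: smooth_on_diff sF _; exact: OO'.
Qed.

Lemma smooth_expr_sum O n (F : 'I_n -> V4 -> R) :
  (forall i, smooth_expr O (F i)) -> smooth_expr O (fun q => \sum_i F i q).
Proof.
elim: n F => [|n IH] F sF.
  rewrite (_ : (fun q => _) = fun=> 0); first exact/se_gen/smooth_cst.
  by apply/funext => q; rewrite big_ord0.
rewrite (_ : (fun q => _) = fun q => F ord0 q + \sum_i F (lift ord0 i) q).
  by apply: se_add => //; exact: IH.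
by apply/funext => q; rewrite big_ord_recl.
Qed.

Lemma smooth_exprP O F : open O -> smooth_expr O F -> smooth_on O F.
Proof.
move=> oO; apply: (smooth_coind oO) => {}F sF; split=> [|a]; first exact: smooth_expr_diff.
elim: sF => {F} [F sF|F G sF [F' sF' FF'] sG [G' sG' GG']|
    F G sF [F' sF' FF'] sG [G' sG' GG']|F sF [F' sF' FF'] F0|].
- by exists (pder a F) => //; exact/se_gen/smooth_on_pder.
- exists (fun q => F' q + G' q) => [|q Oq]; first exact: se_add.
  rewrite pderD ?FF' ?GG' //; exact: smooth_expr_diff Oq.
- exists (fun q => F' q * G q + F q * G' q) => [|q Oq].
    by apply: se_add; apply: se_mul.
  rewrite pderM ?FF' ?GG' //; exact: smooth_expr_diff Oq.
- exists (fun q => -1 * ((F q)^-1 * (F q)^-1) * F' q) => [|q Oq].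
    apply: se_mul => //; apply: se_mul; first exact/se_gen/smooth_cst.
    by apply: se_mul; apply: se_inv.
  rewrite pderV ?FF' ?F0 //; last exact: smooth_expr_diff Oq.
  by rewrite mulN1r -invfM expr2.
move=> O' F phi sF sphi ih OO'.
have /choice[G hG] b : exists G, smooth_expr O G /\
    forall q, O q -> pder a (fun q0 => phi q0 0 b) q = G q.
  by have [G ? ?] := ih b; exists G.
exists (fun q => \sum_b pder b F (phi q) * G b q) => [|q Oq].
  apply: smooth_expr_sum => b; apply: se_mul; last exact: (hG b).1.
  by apply: se_comp OO' => //; exact: smooth_on_pder.
rewrite pder_comp; last 2 first.
- by apply: smooth_on_diff sF _; exact: OO'.
- by move=> b; apply: smooth_expr_diff Oq.
by apply: eq_bigr => b _; rewrite (hG b).2.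
Qed.

Lemma smoothD O F G : open O -> smooth_on O F -> smooth_on O G ->
  smooth_on O (fun q => F q + G q).
Proof. by move=> oO sF sG; apply/smooth_exprP/se_add/se_gen => //; exact: se_gen. Qed.

Lemma smoothM O F G : open O -> smooth_on O F -> smooth_on O G ->
  smooth_on O (fun q => F q * G q).
Proof. by move=> oO sF sG; apply/smooth_exprP/se_mul/se_gen => //; exact: se_gen. Qed.

Lemma smoothV O F : open O -> smooth_on O F -> (forall q, O q -> F q != 0) ->
  smooth_on O (fun q => (F q)^-1).
Proof. by move=> oO sF F0; apply/smooth_exprP => //; apply: se_inv => //; exact: se_gen. Qed.

Lemma smooth_comp O O' F (phi : V4 -> V4) : open O -> smooth_on O' F ->
  (forall b, smooth_on O (fun q => phi q 0 b)) -> (forall q, O q -> O' (phi q)) ->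
  smooth_on O (fun q => F (phi q)).
Proof.
move=> oO sF sphi OO'; apply/smooth_exprP => //; apply: (se_comp sF) => // b.
exact: se_gen.
Qed.

Lemma smooth_sum O n (F : 'I_n -> V4 -> R) : open O ->
  (forall i, smooth_on O (F i)) -> smooth_on O (fun q => \sum_i F i q).
Proof. by move=> oO sF; apply/smooth_exprP/smooth_expr_sum => // i; exact: se_gen. Qed.

Lemma smooth_ext O F G : open O -> (forall q, O q -> F q = G q) ->
  smooth_on O F -> smooth_on O G.
Proof.
move=> oO FG sF q Oq w; apply: near_diff (sF q Oq w).
by apply: (near_open oO Oq) => z Oz; apply: (Dw_on _ oO FG).
Qed.

Lemma smooth_on_cont O F q : smooth_on O F -> O q -> {for q, continuous F}.
Proof. by move=> sF Oq; apply: differentiable_continuous; exact: smooth_on_diff Oq. Qed.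

(** * Mean values and symmetry of second derivatives *)

Lemma is_derive_line F (p v : V4) (t : R) : differentiable F (p + t *: v) ->
  is_derive t 1 (fun s : R => F (p + s *: v)) (\sum_a v 0 a * pder a F (p + t *: v)).
Proof.
move=> dF.
have dl : is_diff t (fun s : R => p + s *: v) (fun s => s *: v).
  by apply: (is_diff_eq (is_diffD _ _)); rewrite add0r.
have dFF : is_diff (p + t *: v) F ('d F (p + t *: v)) by apply: differentiableP.
have := @is_diff_comp _ _ _ _ (fun s : R => p + s *: v) (fun s => s *: v) F _ t dl dFF.
move=> [d1 d2]; apply: DeriveDef; first exact/derivable1_diffP.
by rewrite deriveE // d2 /= scale1r diff_pder.
Qed.

Lemma MVT_line F (p v : V4) : (forall t, t \in `[0, 1] -> differentiable F (p + t *: v)) ->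
  exists2 t, t \in `[0, 1] &
    F (p + v) - F p = \sum_a v 0 a * pder a F (p + t *: v).
Proof.
move=> dF.
have [||t t01] := @MVT_segment R (fun s => F (p + s *: v))
   (fun t => \sum_a v 0 a * pder a F (p + t *: v)) 0 1 ler01.
- by move=> t t01; apply: is_derive_line; apply: dF; exact: subset_itv_oo_cc.
- apply: continuous_in_subspaceT => t; rewrite inE => t01.
  apply: differentiable_continuous; apply/derivable1_diffP.
  by case: (is_derive_line (dF t t01)).
by rewrite scale1r scale0r addr0 subr0 mulr1 => h; exists t.
Qed.

Lemma differentiable_shift (v p : V4) : differentiable (fun q : V4 => q + v) p.
Proof.
apply: differentiable_row => b.
rewrite (_ : (fun q : V4 => _) = (fun q : V4 => q 0 b + v 0 b)).
  apply: differentiableD; [exact: differentiable_coord|exact: differentiable_cst].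
by apply/funext => q; rewrite mxE.
Qed.

Lemma cont_near F q e : {for q, continuous F} -> 0 < e ->
  \forall z \near q, `|F q - F z| < e.
Proof. by move/cvgrPdist_lt; apply. Qed.

Lemma pder_shift F a (v p : V4) : differentiable F (p + v) ->
  pder a (fun q => F (q + v)) p = pder a F (p + v).
Proof.
move=> dF; have dc b : differentiable (fun q : V4 => (q + v) 0 b) p.
  rewrite (_ : (fun q : V4 => _) = (fun q : V4 => q 0 b + v 0 b)).
    apply: differentiableD; [exact: differentiable_coord|exact: differentiable_cst].
  by apply/funext => q; rewrite mxE.
rewrite (@pder_comp F (fun q => q + v)) // (bigD1 a) //= big1 ?addr0 => [|b ba].
  rewrite (_ : (fun q : V4 => _) = (fun q : V4 => q 0 a + v 0 a)).
    rewrite pderD ?pder_coord ?pder_cst ?eqxx ?addr0 ?mulr1 //.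
    exact: differentiable_coord.
  by apply/funext => q; rewrite mxE.
rewrite (_ : (fun q : V4 => _) = (fun q : V4 => q 0 b + v 0 b)).
  rewrite pderD ?pder_coord ?pder_cst 1?eq_sym ?(negbTE ba) ?addr0 ?mulr0 //.
  exact: differentiable_coord.
by apply/funext => q; rewrite mxE.
Qed.

(** Mean value theorem twice: along a for the increment F(x + h E_b) - F(x), then along b for the
    derivative of F along a. *)
Lemma second_difference O F a b q (h : R) : smooth_on O F ->
  (forall t s, t \in `[0, 1] -> s \in `[0, 1] ->
     O (q + t *: (h *: E a) + s *: (h *: E b))) ->
  exists t s, [/\ t \in `[0, 1], s \in `[0, 1] &
   F (q + h *: E a + h *: E b) - F (q + h *: E b) - F (q + h *: E a) + F q =
   h ^+ 2 * pder b (pder a F) (q + t *: (h *: E a) + s *: (h *: E b))].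
Proof.
move=> sF OO; pose P x := F (x + h *: E b) - F x.
have i0 : (0 : R) \in `[0, 1] by rewrite in_itv /= lexx ler01.
have i1 : (1 : R) \in `[0, 1] by rewrite in_itv /= lexx ler01.
have d1 t : t \in `[0, 1] -> differentiable (fun x => F (x + h *: E b)) (q + t *: (h *: E a)).
  move=> ti; apply: (@differentiable_comp _ _ _ _ (fun x : V4 => x + h *: E b) F).
    exact: differentiable_shift.
  by apply: smooth_on_diff sF _; have := OO _ _ ti i1; rewrite scale1r.
have d2 t : t \in `[0, 1] -> differentiable F (q + t *: (h *: E a)).
  by move=> ti; apply: smooth_on_diff sF _; have := OO _ _ ti i0; rewrite scale0r addr0.
have sumE (c : 'I_4) (X : 'I_4 -> R) : \sum_i (h *: E c : V4) 0 i * X i = h * X c.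
  rewrite (bigD1 c) //= big1 ?addr0 => [|i ic]; rewrite !mxE eqxx /= ?eqxx ?mulr1 //.
  by rewrite (negbTE ic) mulr0 mul0r.
have [|t ti] := @MVT_line P q (h *: E a).
  by move=> t ti; apply: differentiableB; [exact: d1|exact: d2].
rewrite sumE => hP.
have [|s si] := @MVT_line (pder a F) (q + t *: (h *: E a)) (h *: E b).
  by move=> s si; apply: smooth_on_diff (smooth_on_pder a sF) _; exact: OO.
rewrite sumE => hQ; exists t, s; split=> //.
rewrite expr2 -mulrA -hQ; transitivity (P (q + h *: E a) - P q); first by rewrite /P; ring.
rewrite hP; congr (_ * _); rewrite /P /pder deriveB; last 2 first.
- by apply: diff_derivable; exact: d1.
- by apply: diff_derivable; exact: d2.
rewrite -[X in X - _ = _]/(pder a _ _) pder_shift //.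
by apply: smooth_on_diff sF _; have := OO _ _ ti i1; rewrite scale1r.
Qed.

Lemma dist_half_absurd (a b x y : R) :
  `|a - x| < `|a - b| / 2 -> `|b - y| < `|a - b| / 2 -> y = x -> False.
Proof.
move=> h1 h2 yx; have := ltrD h1 h2; rewrite -splitr yx (distrC b).
by move/(le_lt_trans (ler_distD x a b)); rewrite ltxx.
Qed.

(** The second difference over a small parallelogram is symmetric in a and b, and is h^2 times
    either mixed derivative at some nearby point. If these derivatives differed at q, continuity
    would keep them apart on a ball. *)
Lemma pderC O F a b q : open O -> smooth_on O F -> O q ->
  pder a (pder b F) q = pder b (pder a F) q.
Proof.
move=> oO sF Oq; apply/eqP; rewrite -subr_eq0; apply/negPn/negP => n0.
set g := pder a (pder b F) in n0 *; set k := pder b (pder a F) in n0 *.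
pose e := `|g q - k q| / 2; have e0 : 0 < e by rewrite divr_gt0 ?normr_gt0.
have gc : {for q, continuous g}.
  by apply: smooth_on_cont Oq; do 2!apply: smooth_on_pder.
have kc : {for q, continuous k}.
  by apply: smooth_on_cont Oq; do 2!apply: smooth_on_pder.
have /nbhs_ballP[r /= r0 hr] : \forall z \near q, [/\ O z, `|g q - g z| < e & `|k q - k z| < e].
  have h1 : \forall z \near q, O z by exact: (open_nbhs_nbhs (conj oO Oq)).
  have h2 : \forall z \near q, `|g q - g z| < e by exact: cont_near.
  have h3 : \forall z \near q, `|k q - k z| < e by exact: cont_near.
  exact: filterS3 (fun z a b c => And3 a b c) h1 h2 h3.
(* With h = r / m the whole parallelogram lies in the ball of radius r; the summand 1 makes the
   inequality strict. *)
pose m : R := `|E a| + `|E b| + 1.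
have m0 : 0 < m by rewrite ltr_wpDl // addr_ge0.
have [h h0 hm] : exists2 h, 0 < h & h * m = r.
  by exists (r / m); [rewrite divr_gt0|rewrite divfK ?gt_eqF].
have inr c d t s : t \in `[0, 1] -> s \in `[0, 1] -> `|E c| + `|E d| + 1 = m ->
    ball q r (q + t *: (h *: E c) + s *: (h *: E d)).
  rewrite !in_itv /= => /andP[t0 t1] /andP[s0 s1] mE.
  rewrite -ball_normE /ball_ /= opprD opprD addrA addrA subrr sub0r -opprD normrN.
  apply: le_lt_trans (ler_normD _ _) _; rewrite !normrZ !ger0_norm ?(ltW h0) //.
  apply: (@le_lt_trans _ _ (h * (`|E c| + `|E d|))).
    by rewrite mulrDr lerD // ler_piMl // (mulr_ge0 (ltW h0)).
  by rewrite -hm ltr_pM2l // -mE ltrDl.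
have [|t [s [ti si E1]]] := @second_difference O F a b q h sF.
  by move=> t s ti si; case: (hr _ (inr a b t s ti si erefl)).
have [|t' [s' [ti' si' E2]]] := @second_difference O F b a q h sF.
  by move=> x y xi yi; case: (hr _ (inr b a x y xi yi _)); rewrite // /m (addrC `|E b|).
have [_ _ hk] := hr _ (inr a b t s ti si erefl).
have [|_ hg _] := hr _ (inr b a t' s' ti' si' _); first by rewrite /m (addrC `|E b|).
have : k (q + t *: (h *: E a) + s *: (h *: E b)) =
       g (q + t' *: (h *: E b) + s' *: (h *: E a)).
  have h2 : h ^+ 2 != 0 by rewrite expf_neq0 // gt_eqF.
  apply: (mulfI h2); apply: etrans (esym E1) _; apply: etrans E2.
  by rewrite (addrAC q (h *: E b)); congr (_ + _); exact: addrAC.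
exact: dist_half_absurd hg hk.
Qed.

Lemma pder_Dw O F a w q : open O -> smooth_on O F -> O q ->
  pder a (Dw w F) q = Dw w (pder a F) q.
Proof.
move=> oO sF; elim: w q => // b w IH q Oq.
rewrite /= (@pderC O) //; last exact: smooth_on_Dw.
exact: (@pder_on O _ (Dw w (pder a F))).
Qed.

Lemma pder_midx4 al F : pder_midx al F =
  iter (al iu) (pder iu) (iter (al ix1) (pder ix1)
    (iter (al ix2) (pder ix2) (iter (al iv) (pder iv) F))).
Proof.
rewrite /pder_midx; have -> : enum 'I_4 = [:: iu; ix1; ix2; iv] by
  rewrite !enum_ordSl enum_ord0 /=; congr [:: _; _; _; _]; apply/val_inj.
by [].
Qed.

Lemma iter_pder n a F : iter n (pder a) F = Dw (nseq n a) F.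
Proof. by elim: n => //= n ->. Qed.

(** The letters come in the order of the fold in [pder_midx], so both notions of iterated derivative
    agree without any symmetry of derivatives. *)
Definition wd (al : midx) : seq 'I_4 :=
  nseq (al iu) iu ++ nseq (al ix1) ix1 ++ nseq (al ix2) ix2 ++ nseq (al iv) iv.

Lemma pder_midxE al F : pder_midx al F = Dw (wd al) F.
Proof. by rewrite pder_midx4 !iter_pder /wd !Dw_cat. Qed.

Lemma big_ord4 (T : Type) (idx : T) (op : Monoid.law idx) (f : 'I_4 -> T) :
  \big[op/idx]_a f a = op (f iu) (op (f ix1) (op (f ix2) (f iv))).
Proof.
rewrite !big_ord_recl big_ord0 Monoid.mulm1.
by congr (op (f _) (op (f _) (op (f _) (f _)))); apply/val_inj.
Qed.

Lemma size_wd al : size (wd al) = midx_order al.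
Proof. by rewrite /wd !size_cat !size_nseq /midx_order big_ord4. Qed.

Lemma ord4P (a : 'I_4) : [\/ a = iu, a = ix1, a = ix2 | a = iv].
Proof.
case: a => [[|[|[|[|//]]]] i].
- by constructor 1; apply/val_inj.
- by constructor 2; apply/val_inj.
- by constructor 3; apply/val_inj.
- by constructor 4; apply/val_inj.
Qed.

Lemma pder_midxS O F a al q : open O -> smooth_on O F -> O q ->
  pder a (pder_midx al F) q = pder_midx (midxS a al) F q.
Proof.
move=> oO sF Oq; rewrite !pder_midx4 !ffunE.
have sD w : smooth_on O (Dw w F) by exact: smooth_on_Dw.
rewrite !iter_pder; case: (ord4P a) => ->; rewrite /= ?addn0 ?addn1 //.
- by rewrite (@pder_Dw O) // -!Dw_cat.
- by rewrite -(Dw_cat (nseq _ iu)) (@pder_Dw O) ?Dw_cat // -!Dw_cat.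
- rewrite -(Dw_cat (nseq _ ix1)) -(Dw_cat (nseq _ iu)) (@pder_Dw O) ?Dw_cat //.
Qed.

(** * Agreement of jets at a point *)

(** The bound is strict: [eqjet k] compares jets of order k - 1, and [eqjet 0] is vacuous, which
    starts the inductions. *)
Definition eqjet (k : nat) p F G := forall w, (size w < k)%N -> Dw w F p = Dw w G p.

Lemma eqjetW k k' p F G : (k <= k')%N -> eqjet k' p F G -> eqjet k p F G.
Proof. by move=> kk h w wk; apply: h; exact: leq_trans wk kk. Qed.

Lemma eqjet_refl k p F : eqjet k p F F. Proof. by []. Qed.

Lemma eqjet_sym k p F G : eqjet k p F G -> eqjet k p G F.
Proof. by move=> h w wk; rewrite h. Qed.

Lemma eqjet_trans k p F G H : eqjet k p F G -> eqjet k p G H -> eqjet k p F H.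
Proof. by move=> h1 h2 w wk; rewrite h1 // h2. Qed.

Lemma eqjetS k p F G : eqjet k.+1 p F G <->
  F p = G p /\ forall a, eqjet k p (pder a F) (pder a G).
Proof.
split=> [h|[h0 h] w].
  by split=> [|a w wk]; [exact: (h [::])|rewrite -!Dw_rcons h // size_rcons].
by case/lastP: w => // w a; rewrite size_rcons !Dw_rcons => wk; exact: h.
Qed.

Lemma eqjet0 k p F G : eqjet k.+1 p F G -> F p = G p.
Proof. by move=> h; exact: (h [::]). Qed.

Lemma eqjet_ext O k p F G : open O -> O p -> (forall q, O q -> F q = G q) -> eqjet k p F G.
Proof. by move=> oO Op FG w _; exact: (Dw_on _ oO FG). Qed.

Lemma eqjet_pder k p a F G : eqjet k.+1 p F G -> eqjet k p (pder a F) (pder a G).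
Proof. by case/eqjetS => _; apply. Qed.

Lemma eqjetD O k p F G F' G' : open O -> O p ->
  smooth_on O F -> smooth_on O G -> smooth_on O F' -> smooth_on O G' ->
  eqjet k p F F' -> eqjet k p G G' -> eqjet k p (fun q => F q + G q) (fun q => F' q + G' q).
Proof.
move=> oO Op; elim: k F G F' G' => // k IH F G F' G' sF sG sF' sG'.
move=> /eqjetS[F0 F1] /eqjetS[G0 G1]; apply/eqjetS; rewrite F0 G0; split=> // a.
apply: (@eqjet_trans _ _ _ (fun q => pder a F q + pder a G q)).
  apply: (@eqjet_ext O) => // q Oq; apply: pderD; exact: smooth_on_diff Oq.
apply: (@eqjet_trans _ _ _ (fun q => pder a F' q + pder a G' q)).
  by apply: IH => //; exact: smooth_on_pder.
apply/eqjet_sym/(@eqjet_ext O) => // q Oq; apply: pderD; exact: smooth_on_diff Oq.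
Qed.

Lemma eqjetM O k p F G F' G' : open O -> O p ->
  smooth_on O F -> smooth_on O G -> smooth_on O F' -> smooth_on O G' ->
  eqjet k p F F' -> eqjet k p G G' -> eqjet k p (fun q => F q * G q) (fun q => F' q * G' q).
Proof.
move=> oO Op; elim: k F G F' G' => // k IH F G F' G' sF sG sF' sG' FF GG.
move/eqjetS: (FF) => [F0 F1]; move/eqjetS: (GG) => [G0 G1].
apply/eqjetS; rewrite F0 G0; split=> // a.
have sp := smooth_on_pder a.
apply: (@eqjet_trans _ _ _ (fun q => pder a F q * G q + F q * pder a G q)).
  apply: (@eqjet_ext O) => // q Oq; apply: pderM; exact: smooth_on_diff Oq.
apply: (@eqjet_trans _ _ _ (fun q => pder a F' q * G' q + F' q * pder a G' q)).
  apply: (eqjetD oO) => //; try by apply: smoothM => //; exact: sp.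
    by apply: IH => //; [exact: sp|exact: sp|exact: eqjetW GG].
  by apply: IH => //; [exact: sp|exact: sp|exact: eqjetW FF].
apply/eqjet_sym/(@eqjet_ext O) => // q Oq; apply: pderM; exact: smooth_on_diff Oq.
Qed.

Lemma Dw_add O w p F G : open O -> O p -> smooth_on O F -> smooth_on O G ->
  Dw w (fun q => F q + G q) p = Dw w F p + Dw w G p.
Proof.
move=> oO Op sF sG; elim: w p Op => // a w IH p Op /=.
rewrite (@pder_on O _ (fun q => Dw w F q + Dw w G q)) //.
by apply: pderD; apply: smooth_on_diff Op; exact: smooth_on_Dw.
Qed.

Lemma Dw_cst w c p : (0 < size w)%N -> Dw w (fun=> c) p = 0.
Proof.
case/lastP: w => // w a _; rewrite Dw_rcons (_ : pder a _ = fun=> 0).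
  elim: w p => // b w IH p; rewrite /= (_ : Dw w _ = fun=> 0) ?pder_cst //.
  by apply/funext => q.
by apply/funext => q; rewrite pder_cst.
Qed.

Lemma Dw_scale O w p c F : open O -> O p -> smooth_on O F ->
  Dw w (fun q => c * F q) p = c * Dw w F p.
Proof.
move=> oO Op sF; elim: w p Op => // a w IH p Op /=.
rewrite (@pder_on O _ (fun q => c * Dw w F q)) //.
rewrite pderM ?pder_cst ?mul0r ?add0r //.
by apply: smooth_on_diff Op; exact: smooth_on_Dw.
Qed.

Lemma Dw_sum O w p n (F : 'I_n -> V4 -> R) : open O -> O p ->
  (forall i, smooth_on O (F i)) ->
  Dw w (fun q => \sum_i F i q) p = \sum_i Dw w (F i) p.
Proof.
move=> oO Op; elim: n F => [|n IH] F sF.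
  rewrite big_ord0 (@Dw_on O _ (fun=> 0)) //.
    case: w => [//|a w]; exact: Dw_cst.
  by move=> q _; rewrite big_ord0.
rewrite big_ord_recl -IH //.
rewrite -(@Dw_add O) //; last exact: smooth_sum.
by apply: (Dw_on _ oO) => // q Oq; rewrite big_ord_recl.
Qed.

(** In the Leibniz expansion only f times the full derivative of g sees order k of g; on all other
    terms the two products agree. *)
Lemma Dw_mul_top O k p f g f' g' w : open O -> O p ->
  smooth_on O f -> smooth_on O g -> smooth_on O f' -> smooth_on O g' ->
  eqjet k.+1 p f f' -> eqjet k p g g' -> size w = k ->
  Dw w (fun q => f q * g q) p - Dw w (fun q => f' q * g' q) p =
  f p * (Dw w g p - Dw w g' p).
Proof.
move=> oO Op; elim: k f g f' g' w => [|k IH] f g f' g' w sf sg sf' sg' ff gg.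
  by move/size0nil => ->; rewrite /= (eqjet0 ff) // mulrBr.
case/lastP: w => // w a; rewrite size_rcons => -[wk]; rewrite !Dw_rcons.
have sp := smooth_on_pder a.
have E1 F G : smooth_on O F -> smooth_on O G -> Dw w (pder a (fun q => F q * G q)) p =
    Dw w (fun q => pder a F q * G q) p + Dw w (fun q => F q * pder a G q) p.
  move=> sF sG; rewrite -(@Dw_add O) //; try by apply: smoothM => //; exact: sp.
  by apply: (Dw_on _ oO) => // q Oq; apply: pderM; exact: smooth_on_diff Oq.
rewrite !E1 // (@eqjetM O k.+1 p (pder a f) g (pder a f') g') ?wk //;
  try exact: sp; last exact: eqjet_pder.
rewrite opprD addrACA subrr add0r; apply: IH => //; try exact: sp.
- exact: eqjetW ff.
- exact: eqjet_pder.
Qed.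

Lemma eqjet_comp O O' k p F F' (phi phi' : V4 -> V4) : open O -> open O' -> O p ->
  smooth_on O' F -> smooth_on O' F' ->
  (forall b, smooth_on O (fun q => phi q 0 b)) ->
  (forall b, smooth_on O (fun q => phi' q 0 b)) ->
  (forall q, O q -> O' (phi q)) -> (forall q, O q -> O' (phi' q)) ->
  phi' p = phi p -> eqjet k (phi p) F F' ->
  (forall b, eqjet k p (fun q => phi q 0 b) (fun q => phi' q 0 b)) ->
  eqjet k p (fun q => F (phi q)) (fun q => F' (phi' q)).
Proof.
move=> oO oO' Op + + sphi sphi' hO hO' pp; elim: k F F' => // k IH F F' sF sF' FF ee.
move/eqjetS: (FF) => [F0 F1]; apply/eqjetS; split=> [|a]; first by rewrite pp.
have ext G (psi : V4 -> V4) : smooth_on O' G -> (forall b, smooth_on O (fun q => psi q 0 b)) ->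
    (forall q, O q -> O' (psi q)) ->
    eqjet k p (pder a (fun q => G (psi q)))
      (fun q => \sum_b pder b G (psi q) * pder a (fun q => psi q 0 b) q).
  move=> sG sps hps; apply: (@eqjet_ext O) => // q Oq; apply: pder_comp.
    by apply: (smooth_on_diff sG); exact: hps.
  by move=> b; exact: smooth_on_diff (sps b) Oq.
apply: eqjet_trans (ext F phi sF sphi hO) _.
apply/eqjet_sym/(eqjet_trans (ext F' phi' sF' sphi' hO'))/eqjet_sym.
have sm G (psi : V4 -> V4) b : smooth_on O' G -> (forall b, smooth_on O (fun q => psi q 0 b)) ->
    (forall q, O q -> O' (psi q)) ->
    smooth_on O (fun q => pder b G (psi q) * pder a (fun q => psi q 0 b) q).
  move=> sG sps hps; apply: smoothM => //; last exact/smooth_on_pder.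
  exact: (smooth_comp oO (smooth_on_pder b sG)).
move=> w wk; rewrite !(@Dw_sum O) //; try by move=> b; exact: sm.
apply: eq_bigr => b _; apply: (eqjetM oO Op _ _ _ _ _ _ wk).
- exact: (smooth_comp oO (smooth_on_pder b sF)).
- exact/smooth_on_pder.
- exact: (smooth_comp oO (smooth_on_pder b sF')).
- exact/smooth_on_pder.
- apply: IH; [exact: smooth_on_pder|exact: smooth_on_pder|exact: F1|].
  by move=> c; apply: eqjetW (ee c).
- exact: eqjet_pder.
Qed.

(** The top derivatives of the inner map enter a composite linearly, with the gradient of F as
    coefficients. This turns the normalization of jets into linear systems. *)
Lemma Dw_comp_top O O' k p F (phi phi' : V4 -> V4) w : open O -> open O' -> O p ->
  smooth_on O' F ->
  (forall b, smooth_on O (fun q => phi q 0 b)) ->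
  (forall b, smooth_on O (fun q => phi' q 0 b)) ->
  (forall q, O q -> O' (phi q)) -> (forall q, O q -> O' (phi' q)) ->
  (forall b, eqjet k.+1 p (fun q => phi q 0 b) (fun q => phi' q 0 b)) ->
  size w = k.+1 ->
  Dw w (fun q => F (phi q)) p - Dw w (fun q => F (phi' q)) p =
  \sum_b pder b F (phi p) *
    (Dw w (fun q => phi q 0 b) p - Dw w (fun q => phi' q 0 b) p).
Proof.
move=> oO oO' Op sF sphi sphi' hO hO' ee.
have pp : phi' p = phi p by apply/rowP => b; rewrite (eqjet0 (ee b)).
case/lastP: w => // w a; rewrite size_rcons => -[wk]; rewrite !Dw_rcons.
have ext (psi : V4 -> V4) : (forall b, smooth_on O (fun q => psi q 0 b)) ->
    (forall q, O q -> O' (psi q)) ->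
    Dw w (pder a (fun q => F (psi q))) p =
      \sum_b Dw w (fun q => pder b F (psi q) * pder a (fun q => psi q 0 b) q) p.
  move=> sps hps; rewrite -(@Dw_sum O) //.
    apply: (Dw_on _ oO) => // q Oq; apply: pder_comp.
      by apply: (smooth_on_diff sF); exact: hps.
    by move=> b; exact: smooth_on_diff (sps b) Oq.
  move=> b; apply: smoothM => //; last exact/smooth_on_pder.
  exact: (smooth_comp oO (smooth_on_pder b sF)).
rewrite !ext // -sumrB; apply: eq_bigr => b _; rewrite !Dw_rcons.
apply: (Dw_mul_top oO Op _ _ _ _ _ _ wk).
- exact: (smooth_comp oO (smooth_on_pder b sF)).
- exact/smooth_on_pder.
- exact: (smooth_comp oO (smooth_on_pder b sF)).
- exact/smooth_on_pder.
- exact: (eqjet_comp oO oO' Op (smooth_on_pder b sF) (smooth_on_pder b sF)).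
- exact: eqjet_pder.
Qed.

End Smooth.

Section Borel.
Variable R : realType.
Notation V4 := 'rV[R]_4.
Notation E a := (delta_mx 0 a : V4).
Implicit Types (F G T : V4 -> R) (O : set V4) (p q : V4) (w : seq 'I_4).

(** * Borel's theorem *)

Definition wcnt w : midx := [ffun a => count_mem a w].

Lemma wcnt_cons a w : wcnt (a :: w) = midxS a (wcnt w).
Proof. by apply/ffunP => b; rewrite !ffunE /= addnC eq_sym. Qed.

Lemma wcnt_rcons a w : wcnt (rcons w a) = midxS a (wcnt w).
Proof. by apply/ffunP => b; rewrite !ffunE -cats1 count_cat /= addn0 eq_sym. Qed.

Lemma wcnt_nil : wcnt [::] = midx0.
Proof. by apply/ffunP => b; rewrite !ffunE. Qed.

Lemma midx_orderS a al : midx_order (midxS a al) = (midx_order al).+1.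
Proof.
rewrite /midx_order (eq_bigr (fun b => al b + (b == a))%N); last by move=> b _; rewrite ffunE.
rewrite big_split /=; have -> : (\sum_(b < 4) (b == a) = 1)%N; last by rewrite addn1.
by rewrite (bigD1 a) //= eqxx big1 // => b ba; rewrite (negbTE ba).
Qed.

Lemma midx_order_wcnt w : midx_order (wcnt w) = size w.
Proof.
elim: w => [|a w IH]; last by rewrite wcnt_cons midx_orderS IH.
by rewrite wcnt_nil /midx_order big1 // => a _; rewrite ffunE.
Qed.

Lemma wcnt_wd al : wcnt (wd al) = al.
Proof.
apply/ffunP => b; rewrite ffunE /wd !count_cat !count_nseq /=.
by case: (ord4P b) => ->; rewrite /= ?mul0n ?mul1n ?addn0.
Qed.

Lemma Dw_wcnt O F w q : open O -> smooth_on O F -> O q ->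
  Dw w F q = pder_midx (wcnt w) F q.
Proof.
move=> oO sF; elim: w q => [|a w IH] q Oq.
  by rewrite wcnt_nil pder_midx4 !ffunE.
by rewrite /= wcnt_cons -(@pder_midxS _ O) //; apply: (@pder_on _ O).
Qed.

Lemma Dw_wd O F w q : open O -> smooth_on O F -> O q ->
  Dw w F q = Dw (wd (wcnt w)) F q.
Proof. by move=> oO sF Oq; rewrite -pder_midxE (@Dw_wcnt O). Qed.

(** Bounds on all of R^4 allow Borel's series to be summed without cutoff functions. *)
Definition nice F := smooth_on setT F /\ forall w, exists B, forall q, `|Dw w F q| <= B.

Lemma nice_bound F w : nice F -> exists2 B, 0 <= B & forall q, `|Dw w F q| <= B.
Proof.
case=> _ /(_ w)[B hB]; exists B => //; exact: le_trans (normr_ge0 _) (hB 0).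
Qed.

Lemma nice_pder a F : nice F -> nice (pder a F).
Proof.
move=> [sF bF]; split=> [|w]; first exact: smooth_on_pder.
by have [B hB] := bF (rcons w a); exists B => q; rewrite -Dw_rcons.
Qed.

Let oT : open (@setT V4) := openT.

Lemma niceD F G : nice F -> nice G -> nice (fun q => F q + G q).
Proof.
move=> [sF bF] [sG bG]; split=> [|w]; first exact: smoothD.
have [B hB] := bF w; have [C hC] := bG w; exists (B + C) => q.
by rewrite (@Dw_add _ setT) // (le_trans (ler_normD _ _)) // lerD.
Qed.

Lemma niceM F G : nice F -> nice G -> nice (fun q => F q * G q).
Proof.
move=> nF nG; split=> [|w]; first by apply: smoothM => //; [exact: nF.1|exact: nG.1].
elim/last_ind: w F G nF nG => [|w a IH] F G nF nG.
  have [B B0 hB] := nice_bound [::] nF; have [C C0 hC] := nice_bound [::] nG.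
  by exists (B * C) => q; rewrite /= normrM ler_pM.
have [B hB] := IH _ _ (nice_pder a nF) nG; have [C hC] := IH _ _ nF (nice_pder a nG).
exists (B + C) => q; rewrite Dw_rcons.
rewrite (@Dw_on _ setT _ (fun q => pder a F q * G q + F q * pder a G q)) //; last first.
  by move=> z _; apply: pderM; [exact: smooth_on_diff nF.1 _|exact: smooth_on_diff nG.1 _].
rewrite (@Dw_add _ setT) //; last 2 first.
- by apply: smoothM => //; [exact: (nice_pder a nF).1|exact: nG.1].
- by apply: smoothM => //; [exact: nF.1|exact: (nice_pder a nG).1].
by rewrite (le_trans (ler_normD _ _)) // lerD.
Qed.

Lemma nice_cst c : nice (fun=> c).
Proof.
split=> [|[|a w]]; first exact: smooth_cst.
  by exists `|c| => q; rewrite /=.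
by exists 0 => q; rewrite Dw_cst // normr0.
Qed.

Lemma nice_sum n (F : 'I_n -> V4 -> R) : (forall i, nice (F i)) ->
  nice (fun q => \sum_i F i q).
Proof.
elim: n F => [|n IH] F nF.
  rewrite (_ : (fun q => _) = fun=> 0); first exact: nice_cst.
  by apply/funext => q; rewrite big_ord0.
rewrite (_ : (fun q => _) = fun q => F ord0 q + \sum_i F (lift ord0 i) q).
  by apply: niceD => //; exact: IH.
by apply/funext => q; rewrite big_ord_recl.
Qed.

Lemma diff_coord_comp (f : R -> R) a q : derivable f (q 0 a) 1 ->
  differentiable (fun q : V4 => f (q 0 a)) q /\
  forall b, pder b (fun q : V4 => f (q 0 a)) q = (b == a)%:R * derive1 f (q 0 a).
Proof.
move=> df; have df' : differentiable f (q 0 a) by exact/derivable1_diffP.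
have dc : differentiable (fun q : V4 => q 0 a) q by exact: differentiable_coord.
have dfc : differentiable (fun q : V4 => f (q 0 a)) q.
  exact: (@differentiable_comp _ _ _ _ (fun q : V4 => q 0 a) f).
split=> // b; rewrite pderE //.
rewrite (@diff_comp _ _ _ _ (fun q : V4 => q 0 a) f) //= deriv1E //= -(pderE _ dc).
by rewrite pder_coord.
Qed.

(** These combinations are closed under differentiation. The sine is a bounded replacement of the
    coordinate itself: value 0 and derivative 1 at the origin. *)
Definition trig a (c : R * R) (q : V4) : R := c.1 * sin (q 0 a) + c.2 * cos (q 0 a).

Lemma trig_pder a c q : differentiable (trig a c) q /\
  forall b, pder b (trig a c) q = trig a ((b == a)%:R * - c.2, (b == a)%:R * c.1) q.
Proof.
have [ds Ds] := @diff_coord_comp sin a q (@ex_derive _ _ _ _ _ _ _ (is_derive_sin _)).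
have [dc Dc] := @diff_coord_comp cos a q (@ex_derive _ _ _ _ _ _ _ (is_derive_cos _)).
have d1 : differentiable (fun q : V4 => c.1 * sin (q 0 a)) q.
  by apply: differentiableM => //; exact: differentiable_cst.
have d2 : differentiable (fun q : V4 => c.2 * cos (q 0 a)) q.
  by apply: differentiableM => //; exact: differentiable_cst.
split; first exact: differentiableD.
move=> b; rewrite /trig pderD // !pderM ?pder_cst ?Ds ?Dc //;
  do ?[exact: differentiable_cst].
rewrite !derive1E (@derive_val _ _ _ _ _ _ _ (is_derive_sin _)).
rewrite (@derive_val _ _ _ _ _ _ _ (is_derive_cos _)) /=; ring.
Qed.

Lemma nice_trig a c : nice (trig a c).
Proof.
have D w : exists c', Dw w (trig a c) = trig a c'.
  elim: w => [|b w [c' ih]]; first by exists c.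
  exists ((b == a)%:R * - c'.2, (b == a)%:R * c'.1).
  by rewrite /= ih; apply/funext => q; rewrite (trig_pder a c' q).2.
split=> [q _ w|w]; have [c' ->] := D w; first exact: (trig_pder a c' q).1.
exists (`|c'.1| + `|c'.2|) => q; rewrite /trig (le_trans (ler_normD _ _)) // !normrM.
by rewrite lerD // ler_piMr // ?sin_max ?cos_max.
Qed.

Lemma Dw_zero_order n f T w : smooth_on setT f -> smooth_on setT T ->
  f 0 = 0 -> (forall w, (size w < n)%N -> Dw w T 0 = 0) -> (size w <= n)%N ->
  Dw w (fun q => f q * T q) 0 = 0.
Proof.
move=> sf sT f0 hT; rewrite leq_eqVlt.
have s0 : smooth_on setT (fun _ : V4 => 0 : R) by exact: smooth_cst.
have h0 w' : Dw w' (fun _ : V4 => 0 : R) 0 = 0.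
  by case: w' => [//|b w']; rewrite Dw_cst.
have hfT : eqjet n 0 T (fun=> 0) by move=> w' /hT ->; rewrite h0.
have f00 : (fun q => f q * 0) = (fun=> 0) by apply/funext => q; rewrite mulr0.
case/orP => [/eqP|] wn.
  have := @Dw_mul_top _ setT n 0 f T f (fun=> 0) w oT I sf sT sf s0 (@eqjet_refl _ _ _ _) hfT wn.
  by rewrite f0 mul0r f00 h0 subr0.
have := @eqjetM _ setT n 0 f T f (fun=> 0) oT I sf sT sf s0 (@eqjet_refl _ _ _ _) hfT w wn.
by rewrite f00 h0.
Qed.

(* Euler's identity in disguise: the top jet of [x_a T]. *)
Lemma Dw_coord_mul a n f T (t : midx -> R) w : smooth_on setT f -> smooth_on setT T ->
  f 0 = 0 -> (forall b, pder b f 0 = (b == a)%:R) ->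
  (forall w, (size w < n)%N -> Dw w T 0 = 0) ->
  (forall w, size w = n -> Dw w T 0 = t (midxS a (wcnt w))) ->
  size w = n.+1 ->
  Dw w (fun q => f q * T q) 0 = (count_mem a w)%:R * t (wcnt w).
Proof.
elim: n T t w => [|n IH] T t w sf sT f0 f1 hT ht.
all: case/lastP: w => // w b; rewrite size_rcons => -[wn]; rewrite Dw_rcons.
all: have sp := smooth_on_pder.
all: have s0 : smooth_on setT (fun _ : V4 => 0 : R) by exact: smooth_cst.
all: rewrite (@Dw_on _ setT _ (fun q => pder b f q * T q + f q * pder b T q)) //;
  last by move=> z _; apply: pderM; [exact: smooth_on_diff sf _|exact: smooth_on_diff sT _].
all: rewrite (@Dw_add _ setT) //; try by apply: smoothM => //; exact: sp.
all: have h0 w' : Dw w' (fun _ : V4 => 0 : R) 0 = 0 by case: w' => [//|c w']; rewrite Dw_cst.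
all: rewrite -(cats1 w b) count_cat natrD mulrDl cats1 wcnt_rcons.
  move/size0nil: wn => -> /=; rewrite f0 mul0r !addr0 f1 mul0r add0r addn0 eq_sym.
  have := ht [::] erefl; rewrite /= => ->.
  by have [->|] := eqVneq a b; rewrite ?mul0r // eqxx !mul1r.
rewrite (IH (pder b T) (fun c => t (midxS b c))) //.
- rewrite addrC /= addn0 [in RHS]eq_sym; congr (_ + _).
  have hfT : eqjet n.+1 0 T (fun=> 0) by move=> w' /hT ->; rewrite h0.
  have := @Dw_mul_top _ setT n.+1 0 (pder b f) T (pder b f) (fun=> 0) w oT I
    (sp _ _ _ _ sf) sT (sp _ _ _ _ sf) s0 (@eqjet_refl _ _ _ _) hfT wn.
  rewrite (_ : (fun q => pder b f q * 0) = fun=> 0) ?h0 ?subr0; last first.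
    by apply/funext => q; rewrite mulr0.
  move=> ->; rewrite f1 ht //.
  by have [->|] := eqVneq b a; rewrite ?mul0r // eqxx !mul1r.
- exact: sp.
- by move=> w' wn'; rewrite -Dw_rcons hT // size_rcons.
- move=> w' wn'; rewrite -Dw_rcons ht ?size_rcons ?wn' // wcnt_rcons.
  by congr (t _); apply/ffunP => c; rewrite !ffunE addnAC.
Qed.

(** Induction on n: T is (n + 1)^-1 times the sum over a of sin(x_a) T_a, where the top jet of T_a
    is t shifted by a. For a word w the term of a contributes its number of letters a times t, and
    these numbers add up to n + 1. *)
Lemma nice_jet n (t : midx -> R) : exists T, [/\ nice T,
  forall w, (size w < n)%N -> Dw w T 0 = 0 &
  forall w, size w = n -> Dw w T 0 = t (wcnt w)].
Proof.
elim: n t => [|n IH] t.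
  exists (fun=> t midx0); split=> //; first exact: nice_cst.
  by move=> w /size0nil ->; rewrite /= wcnt_nil.
have /choice[T hT] a := IH (fun c => t (midxS a c)).
pose s a := trig a (1, 0).
have ns a : nice (s a) by exact: nice_trig.
have s0 a : s a 0 = 0 by rewrite /s /trig /= mxE sin0 mul0r mulr0 addr0.
have s1 a b : pder b (s a) 0 = (b == a)%:R.
  by rewrite /s (trig_pder a (1, 0) 0).2 /trig /= mxE sin0 cos0 oppr0 !mulr0 add0r !mulr1.
have sT a : smooth_on setT (T a) by case: (hT a) => -[].
have sm a : smooth_on setT (fun q => s a q * T a q) by apply: smoothM => //; exact: (ns a).1.
exists (fun q => n.+1%:R^-1 * \sum_a s a q * T a q); split.
- apply: niceM; first exact: nice_cst.
  by apply: nice_sum => a; apply: niceM => //; case: (hT a).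
- move=> w wn; rewrite (@Dw_scale _ setT) //; last exact: smooth_sum.
  rewrite (@Dw_sum _ setT) // big1 ?mulr0 // => a _.
  by apply: (Dw_zero_order (n := n)) => //; [exact: (ns a).1|case: (hT a)].
- move=> w wn; rewrite (@Dw_scale _ setT) //; last exact: smooth_sum.
  rewrite (@Dw_sum _ setT) // (eq_bigr (fun a => (count_mem a w)%:R * t (wcnt w))).
    rewrite -mulr_suml -natr_sum.
    have -> : (\sum_a count_mem a w)%N = n.+1.
      by rewrite -wn -midx_order_wcnt; apply: eq_bigr => a _; rewrite ffunE.
    by rewrite mulrA mulVf ?mul1r // pnatr_eq0.
  move=> a _; apply: (Dw_coord_mul (n := n)) => //; first exact: (ns a).1.
    by case: (hT a).
  by case: (hT a).
Qed.

Lemma Dw_zoom F (l : R) w q : smooth_on setT F ->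
  Dw w (fun z => F (l *: z)) q = l ^+ size w * Dw w F (l *: q).
Proof.
move=> sF.
have sl b : smooth_on setT (fun q : V4 => (l *: q) 0 b).
  rewrite (_ : (fun q : V4 => _) = fun q : V4 => l * q 0 b).
    by apply: smoothM => //; [exact: smooth_cst|exact: smooth_coord].
  by apply/funext => z; rewrite mxE.
elim: w q => [|a w IH] q; first by rewrite /= expr0 mul1r.
rewrite /= (_ : Dw w (fun z => F (l *: z)) = fun z => l ^+ size w * Dw w F (l *: z));
  last exact/funext.
have sD := smooth_on_Dw w sF.
have sD' : smooth_on setT (fun z => Dw w F (l *: z)) by exact: (smooth_comp oT sD sl).
rewrite pderM ?pder_cst ?mul0r ?add0r; last 2 first.
- exact: differentiable_cst.
- exact: smooth_on_diff sD' _.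
rewrite exprSr -mulrA; congr (_ * _).
rewrite (@pder_comp _ (Dw w F) (fun z => l *: z)); last 2 first.
- exact: smooth_on_diff sD _.
- by move=> b; exact: smooth_on_diff (sl b) _.
have pl b : pder a (fun q : V4 => (l *: q) 0 b) q = l * (a == b)%:R.
  rewrite (_ : (fun q : V4 => _) = fun q : V4 => l * q 0 b).
    rewrite pderM ?pder_cst ?pder_coord ?mul0r ?add0r //.
    exact: differentiable_coord.
  by apply/funext => z; rewrite mxE.
rewrite (bigD1 a) //= big1 ?addr0 ?pl ?eqxx ?mulr1 1?mulrC // => b ba.
by rewrite pl eq_sym (negbTE ba) !mulr0.
Qed.

Lemma nice_zoom F l : nice F -> nice (fun z => F (l *: z)).
Proof.
move=> [sF bF]; split=> [|w].
  apply: (smooth_comp oT sF) => // b.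
  rewrite (_ : (fun q : V4 => _) = fun q : V4 => l * q 0 b).
    by apply: smoothM => //; [exact: smooth_cst|exact: smooth_coord].
  by apply/funext => z; rewrite mxE.
have [B hB] := bF w; exists (`|l ^+ size w| * B) => q.
by rewrite Dw_zoom // normrM ler_wpM2l.
Qed.

Lemma bounds_words F n : nice F ->
  exists2 B, 0 <= B & forall w, (size w < n)%N -> forall q, `|Dw w F q| <= B.
Proof.
elim: n F => [|n IH] F nF; first by exists 0.
have [B0 B00 hB0] := nice_bound [::] nF.
have /choice[B hB] (a : 'I_4) :
    exists B, 0 <= B /\ forall w, (size w < n)%N -> forall q, `|Dw w (pder a F) q| <= B.
  by have [B ? ?] := IH _ (nice_pder a nF); exists B.
exists (B0 + \sum_a B a) => [|w].
  by rewrite addr_ge0 // sumr_ge0 // => a _; case: (hB a).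
case/lastP: w => [_ q|w a].
  by rewrite (le_trans (hB0 q)) // lerDl sumr_ge0 // => a _; case: (hB a).
rewrite size_rcons ltnS => wn q; rewrite Dw_rcons.
apply: le_trans ((hB a).2 w wn q) _; rewrite (bigD1 a) //= addrCA lerDl.
by rewrite addr_ge0 // sumr_ge0 // => b _; case: (hB b).
Qed.

(** Zooming: l^-n T(l x) keeps the derivatives of order n at 0 and brings a factor l^(j - n), at
    most 1 / l, to those of order j < n. *)
Lemma small_jet n (t : midx -> R) e : 0 < e -> exists T, [/\ nice T,
  forall w, (size w < n)%N -> Dw w T 0 = 0,
  forall w, size w = n -> Dw w T 0 = t (wcnt w) &
  forall w, (size w < n)%N -> forall q, `|Dw w T q| <= e].
Proof.
move=> e0; have [T [nT T0 Tt]] := nice_jet n t.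
have [B B0 hB] := bounds_words n nT.
(* B bounds the derivatives of order below n; this l is at least 1 and makes B / l at most e. *)
pose l := 1 + B / e; have l1 : 1 <= l by rewrite lerDl divr_ge0 // ltW.
have l0 : 0 < l by apply: lt_le_trans l1.
have lB : B / l <= e.
  by rewrite ler_pdivrMr // /l mulrDr mulr1 mulrC divfK ?gt_eqF // lerDr ltW.
have nz : nice (fun z => T (l *: z)) by exact: nice_zoom.
have D w q : Dw w (fun q => l ^- n * T (l *: q)) q = l ^- n * (l ^+ size w * Dw w T (l *: q)).
  by rewrite (@Dw_scale _ setT) ?Dw_zoom //; [exact: nT.1|exact: nz.1].
exists (fun q => l ^- n * T (l *: q)); split.
- by apply: niceM nz; exact: nice_cst.
- by move=> w wn; rewrite D scaler0 T0 // !mulr0.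
- move=> w wn; rewrite D scaler0 Tt // wn mulrA mulVf ?mul1r //.
  by rewrite expf_neq0 // gt_eqF.
- move=> w wn q; rewrite D mulrA normrM; apply: le_trans lB.
  rewrite mulrC ler_pM ?normr_ge0 //; first exact: hB.
  rewrite ger0_norm; last by rewrite mulr_ge0 ?invr_ge0 ?exprn_ge0 // ltW.
  rewrite mulrC ler_pdivrMr ?exprn_gt0 // mulrC ler_pdivlMr // -exprSr.
  by rewrite ler_weXn2l.
Qed.

Lemma pow2_small (K e : R) : 0 <= K -> 0 < e -> exists n, forall m, (n <= m)%N -> K / 2 ^+ m <= e.
Proof.
move=> K0 e0; exists (Num.bound (K / e)) => m nm.
have h : K / e < m%:R.
  apply: lt_le_trans (archi_boundP _) _; first by rewrite divr_ge0 // ltW.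
  by rewrite ler_nat.
rewrite ler_pdivrMr ?exprn_gt0 // mulrC -ler_pdivrMr //.
apply: le_trans (ltW h) _; rewrite -natrX ler_nat; apply: ltnW; exact: ltn_expl.
Qed.

Lemma geo_tail (u : nat -> R) K k : 0 <= K ->
  (forall n, (k <= n)%N -> `|u n.+1 - u n| <= K / 2 ^+ n) ->
  (u @ \oo --> lim (u @ \oo)) /\
  forall n, (k <= n)%N -> `|lim (u @ \oo) - u n| <= 2 * K / 2 ^+ n.
Proof.
move=> K0 hu.
have step n j : (k <= n)%N -> `|u (n + j)%N - u n| <= 2 * K / 2 ^+ n - 2 * K / 2 ^+ (n + j).
  move=> kn; elim: j => [|j IH]; first by rewrite addn0 !subrr normr0.
  rewrite addnS -(subrKA (u (n + j)%N)) (le_trans (ler_normD _ _)) //.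
  have h1 := hu (n + j)%N (leq_trans kn (leq_addr _ _)).
  have -> : 2 * K / 2 ^+ n - 2 * K / 2 ^+ (n + j).+1 =
     K / 2 ^+ (n + j) + (2 * K / 2 ^+ n - 2 * K / 2 ^+ (n + j)).
    by rewrite [in X in _ - X = _]exprS; field; rewrite !expf_neq0.
  exact: lerD.
have bnd n m : (k <= n)%N -> (n <= m)%N -> `|u m - u n| <= 2 * K / 2 ^+ n.
  move=> kn nm; rewrite -(subnKC nm) (le_trans (step _ _ kn)) // gerBl.
  by rewrite !mulr_ge0 // invr_ge0 exprn_ge0.
have cu : cvg (u @ \oo).
  apply: cauchy_cvg; apply: cauchy_exP => e e0.
  have [n hn] : exists n, forall m, (n <= m)%N -> 2 * K / 2 ^+ m <= e / 2.
    by apply: pow2_small; rewrite ?mulr_ge0 // divr_gt0.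
  exists (u (maxn k n)); exists (maxn k n) => // m /= km.
  rewrite -ball_normE /ball_ /= distrC.
  apply: le_lt_trans (bnd _ _ (leq_maxl _ _) km) _.
  apply: le_lt_trans (hn _ (leq_maxr _ _)) _.
  by rewrite ltr_pdivrMr // ltr_pMr // ltr1n.
split=> // n kn.
have c1 : (fun m => `|u m - u n|) @ \oo --> `|lim (u @ \oo) - u n|.
  by apply: cvg_norm; apply: cvgB => //; exact: cvg_cst.
rewrite -(cvg_lim _ c1) //; apply: limr_le; first by apply/cvg_ex; eexists; exact: c1.
by exists n => // m /= nm; exact: bnd.
Qed.

Lemma coord_le_norm (h : V4) a : `|h 0 a| <= `|h|.
Proof.
rewrite [leRHS]/Num.Def.normr /= mx_normrE.
exact: (le_bigmax _ (fun ij : 'I_1 * 'I_4 => `|h ij.1 ij.2|) (0, a)).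
Qed.

Lemma cvg_sum4 (u : 'I_4 -> nat -> R) (l : 'I_4 -> R) : (forall a, u a @ \oo --> l a) ->
  (fun m => \sum_a u a m) @ \oo --> \sum_a l a.
Proof.
move=> ul; rewrite (big_ord4 _ l) (_ : (fun m => _) =
  fun m => u iu m + (u ix1 m + (u ix2 m + u iv m))).
  by do 3!(apply: cvgD => //).
by apply/funext => m; rewrite (big_ord4 _ (u ^~ m)).
Qed.

(* A sum of corrections of higher and higher order, each of them small
   together with its derivatives of lower order. *)
Lemma borel0 (c : midx -> R) : exists2 F, smooth_on setT F &
  forall w, Dw w F 0 = c (wcnt w).
Proof.
(* The correction of order n repairs the derivatives of order n at 0 of the partial sum so far, and
   its lower derivatives are at most 2^-n everywhere. *)
have /choice[stp hstp] (x : nat * (V4 -> R)) : exists T, nice x.2 ->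
    [/\ nice T, forall w, (size w < x.1)%N -> Dw w T 0 = 0,
     forall w, size w = x.1 -> Dw w T 0 = c (wcnt w) - Dw (wd (wcnt w)) x.2 0 &
     forall w, (size w < x.1)%N -> forall q, `|Dw w T q| <= 2 ^- x.1].
  have e0 : 0 < (2 ^- x.1 : R) by rewrite invr_gt0 exprn_gt0.
  have [T hT] := @small_jet x.1 (fun al => c al - Dw (wd al) x.2 0) (2 ^- x.1) e0.
  by exists T.
pose S := fix S n : V4 -> R :=
  if n is m.+1 then (fun q => S m q + stp (m, S m) q) else (fun=> 0).
have nS n : nice (S n).
  elim: n => [|n IH]; first exact: nice_cst.
  by apply: niceD => //; case: (hstp (n, S n) IH).
pose T n := stp (n, S n); have hT n := hstp (n, S n) (nS n).
have nT n : nice (T n) by case: (hT n).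
have DS w n q : Dw w (S n.+1) q = Dw w (S n) q + Dw w (T n) q.
  by rewrite (@Dw_add _ setT) //; [exact: (nS n).1|exact: (nT n).1].
have S0 n w : (size w < n)%N -> Dw w (S n) 0 = c (wcnt w).
  elim: n => // n IH; rewrite ltnS leq_eqVlt DS => /orP[/eqP wn|wn].
    have [_ _ -> // _] := hT n; rewrite /= (@Dw_wd setT) //; last exact: (nS n).1.
    by rewrite addrC subrK.
  by have [_ -> // _ _] := hT n; rewrite addr0 IH.
have tail w n q : ((size w).+1 <= n)%N -> `|Dw w (S n.+1) q - Dw w (S n) q| <= 1 / 2 ^+ n.
  by move=> wn; rewrite DS addrAC subrr add0r mul1r; have [_ _ _ ->] := hT n.
pose Fw w q := lim ((fun n => Dw w (S n) q) @ \oo).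
have cF w q : (fun n => Dw w (S n) q) @ \oo --> Fw w q.
  exact: (geo_tail ler01 (tail w ^~ q)).1.
have dF w p : differentiable (Fw w) p /\ forall a, pder a (Fw w) p = Fw (a :: w) p.
  apply: diff_crit => e e0.
  (* Origin of 16: by the mean value theorem the remainder of [T m] is a sum over 4 coordinates of
     at most |h| times a difference of two values bounded by 2^-m, so at most 8 |h| / 2^m, and the
     tail of the series doubles this. The offset [(size w).+2] below lets the bound cover the words
     a :: w. *)
  have [n0 hn0] : exists n, forall m, (n <= m)%N -> 16 / 2 ^+ m <= e / 2.
    by apply: pow2_small => //; rewrite divr_gt0.
  pose n := maxn n0 (size w).+2.
  have e20 : 0 < e / 2 by rewrite divr_gt0.
  have est := diff_est (smooth_on_diff (smooth_on_Dw w (nS n).1) (I : setT p)) e20.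
  near=> h.
  pose r m := Dw w (S m) (h + p) - Dw w (S m) p - \sum_a h 0 a * Dw (a :: w) (S m) p.
  have rl : r @ \oo --> Fw w (h + p) - Fw w p - \sum_a h 0 a * Fw (a :: w) p.
    apply: cvgB; first by apply: cvgB; exact: cF.
    by apply: cvg_sum4 => a; apply: cvgM; [exact: cvg_cst|exact: cF].
  have rT m : ((size w).+2 <= m)%N -> `|r m.+1 - r m| <= (8 * `|h|) / 2 ^+ m.
    move=> wm; have -> : r m.+1 - r m =
        Dw w (T m) (p + h) - Dw w (T m) p - \sum_a h 0 a * Dw (a :: w) (T m) p.
      rewrite /r !DS (addrC h) (eq_bigr (fun a => h 0 a * Dw (a :: w) (S m) p +
        h 0 a * Dw (a :: w) (T m) p)); last by move=> a _; rewrite DS mulrDr.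
      rewrite big_split /=; move: (\sum_a _) (\sum_a _) => X Y; ring.
    have [t _ ->] := @MVT_line _ (Dw w (T m)) p h
      (fun t _ => smooth_on_diff (smooth_on_Dw w (nT m).1) (I : setT _)).
    rewrite -sumrB; apply: le_trans (ler_norm_sum _ _ _) _.
    have -> : 8 * `|h| / 2 ^+ m = \sum_(a < 4) `|h| * (2 ^- m + 2 ^- m).
      rewrite sumr_const card_ord -mulr_natl; field; by rewrite expf_neq0.
    apply: ler_sum => a _; rewrite -mulrBr normrM ler_pM ?coord_le_norm //.
    have [_ _ _ hm] := hT m.
    by apply: le_trans (ler_normB _ _) _; apply: lerD; apply: (hm (a :: w)).
  have h80 : 0 <= 8 * `|h| by rewrite mulr_ge0.
  have [cr hr] := geo_tail h80 rT; rewrite (cvg_lim _ rl) // in hr.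
  have {hr} := hr n (leq_maxr _ _).
  set L := Fw w (h + p) - Fw w p - _ => hL.
  have h1 : `|r n| <= e / 2 * `|h| by rewrite /r; near: h.
  have h2 : 2 * (8 * `|h|) / 2 ^+ n <= e / 2 * `|h|.
    rewrite (_ : 2 * (8 * `|h|) / 2 ^+ n = 16 / 2 ^+ n * `|h|); last by ring.
    by rewrite ler_wpM2r // hn0 // leq_maxl.
  rewrite -(subrK (r n) L); apply: le_trans (ler_normD _ _) _.
  apply: le_trans (lerD hL h1) _; rewrite [leRHS](_ : _ = e / 2 * `|h| + e / 2 * `|h|).
    by rewrite lerD2r.
  by rewrite -mulrDl -splitr.
have DwF w : Dw w (Fw [::]) = Fw w.
  by elim: w => // a w IH; rewrite /= IH; apply/funext => q; rewrite (dF w q).2.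
exists (Fw [::]) => [q _ w|w]; first by rewrite DwF; case: (dF w q).
rewrite DwF /Fw; apply: cvg_lim => //; apply: cvg_near_cst.
by exists (size w).+1 => // n /= wn; rewrite S0.
Unshelve. all: by end_near. Qed.

Lemma Dw_shift F (v : V4) w p : smooth_on setT F ->
  Dw w (fun q => F (q + v)) p = Dw w F (p + v).
Proof.
move=> sF; elim: w p => // a w IH p; rewrite /=.
rewrite (_ : Dw w (fun q => F (q + v)) = fun q => Dw w F (q + v)); last exact/funext.
by rewrite pder_shift //; exact: smooth_on_diff (smooth_on_Dw w sF) _.
Qed.

Lemma borel (c : midx -> R) p : exists2 F, smooth_on setT F &
  forall w, Dw w F p = c (wcnt w).
Proof.
have [F sF hF] := borel0 c; exists (fun q => F (q - p)) => [|w]; last first.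
  by rewrite Dw_shift // subrr hF.
apply: (smooth_comp oT sF) => // b.
rewrite (_ : (fun q : V4 => _) = fun q : V4 => q 0 b + (- p) 0 b).
  by apply: smoothD => //; [exact: smooth_coord|exact: smooth_cst].
by apply/funext => q; rewrite mxE.
Qed.

End Borel.

Section Jets.
Variable R : realType.
Notation V4 := 'rV[R]_4.
Notation E a := (delta_mx 0 a : V4).
Notation jt := (jet R).
Implicit Types (f g : jt -> R) (th : jt) (V : jt -> Prop) (a b : 'I_4).

(** * Rational functions on jets and total derivatives *)

Lemma posdefP (y : fibre -> R) :
  posdef y <-> 0 < y fh11 /\ 0 < y fh11 * y fh22 - y fh12 ^+ 2.
Proof.
split=> [h|[h1 h2] s t st].
  have h11 : 0 < y fh11.
    have := h 1 0; rewrite expr1n expr0n /= !mulr0 !mulr1 !addr0; apply.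
    by rewrite xpair_eqE oner_eq0.
  split=> //; have := h (- y fh12) (y fh11).
  rewrite xpair_eqE [y fh11 == 0]gt_eqF // andbF => /(_ isT).
  rewrite (_ : _ + _ = y fh11 * (y fh11 * y fh22 - y fh12 ^+ 2)); last by ring.
  by rewrite pmulr_rgt0.
rewrite -(pmulr_rgt0 _ h1) [ltRHS](_ : _ = (y fh11 * s + y fh12 * t) ^+ 2 +
  (y fh11 * y fh22 - y fh12 ^+ 2) * t ^+ 2); last by ring.
have [t0|t0] := eqVneq t 0; last by rewrite ltr_wpDl ?sqr_ge0 // mulr_gt0 // exprn_even_gt0.
rewrite t0 mulr0 addr0 expr0n mulr0 addr0 exprn_even_gt0 //= mulf_neq0 //.
  by rewrite gt_eqF.
by move: st; rewrite t0 xpair_eqE eqxx andbT.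
Qed.

Lemma EooP th : Eoo th <-> posdef (jet0 th) /\
  forall c (al : midx), (vdeg c < al iv)%N -> jcoord th c al = 0.
Proof.
split=> [h|[h1 h2] k]; last by split=> // c al _; exact: h2.
split=> [|c al]; first by case: (h 0%N).
by case: (h (midx_order al)) => _; apply.
Qed.

Lemma jet_eq th th' : base th = base th' ->
  (forall c al, jcoord th c al = jcoord th' c al) -> th = th'.
Proof.
case: th th' => [b c] [b' c'] /= -> h; congr Jet.
by apply/funext => x; apply/funext => y.
Qed.

Lemma flow0 a th : flow a 0 th = th.
Proof. by apply: jet_eq => [|c al] /=; rewrite ?scale0r ?mul0r addr0. Qed.

Definition jetline (b v : V4) (c w : fibre -> midx -> R) (t : R) : jt :=
  Jet (b + t *: v) (fun x al => c x al + t * w x al).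

Lemma flowE a t th : flow a t th =
  jetline (base th) (E a) (jcoord th) (fun c al => jcoord th c (midxS a al)) t.
Proof. by []. Qed.

(** Used twice: polynomial functions become differentiable along [flow], and products of functions
    on the equation reduce to products of one-variable polynomials. *)
Lemma polyfun_line k f (b v : V4) c w : polyfun k f ->
  exists P : {poly R}, forall t, f (jetline b v c w t) = P.[t].
Proof.
elim=> [r|g|g h _ [P hP] _ [Q hQ]|g h _ [P hP] _ [Q hQ]].
- by exists r%:P => t; rewrite hornerC.
- case=> [a|x al _].
    exists ((b 0 a)%:P + 'X * (v 0 a)%:P) => t.
    by rewrite !hornerE /= !mxE.
  by exists ((c x al)%:P + 'X * (w x al)%:P) => t; rewrite !hornerE.
- by exists (P + Q) => t; rewrite hornerE hP hQ.
- by exists (P * Q) => t; rewrite hornerE hP hQ.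
Qed.

Lemma polyfunW k k' f : (k <= k')%N -> polyfun k f -> polyfun k' f.
Proof.
move=> kk; elim=> [r|g|g h _ ? _ ?|g h _ ? _ ?].
- exact: alg_cst.
- case=> [a|c al kal]; apply: alg_gen; constructor; exact: leq_trans kal kk.
- exact: alg_add.
- exact: alg_mul.
Qed.

Definition dflow a f th := derivable (fun t : R => f (flow a t th)) 0 1.

Lemma polyfun_dflow k f a th : polyfun k f -> dflow a f th.
Proof.
move=> pf; have [P hP] := polyfun_line (base th) (E a) (jcoord th)
  (fun c al => jcoord th c (midxS a al)) pf.
rewrite /dflow (_ : (fun t => _) = horner P); first exact: derivable_horner.
by apply/funext => t; rewrite flowE hP.
Qed.

Arguments polyfun_dflow {k f} a th.

Lemma Dt_cst a r th : Dt a (fun=> r) th = 0.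
Proof. by rewrite /Dt derive1_cst. Qed.

Lemma DtD a f g th : dflow a f th -> dflow a g th ->
  dflow a (fun z => f z + g z) th /\ Dt a (fun z => f z + g z) th = Dt a f th + Dt a g th.
Proof.
by move=> df dg; split; [exact: (derivableD df dg)|rewrite /Dt !derive1E (deriveD df dg)].
Qed.

Lemma DtM a f g th : dflow a f th -> dflow a g th ->
  dflow a (fun z => f z * g z) th /\
  Dt a (fun z => f z * g z) th = Dt a f th * g th + f th * Dt a g th.
Proof.
move=> df dg; split; [exact: (derivableM df dg)|rewrite /Dt !derive1E (deriveM df dg)].
by rewrite !flow0 addrC /GRing.scale /= mulrC.
Qed.

Lemma DtV a f th : dflow a f th -> f th != 0 ->
  dflow a (fun z => (f z)^-1) th /\ Dt a (fun z => (f z)^-1) th = - Dt a f th / f th ^+ 2.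
Proof.
move=> df f0; have ff : f (flow a 0 th) != 0 by rewrite flow0.
split; first exact: (derivableV ff df).
by rewrite /Dt !derive1E (deriveV ff df) flow0 /GRing.scale /= mulrC mulrN mulNr.
Qed.

Lemma Dt_base a b th : Dt a (fun z => base z 0 b) th = (a == b)%:R.
Proof.
rewrite /Dt derive1E (_ : (fun t => _) = cst (base th 0 b) + (fun t : R => t * (a == b)%:R)).
  rewrite deriveD ?derive_cst ?add0r; [|exact: derivable_cst|].
    by rewrite -derive1E derive1Mr // derive1_id mul1r.
  exact/derivableM.
by apply/funext => t; rewrite /= !mxE eqxx /= eq_sym.
Qed.

Lemma Dt_coord a c al th : Dt a (fun z => jcoord z c al) th = jcoord th c (midxS a al).
Proof.
rewrite /Dt derive1E (_ : (fun t => _) = cst (jcoord th c al) +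
  (fun t : R => t * jcoord th c (midxS a al))) //.
rewrite deriveD ?derive_cst ?add0r; [|exact: derivable_cst|exact/derivableM].
by rewrite -derive1E derive1Mr // derive1_id mul1r.
Qed.

Lemma alg_ext S f g : f =1 g -> alg S f -> alg (R := R) S g.
Proof. by move/funext => ->. Qed.

Lemma polyfun_Dt k f a : polyfun k f -> polyfun k.+1 (Dt a f).
Proof.
elim=> [r|g [b|c al kal]|g h pg ig ph ih|g h pg ig ph ih].
- by apply: (alg_ext (f := fun=> 0)) => [z|]; [rewrite Dt_cst|exact: alg_cst].
- by apply: (alg_ext (f := fun=> (a == b)%:R)) => [z|]; [rewrite Dt_base|exact: alg_cst].
- apply: (alg_ext (f := fun z => jcoord z c (midxS a al))) => [z|]; first by rewrite Dt_coord.
  by apply: alg_gen; constructor; rewrite midx_orderS.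
- apply: alg_ext (alg_add ig ih) => z.
  by rewrite (DtD (polyfun_dflow a z pg) (polyfun_dflow a z ph)).2.
- have [pg' ph'] := (polyfunW (leqnSn k) pg, polyfunW (leqnSn k) ph).
  apply: alg_ext (alg_add (alg_mul ig ph') (alg_mul pg' ih)) => z.
  by rewrite (DtM (polyfun_dflow a z pg) (polyfun_dflow a z ph)).2.
Qed.

(** This makes [Dt] local to V: an identity that holds on V may be differentiated at points of V. *)
Definition flow_stable V := forall th a, V th -> \forall t \near (0 : R), V (flow a t th).

Lemma dflow_near f g a th : (\forall t \near (0 : R), f (flow a t th) = g (flow a t th)) ->
  dflow a f th -> dflow a g th /\ Dt a f th = Dt a g th.
Proof.
move=> fg df; split; first exact: near_eq_derivable df.
by rewrite /Dt !derive1E; exact: near_eq_derive.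
Qed.

Arguments dflow_near {f g a th}.

Lemma dflow_on V f g a th : flow_stable V -> V th -> (forall z, V z -> f z = g z) ->
  dflow a f th -> dflow a g th /\ Dt a f th = Dt a g th.
Proof.
by move=> sV Vth fg; apply: dflow_near; apply: filterS (sV _ a Vth) => t /fg.
Qed.

Arguments dflow_on {V f g a th}.

Lemma polyfun_near k f a th : polyfun k f -> f th != 0 ->
  \forall t \near (0 : R), f (flow a t th) != 0.
Proof.
move=> pf f0; have /derivable1_diffP/differentiable_continuous := polyfun_dflow a th pf.
rewrite /prop_for /continuous_at /= flow0 => fc.
have := fc [set y : R | y != 0]; apply.
by apply: open_nbhs_nbhs; split => //; exact: open_neq.
Qed.

Arguments polyfun_near {k f} a {th}.

Lemma polyfun_near_pos k f a th : polyfun k f -> 0 < f th ->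
  \forall t \near (0 : R), 0 < f (flow a t th).
Proof.
move=> pf f0; have /derivable1_diffP/differentiable_continuous := polyfun_dflow a th pf.
rewrite /prop_for /continuous_at /= flow0 => fc.
have := fc [set y : R | 0 < y]; apply.
by apply: open_nbhs_nbhs; split => //; exact: open_gt.
Qed.

Arguments polyfun_near_pos {k f} a {th}.

Lemma polyfun_jet0 c : polyfun 0 (fun th => jet0 th c).
Proof.
apply: alg_gen; constructor; rewrite /midx_order big1 // => a _; by rewrite ffunE.
Qed.

Lemma alg_opp S f : alg S f -> alg (R := R) S (fun z => - f z).
Proof.
move=> sf; apply: alg_ext (alg_mul (alg_cst S (-1)) sf) => z; by rewrite mulN1r.
Qed.

Lemma alg_sub S f g : alg S f -> alg S g -> alg (R := R) S (fun z => f z - g z).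
Proof. by move=> sf sg; apply: alg_add => //; exact: alg_opp. Qed.

Lemma alg_exp S f n : alg S f -> alg (R := R) S (fun z => f z ^+ n).
Proof.
move=> sf; elim: n => [|n IH].
  by apply: (alg_ext (f := fun=> 1)) => [z|]; [rewrite expr0|exact: alg_cst].
by apply: alg_ext (alg_mul sf IH) => z; rewrite exprS.
Qed.

Definition deth th := jet0 th fh11 * jet0 th fh22 - jet0 th fh12 ^+ 2.

Lemma polyfun_deth : polyfun 0 deth.
Proof.
by apply: alg_sub; [apply: alg_mul|apply: alg_exp]; exact: polyfun_jet0.
Qed.

Lemma deth_gt0 th : Eoo th -> 0 < deth th.
Proof. by case/EooP => /posdefP[]. Qed.

Lemma Eoo_stable : flow_stable (@Eoo R).
Proof.
move=> th a /EooP[/posdefP[h1 h2] hv].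
have n1 := polyfun_near_pos a (polyfun_jet0 fh11) h1.
have n2 := polyfun_near_pos a polyfun_deth h2.
near=> t; apply/EooP; split; first by apply/posdefP; split; near: t.
move=> c al ca /=; rewrite !hv ?mulr0 ?addr0 // ffunE.
exact: leq_trans (leq_addr _ _).
Unshelve. all: by end_near. Qed.

Definition Enz (u : jt -> R) th := Eoo th /\ u th != 0.

Lemma Enz_stable k u : polyfun k u -> flow_stable (Enz u).
Proof.
move=> pu th a [Eth uth]; have n1 := Eoo_stable a Eth; have n2 := polyfun_near a pu uth.
by near=> t; split; near: t.
Unshelve. all: by end_near. Qed.

(** Positive definiteness is a convex condition and the other equations are linear. *)
Lemma Eoo_convex (b b' : V4) (c c' : fibre -> midx -> R) t : 0 <= t -> t <= 1 ->
  Eoo (Jet b c) -> Eoo (Jet b' c') ->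
  Eoo (jetline b (b' - b) c (fun x al => c' x al - c x al) t).
Proof.
move=> t0 t1 /EooP[p1 v1] /EooP[p2 v2]; apply/EooP; split; last first.
  by move=> x al h; have /= := v1 x al h; have /= := v2 x al h => /= -> ->; rewrite subr0 mulr0 addr0.
move=> x y xy; have := p1 x y xy; have := p2 x y xy; rewrite /jet0 /=.
set A := (X in 0 < X -> _) => A0; set B := (X in 0 < X -> _) => B0.
rewrite [ltRHS](_ : _ = (1 - t) * B + t * A); last by rewrite /A /B; ring.
have [->|tn0] := eqVneq t 0; first by rewrite subr0 mul1r mul0r addr0.
apply: ltr_wpDl; first by rewrite mulr_ge0 ?subr_ge0 // ltW.
by rewrite mulr_gt0 // lt_def tn0.
Qed.

(** By convexity a segment inside the equation joins a point where f is nonzero to one where g is.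
    On it both are nonzero polynomials in t, and their product has finitely many roots. *)
Lemma nonzero_mul k k' f g : polyfun k f -> polyfun k' g ->
  nonzero_on_E f -> nonzero_on_E g -> nonzero_on_E (fun th => f th * g th).
Proof.
move=> pf pg [[b c] [E1 f1]] [[b' c'] [E2 g2]].
pose L := jetline b (b' - b) c (fun x al => c' x al - c x al).
have L0 : L 0 = Jet b c by apply: jet_eq => [|x al] /=; rewrite ?scale0r ?mul0r addr0.
have L1 : L 1 = Jet b' c'.
  by apply: jet_eq => [|x al] /=; rewrite ?scale1r ?mul1r addrC subrK.
have [P hP] := polyfun_line b (b' - b) c (fun x al => c' x al - c x al) pf.
have [Q hQ] := polyfun_line b (b' - b) c (fun x al => c' x al - c x al) pg.
have PQ0 : P * Q != 0.
  rewrite mulf_neq0 //.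
    by apply: contraNneq f1 => P0; rewrite -L0 hP P0 horner0.
  by apply: contraNneq g2 => Q0; rewrite -L1 hQ Q0 horner0.
(* More distinct parameters 1 / (i + 1) in [0, 1] than the product can have roots. *)
pose s := [seq (i.+1%:R)^-1 : R | i <- iota 0 (size (P * Q))].
have us : uniq s.
  rewrite map_inj_uniq ?iota_uniq // => i j /invr_inj/eqP.
  by rewrite eqr_nat => /eqP[].
have /allPn[t ts tr] : ~~ all (root (P * Q)) s.
  apply/negP => /(max_poly_roots PQ0)/(_ us).
  by rewrite size_map size_iota ltnn.
have [t0 t1] : 0 <= t /\ t <= 1.
  case/mapP: ts => i _ ->; split; first by rewrite invr_ge0.
  by rewrite invf_le1 ?ltr0n // ler1n.
exists (L t); split; first exact: Eoo_convex.
by rewrite hP hQ -hornerM.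
Qed.

Lemma generically_and (P Q : jt -> Prop) : generically P -> generically Q ->
  generically (fun th => P th /\ Q th).
Proof.
move=> [k [p [pp p0 hp]]] [l [q [pq q0 hq]]].
exists (maxn k l), (fun th => p th * q th); split.
- by apply: alg_mul; [exact: polyfunW (leq_maxl _ _) pp|exact: polyfunW (leq_maxr _ _) pq].
- exact: nonzero_mul pp pq p0 q0.
- by move=> th Eth; rewrite mulf_eq0 negb_or => /andP[/hp ? /hq ?]; split; auto.
Qed.

(** Numerator and denominator orders are tracked separately because [diff_invariant l] bounds the
    order of the denominator, and total derivatives raise only that of the numerator. *)
Definition rat V k l f := exists p q, [/\ polyfun k p, polyfun l q &
  forall th, V th -> q th != 0 /\ f th = p th / q th].

Lemma rat_ext V k l f g : (forall th, V th -> f th = g th) -> rat V k l f -> rat V k l g.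
Proof.
by move=> fg [p [q [pp pq h]]]; exists p, q; split=> // th Vth; rewrite -fg //; exact: h.
Qed.

Lemma ratW V k k' l l' f : (k <= k')%N -> (l <= l')%N -> rat V k l f -> rat V k' l' f.
Proof.
by move=> kk ll [p [q [pp pq h]]]; exists p, q; split=> //; [exact: polyfunW pp|exact: polyfunW pq].
Qed.

Lemma rat_poly V k l f : polyfun k f -> rat V k l f.
Proof.
move=> pf; exists f, (fun=> 1); split=> //; first exact: alg_cst.
by move=> th _; rewrite divr1 oner_eq0.
Qed.

Lemma rat_cst V k l r : rat V k l (fun=> r).
Proof. by apply: rat_poly; exact: alg_cst. Qed.

Lemma ratD V k l f g : (l <= k)%N -> rat V k l f -> rat V k l g ->
  rat V k l (fun z => f z + g z).
Proof.
move=> lk [p [q [pp pq h]]] [p' [q' [pp' pq' h']]].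
exists (fun z => p z * q' z + p' z * q z), (fun z => q z * q' z); split.
- by apply: alg_add; apply: alg_mul => //; exact: polyfunW lk _.
- exact: alg_mul.
move=> th Vth; have [q0 ->] := h th Vth; have [q0' ->] := h' th Vth.
by rewrite mulf_neq0 //; split=> //; field; rewrite q0 q0'.
Qed.

Lemma ratM V k l f g : rat V k l f -> rat V k l g -> rat V k l (fun z => f z * g z).
Proof.
move=> [p [q [pp pq h]]] [p' [q' [pp' pq' h']]].
exists (fun z => p z * p' z), (fun z => q z * q' z); split; try exact: alg_mul.
move=> th Vth; have [q0 ->] := h th Vth; have [q0' ->] := h' th Vth.
by rewrite mulf_neq0 //; split=> //; field; rewrite q0 q0'.
Qed.

Lemma ratN V k l f : rat V k l f -> rat V k l (fun z => - f z).
Proof.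
move=> rf; apply: rat_ext (ratM (rat_cst V k l (-1)) rf) => th _; exact: mulN1r.
Qed.

Lemma ratX V k l f n : rat V k l f -> rat V k l (fun z => f z ^+ n).
Proof.
move=> rf; elim: n => [|n IH].
  by apply: rat_ext (rat_cst V k l 1) => th _; rewrite expr0.
by apply: rat_ext (ratM rf IH) => th _; rewrite exprS.
Qed.

Lemma rat_sum V k l n (F : 'I_n -> jt -> R) : (l <= k)%N -> (forall i, rat V k l (F i)) ->
  rat V k l (fun z => \sum_i F i z).
Proof.
move=> lk; elim: n F => [|n IH] F hF.
  by apply: rat_ext (rat_cst V k l 0) => th _; rewrite big_ord0.
apply: rat_ext (ratD lk (hF ord0) (IH _ (fun i => hF (lift ord0 i)))) => th _.
by rewrite big_ord_recl.
Qed.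

Lemma ratV V k f : rat V k k f -> (forall th, V th -> f th != 0) ->
  rat V k k (fun z => (f z)^-1).
Proof.
move=> [p [q [pp pq h]]] f0; exists q, p; split=> // th Vth.
have [q0 e] := h th Vth; have := f0 th Vth; rewrite e mulf_eq0 negb_or => /andP[p0 _].
by rewrite p0 invf_div.
Qed.

Lemma rat_dflow V k l f a th : flow_stable V -> rat V k l f -> V th -> dflow a f th.
Proof.
move=> sV [p [q [pp pq h]]] Vth.
apply: (dflow_on sV Vth (f := fun z => p z / q z) _ _).1 => [z /h[_ ->] //|].
apply: (DtM _ _).1; first exact: polyfun_dflow pp.
by apply: (DtV _ _).1; [exact: polyfun_dflow pq|case: (h th Vth)].
Qed.

Arguments rat_dflow {V k l f} a {th}.

(** Quotient rule over q^2: the derivative of q, of order l + 1, appears only in the numerator,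
    where l <= k makes room for it. *)
Lemma rat_Dt V k l f a : flow_stable V -> (l <= k)%N -> rat V k l f -> rat V k.+1 l (Dt a f).
Proof.
move=> sV lk [p [q [pp pq h]]].
exists (fun z => Dt a p z * q z - p z * Dt a q z), (fun z => q z * q z); split.
- apply: alg_sub; apply: alg_mul.
  + exact: polyfun_Dt.
  + by apply: polyfunW pq; exact: leqW.
  + exact: polyfunW pp.
  + by apply: (@polyfunW l.+1) => //; exact: polyfun_Dt.
- exact: alg_mul.
move=> th Vth; have [q0 _] := h th Vth; split; first by rewrite mulf_neq0.
have dp := polyfun_dflow a th pp; have dq := polyfun_dflow a th pq.
have [dV eV] := DtV dq q0; have [dM eM] := DtM dp dV.
have fe z : V z -> p z / q z = f z by case/h.
rewrite -(dflow_on sV Vth fe dM).2 eM eV; field; exact: q0.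
Qed.

Lemma Dt_on V k l f g a th : flow_stable V -> rat V k l f -> V th ->
  (forall z, V z -> f z = g z) -> Dt a f th = Dt a g th.
Proof. by move=> sV rf Vth fg; apply: (dflow_on sV Vth fg (rat_dflow a sV rf Vth)).2. Qed.

Lemma rat_DtD V k l k' l' f g a th : flow_stable V -> rat V k l f -> rat V k' l' g -> V th ->
  Dt a (fun z => f z + g z) th = Dt a f th + Dt a g th.
Proof. by move=> sV rf rg Vth; apply: (DtD _ _).2; apply: rat_dflow sV _ Vth; eassumption. Qed.

Lemma rat_DtM V k l k' l' f g a th : flow_stable V -> rat V k l f -> rat V k' l' g -> V th ->
  Dt a (fun z => f z * g z) th = Dt a f th * g th + f th * Dt a g th.
Proof. by move=> sV rf rg Vth; apply: (DtM _ _).2; apply: rat_dflow sV _ Vth; eassumption. Qed.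

Lemma rat_DtN V k l f a th : flow_stable V -> rat V k l f -> V th ->
  Dt a (fun z => - f z) th = - Dt a f th.
Proof.
move=> sV rf Vth; rewrite -[RHS]mulN1r -(@Dt_on V k l (fun z => -1 * f z)) //.
- by rewrite (rat_DtM a sV (rat_cst V k l (-1)) rf Vth) Dt_cst mul0r add0r.
- by apply: ratM => //; exact: rat_cst.
- by move=> z _; rewrite mulN1r.
Qed.

Lemma rat_DtV V k l f a th : flow_stable V -> rat V k l f -> V th -> f th != 0 ->
  Dt a (fun z => (f z)^-1) th = - Dt a f th / f th ^+ 2.
Proof. by move=> sV rf Vth f0; apply: (DtV _ _).2 => //; exact: rat_dflow sV rf Vth. Qed.

(** * Restriction to the jets of a section *)

Section Restriction.
Variables (O : set V4) (s : V4 -> fibre -> R).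
Hypothesis oO : open O.
Hypothesis ss : forall c, smooth_on O (fun q => s q c).

Lemma smooth_pder_midx al F : smooth_on O F -> smooth_on O (pder_midx al F).
Proof. by rewrite pder_midxE; exact: smooth_on_Dw. Qed.

(** The characteristic property of total derivatives. On the fibre coordinates it is the symmetry of
    partial derivatives, through [pder_midxS]. *)
Lemma polyfun_section k f : polyfun k f -> smooth_on O (fun q => f (jet_of s q)) /\
  forall q a, O q -> pder a (fun q => f (jet_of s q)) q = Dt a f (jet_of s q).
Proof.
elim=> [r|g [b|c al kal]|g h pg [sg ig] ph [sh ih]|g h pg [sg ig] ph [sh ih]].
- by split=> [|q a Oq]; [exact: smooth_cst|rewrite pder_cst Dt_cst].
- by split=> [|q a Oq]; [exact: smooth_coord|rewrite pder_coord Dt_base].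
- split=> [|q a Oq] /=; first exact: smooth_pder_midx (ss c).
  by rewrite Dt_coord (@pder_midxS _ O).
- split=> [|q a Oq]; first exact: smoothD.
  rewrite (DtD (polyfun_dflow a _ pg) (polyfun_dflow a _ ph)).2 -ig // -ih //.
  by apply: pderD; [exact: smooth_on_diff sg Oq|exact: smooth_on_diff sh Oq].
- split=> [|q a Oq]; first exact: smoothM.
  rewrite (DtM (polyfun_dflow a _ pg) (polyfun_dflow a _ ph)).2 -ig // -ih //.
  by apply: pderM; [exact: smooth_on_diff sg Oq|exact: smooth_on_diff sh Oq].
Qed.

Lemma rat_section V k l f : flow_stable V -> (forall q, O q -> V (jet_of s q)) ->
  rat V k l f -> smooth_on O (fun q => f (jet_of s q)) /\
  forall q a, O q -> pder a (fun q => f (jet_of s q)) q = Dt a f (jet_of s q).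
Proof.
move=> sV OV rf; have [p [q [pp pq h]]] := rf.
have [sp ip] := polyfun_section pp; have [sq iq] := polyfun_section pq.
have q0 z : O z -> q (jet_of s z) != 0 by move=> /OV/h[].
have sqV := smoothV oO sq q0.
have e z : O z -> p (jet_of s z) / q (jet_of s z) = f (jet_of s z) by move=> /OV/h[].
split=> [|z a Oz]; first exact: smooth_ext oO e (smoothM oO sp sqV).
rewrite -(@pder_on _ O _ _ a oO e) // pderM ?ip //; last 2 first.
- exact: smooth_on_diff sp Oz.
- exact: smooth_on_diff sqV Oz.
rewrite pderV ?iq ?q0 //; last exact: smooth_on_diff sq Oz.
have dp := polyfun_dflow a (jet_of s z) pp; have dq := polyfun_dflow a (jet_of s z) pq.
have [dV eV] := DtV dq (q0 z Oz); have [dM eM] := DtM dp dV.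
have fe y : V y -> p y / q y = f y by case/h.
by rewrite -(dflow_on sV (OV _ Oz) fe dM).2 eM eV; congr (_ + _ * _); rewrite !mulNr mulrC.
Qed.

End Restriction.

End Jets.

Section Realize.
Variable R : realType.
Notation V4 := 'rV[R]_4.
Notation jt := (jet R).
Implicit Types (f g : jt -> R) (th : jt) (V : jt -> Prop) (a b : 'I_4) (F : V4 -> R).

(** * Kundt sections with a prescribed jet *)

Section Truncation.
Variable v0 : R.

Definition freeze_v (q : V4) : V4 := \row_b (if b == iv then v0 else q 0 b).

Lemma smooth_freeze b : smooth_on setT (fun q => freeze_v q 0 b).
Proof.
have [e|e] := eqVneq b iv.
  by rewrite (_ : (fun q => _) = fun=> v0); [exact: smooth_cst|apply/funext => q; rewrite mxE e eqxx].
rewrite (_ : (fun q => _) = fun q : V4 => q 0 b); first exact: smooth_coord.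
by apply/funext => q; rewrite mxE (negbTE e).
Qed.

Lemma pder_freeze F a q : smooth_on setT F ->
  pder a (fun z => F (freeze_v z)) q = if a == iv then 0 else pder a F (freeze_v q).
Proof.
move=> sF; rewrite pder_comp; last 2 first.
- exact: smooth_on_diff sF _.
- by move=> b; exact: smooth_on_diff (@smooth_freeze b) _.
have E b : pder a (fun z => freeze_v z 0 b) q = (if b == iv then 0 else (a == b)%:R).
  have [e|e] := eqVneq b iv.
    rewrite (_ : (fun q => _) = fun=> v0) ?pder_cst //.
    by apply/funext => z; rewrite mxE e eqxx.
  rewrite (_ : (fun q => _) = fun q : V4 => q 0 b) ?pder_coord //.
  by apply/funext => z; rewrite mxE (negbTE e).
rewrite (bigD1 a) //= big1 ?addr0 => [|b ba]; rewrite E.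
  by case: ifP; rewrite ?mulr0 // eqxx mulr1.
by rewrite (eq_sym a) (negbTE ba); case: ifP; rewrite mulr0.
Qed.

Definition vpow j (q : V4) : R := (q 0 iv - v0) ^+ j / j`!%:R.

Lemma vpow_pder j a q : differentiable (vpow j) q /\
  pder a (vpow j) q = if (a == iv) && (0 < j)%N then vpow j.-1 q else 0.
Proof.
pose P : {poly R} := ('X - v0%:P) ^+ j * (j`!%:R^-1)%:P.
have hP : vpow j = fun q : V4 => P.[q 0 iv].
  by apply/funext => z; rewrite /P !hornerE /vpow.
have [d e] := diff_coord_comp (@derivable_horner _ P (q 0 iv)).
rewrite hP; split=> //; rewrite e -derivE /P derivM derivC mulr0 addr0 deriv_exp derivXsubC.
case: eqP => _ /=; last by rewrite mul0r.
rewrite mul1r mul1r; case: j @P hP d e => [|j] P _ _ _ /=.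
  by rewrite mulr0n mul0r horner0.
rewrite !hornerE hornerMn !hornerE /vpow factS natrM invfM -mulr_natr mulrA.
by rewrite -[X in X * _ = _]mulrA mulfV ?mulr1 // pnatr_eq0.
Qed.

Lemma smooth_vpow j : smooth_on setT (vpow j).
Proof.
apply: (smooth_coind (P := fun F => F = (fun=> 0) \/ exists j, F = vpow j)) => //.
- exact: openT.
- move=> F [->|[i ->]].
    split=> [q _|a]; first exact: differentiable_cst.
    by exists (fun=> 0) => [|q _]; [left|rewrite pder_cst].
  split=> [q _|a]; first exact: (vpow_pder i iv q).1.
  exists (if (a == iv) && (0 < i)%N then vpow i.-1 else (fun=> 0)) => [|q _].
    by case: ifP => _; [right; exists i.-1|left].
  by rewrite (vpow_pder i a q).2; case: ifP.
by right; exists j.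
Qed.

(** The Taylor polynomial of F in v at v0, of degree below n. Borel's theorem controls derivatives
    at one point only; truncation makes the v-equations hold everywhere and keeps a jet that already
    satisfies them. *)
Definition vtrunc n F (q : V4) : R :=
  \sum_(j < n) vpow j q * Dw (nseq j iv) F (freeze_v q).

Let oT : open (@setT V4) := openT.

Lemma smooth_vterm j F : smooth_on setT F ->
  smooth_on setT (fun q => vpow j q * Dw (nseq j iv) F (freeze_v q)).
Proof.
move=> sF; apply: smoothM => //; first exact: smooth_vpow.
by apply: (smooth_comp oT (smooth_on_Dw (nseq j iv) sF)) => // b; exact: smooth_freeze.
Qed.

Lemma smooth_vtrunc n F : smooth_on setT F -> smooth_on setT (vtrunc n F).
Proof. by move=> sF; apply: smooth_sum => // i; exact: smooth_vterm. Qed.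

Lemma pder_vtrunc n F a q : smooth_on setT F ->
  pder a (vtrunc n F) q = vtrunc (if a == iv then n.-1 else n) (pder a F) q.
Proof.
move=> sF; have := @Dw_sum _ setT [:: a] q n
  (fun j q => vpow j q * Dw (nseq j iv) F (freeze_v q)) oT I.
rewrite /= => -> //; last by move=> i; exact: smooth_vterm.
have sD j : smooth_on setT (Dw (nseq j iv) F) by exact: smooth_on_Dw.
have E (j : nat) : pder a (fun q => vpow j q * Dw (nseq j iv) F (freeze_v q)) q =
    if a == iv then (if j is j'.+1 then vpow j' q * Dw (nseq j' iv) (pder a F) (freeze_v q) else 0)
    else vpow j q * Dw (nseq j iv) (pder a F) (freeze_v q).
  rewrite pderM; last 2 first.
  - exact: (vpow_pder j a q).1.
  - apply: smooth_on_diff (I : setT q).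
    by apply: (smooth_comp oT (sD j)) => // b; exact: smooth_freeze.
  rewrite (vpow_pder j a q).2 pder_freeze //; case: eqP => /= [->|_].
    by rewrite mulr0 addr0; case: j => [|j] /=; rewrite ?mul0r // (@pder_Dw _ setT).
  by rewrite mul0r add0r (@pder_Dw _ setT).
rewrite (eq_bigr _ (fun (i : 'I_n) _ => E i)) /vtrunc; case: eqP => // ->.
by case: n => [|n]; rewrite ?big_ord0 // big_ord_recl /= add0r.
Qed.

Lemma Dw_vtrunc n F w q : smooth_on setT F ->
  Dw w (vtrunc n F) q = vtrunc (n - count_mem iv w) (Dw w F) q.
Proof.
move=> sF; elim: w q => [|a w IH] q; first by rewrite subn0.
rewrite /= (_ : Dw w (vtrunc n F) = vtrunc (n - count_mem iv w) (Dw w F)); last exact/funext.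
rewrite pder_vtrunc; last exact: smooth_on_Dw.
by case: eqP => _ /=; rewrite ?add0n // add1n subnS.
Qed.

Lemma vtrunc_at n F (p : V4) : p 0 iv = v0 -> vtrunc n F p = if n is 0 then 0 else F p.
Proof.
move=> pv; have pp : freeze_v p = p.
  by apply/rowP => b; rewrite mxE; case: eqP => // ->.
case: n => [|n]; first by rewrite /vtrunc big_ord0.
rewrite /vtrunc big_ord_recl big1 ?addr0 /= => [|i _].
  by rewrite /vpow fact0 expr0 divr1 mul1r pp.
by rewrite /vpow pv subrr expr0n /= mul0r mul0r.
Qed.

End Truncation.

Lemma count_wd al : count_mem iv (wd al) = al iv.
Proof. by have /ffunP/(_ iv) := wcnt_wd al; rewrite ffunE. Qed.

Lemma realize_jet (bs : V4) (jc : fibre -> midx -> R) :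
  (forall c (al : midx), (vdeg c < al iv)%N -> jc c al = 0) ->
  exists s : V4 -> fibre -> R, [/\ forall c, smooth_on setT (fun q => s q c),
    jet_of s bs = Jet bs jc &
    forall q c (al : midx), (vdeg c < al iv)%N -> jcoord (jet_of s q) c al = 0].
Proof.
move=> hv; have /choice[F hF] c : exists F, smooth_on setT F /\
    forall w, Dw w F bs = jc c (wcnt w).
  by have [F sF h] := borel (jc c) bs; exists F.
pose s q c := vtrunc (bs 0 iv) (vdeg c).+1 (F c) q.
have sF c : smooth_on setT (F c) by case: (hF c).
exists s; split=> [c||q c al h] /=; first exact: smooth_vtrunc.
  apply: jet_eq => //= c al.
  rewrite pder_midxE Dw_vtrunc // vtrunc_at // count_wd.
  case E : (_ - _)%N => [|m]; last by rewrite (hF c).2 wcnt_wd.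
  by rewrite hv // -subn_eq0 E.
rewrite pder_midxE Dw_vtrunc // count_wd (_ : (_ - _)%N = 0%N); last first.
  by apply/eqP; rewrite subn_eq0.
by rewrite /vtrunc big_ord0.
Qed.

Definition jets_in V (O : set V4) (s : V4 -> fibre -> R) :=
  [/\ open O, forall c, smooth_on O (fun q => s q c) & forall q, O q -> V (jet_of s q)].

Definition realizable V := forall th, V th -> exists O s,
  [/\ jets_in V O s, O (base th) & jet_of s (base th) = th].

Lemma jets_in_cont V O s k f p : jets_in V O s -> polyfun k f -> O p ->
  {for p, continuous (fun q => f (jet_of s q))}.
Proof.
by move=> [oO ss _] pf Op; apply: smooth_on_cont Op; exact: (polyfun_section oO ss pf).1.
Qed.

Lemma open_cut O (f : V4 -> R) (A : set R) : open O -> open A ->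
  (forall p, O p -> {for p, continuous f}) -> open [set p | O p /\ A (f p)].
Proof.
move=> oO oA fc; rewrite openE => p [Op Ap]; rewrite /interior.
have h1 : \forall q \near p, O q by exact: (open_nbhs_nbhs (conj oO Op)).
have h2 : \forall q \near p, A (f q).
  by have := fc p Op A; apply; apply: open_nbhs_nbhs.
exact: filterS2 h1 h2.
Qed.

Lemma realizable_Eoo : realizable (@Eoo R).
Proof.
move=> th Eth; have /EooP[/posdefP[h1 h2] hv] := Eth.
have [s [ss sth sv]] := realize_jet (base th) hv.
have {}sth : jet_of s (base th) = th by rewrite sth; case: (th).
have oT : open (@setT V4) by exact: openT.
have c1 p : setT p -> {for p, continuous (fun q => jet0 (jet_of s q) fh11)}.
  move=> _; apply: smooth_on_cont (I : setT p).
  exact: (polyfun_section oT ss (polyfun_jet0 R fh11)).1.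
have c2 p : setT p -> {for p, continuous (fun q => deth (jet_of s q))}.
  move=> _; apply: smooth_on_cont (I : setT p).
  exact: (polyfun_section oT ss (polyfun_deth R)).1.
have o1 := open_cut oT (@open_gt R 0) c1; have o2 := open_cut oT (@open_gt R 0) c2.
exists ([set p | setT p /\ 0 < jet0 (jet_of s p) fh11] `&`
        [set p | setT p /\ 0 < deth (jet_of s p)]), s; split=> //.
- split; first exact: openI.
    by move=> c; apply: smooth_onS (ss c).
  move=> q [[_ q1] [_ q2]]; apply/EooP; split; first by apply/posdefP.
  exact: sv.
- by split; split=> //; rewrite sth.
Qed.

Lemma realizable_Enz k u : polyfun k u -> realizable (Enz u).
Proof.
move=> pu th [Eth uth]; have [A [s [jO Oth sth]]] := realizable_Eoo Eth.
have [oO ss OE] := jO.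
have oneq : open [set y : R | y != 0] by exact: open_neq.
have oc : open [set p | A p /\ [set y : R | y != 0] (u (jet_of s p))].
  apply: (@open_cut A (fun p => u (jet_of s p)) [set y | y != 0]) => //.
  by move=> p Op; exact: jets_in_cont jO pu Op.
exists [set p | A p /\ [set y : R | y != 0] (u (jet_of s p))], s; split=> //.
- split=> // [c|q [Aq uq]]; first by apply: smooth_onS (ss c) => q [].
  by split; [exact: OE|].
- by split=> //=; rewrite sth.
Qed.

(** Stability makes [Dt] depend on values in V alone; realizability turns [Dt] into a partial
    derivative along a section whose jets stay in V. *)
Definition good V := [/\ flow_stable V, realizable V & forall th, V th -> Eoo th].

Lemma good_Eoo : good (@Eoo R).
Proof. by split=> //; [exact: Eoo_stable|exact: realizable_Eoo]. Qed.

Lemma good_Enz k u : polyfun k u -> good (Enz u).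
Proof. by move=> pu; split=> [||th []//]; [exact: Enz_stable pu|exact: realizable_Enz pu]. Qed.

Lemma good_eq V V' : (forall th, V th <-> V' th) -> good V -> good V'.
Proof.
by move=> VV; suff -> : V = V' by []; apply/funext => th; apply/propext.
Qed.

(** * Calculus of rational functions on a good set of jets *)

Definition ra V f := exists k, rat V k k f.

Lemma ra_ext V f g : (forall th, V th -> f th = g th) -> ra V f -> ra V g.
Proof. by move=> fg [k h]; exists k; exact: rat_ext h. Qed.

Lemma ra_max V k f : rat V k k f -> forall l, (k <= l)%N -> rat V l l f.
Proof. by move=> rf l kl; exact: (ratW kl kl rf). Qed.

Lemma ra2 V f g : ra V f -> ra V g -> exists k, rat V k k f /\ rat V k k g.
Proof.
move=> [k rf] [l rg]; exists (maxn k l).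
by split; [exact: ra_max rf _ (leq_maxl _ _)|exact: ra_max rg _ (leq_maxr _ _)].
Qed.

Lemma ra_poly V k f : polyfun k f -> ra V f.
Proof. by move=> pf; exists k; exact: rat_poly. Qed.

Lemma ra_cst V r : ra V (fun=> r).
Proof. by exists 0%N; exact: rat_cst. Qed.

Lemma ra_jcoord V c al : ra V (fun th => jcoord th c al).
Proof. by apply: (@ra_poly V (midx_order al)); apply: alg_gen; constructor. Qed.

Lemma raD V f g : ra V f -> ra V g -> ra V (fun z => f z + g z).
Proof. by move=> rf rg; have [k [? ?]] := ra2 rf rg; exists k; exact: ratD. Qed.

Lemma raM V f g : ra V f -> ra V g -> ra V (fun z => f z * g z).
Proof. by move=> rf rg; have [k [? ?]] := ra2 rf rg; exists k; exact: ratM. Qed.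

Lemma raN V f : ra V f -> ra V (fun z => - f z).
Proof. by move=> [k rf]; exists k; exact: ratN. Qed.

Lemma raB V f g : ra V f -> ra V g -> ra V (fun z => f z - g z).
Proof. by move=> rf rg; apply: raD => //; exact: raN. Qed.

Lemma raX V f n : ra V f -> ra V (fun z => f z ^+ n).
Proof. by move=> [k rf]; exists k; exact: ratX. Qed.

Lemma raV V f : ra V f -> (forall th, V th -> f th != 0) -> ra V (fun z => (f z)^-1).
Proof. by move=> [k rf] f0; exists k; exact: ratV. Qed.

Lemma ra_sum V n (F : 'I_n -> jt -> R) : (forall i, ra V (F i)) ->
  ra V (fun z => \sum_i F i z).
Proof.
elim: n F => [|n IH] F hF.
  by apply: ra_ext (ra_cst V 0) => th _; rewrite big_ord0.
apply: ra_ext (raD (hF ord0) (IH _ (fun i => hF (lift ord0 i)))) => th _.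
by rewrite big_ord_recl.
Qed.

Section Good.
Variable V : jt -> Prop.
Hypothesis gV : good V.

Let sV : flow_stable V. Proof. by case: gV. Qed.

Lemma ra_Dt f a : ra V f -> ra V (Dt a f).
Proof. by move=> [k rf]; exists k.+1; apply: ratW (leqnn _) (leqnSn _) _; exact: rat_Dt. Qed.

Lemma Dt_eq f g a th : ra V f -> V th -> (forall z, V z -> f z = g z) -> Dt a f th = Dt a g th.
Proof. by move=> [k rf]; exact: Dt_on rf. Qed.

Lemma Dt_add f g a th : ra V f -> ra V g -> V th ->
  Dt a (fun z => f z + g z) th = Dt a f th + Dt a g th.
Proof. by move=> [k rf] [l rg]; exact: rat_DtD rf rg. Qed.

Lemma Dt_mul f g a th : ra V f -> ra V g -> V th ->
  Dt a (fun z => f z * g z) th = Dt a f th * g th + f th * Dt a g th.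
Proof. by move=> [k rf] [l rg]; exact: rat_DtM rf rg. Qed.

Lemma Dt_opp f a th : ra V f -> V th -> Dt a (fun z => - f z) th = - Dt a f th.
Proof. by move=> [k rf]; exact: rat_DtN rf. Qed.

Lemma Dt_sub f g a th : ra V f -> ra V g -> V th ->
  Dt a (fun z => f z - g z) th = Dt a f th - Dt a g th.
Proof. by move=> rf rg Vth; rewrite Dt_add ?Dt_opp //; exact: raN. Qed.

Lemma Dt_inv f a th : ra V f -> V th -> f th != 0 ->
  Dt a (fun z => (f z)^-1) th = - Dt a f th / f th ^+ 2.
Proof. by move=> [k rf]; exact: rat_DtV rf. Qed.

Lemma Dt_zero f a th : V th -> (forall z, V z -> f z = 0) -> Dt a f th = 0.
Proof.
move=> Vth f0; rewrite -(@Dt_eq (fun=> 0) f) ?Dt_cst //; first exact: ra_cst.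
by move=> z /f0.
Qed.

Lemma ra_section O s f : jets_in V O s -> ra V f -> smooth_on O (fun q => f (jet_of s q)) /\
  forall q a, O q -> pder a (fun q => f (jet_of s q)) q = Dt a f (jet_of s q).
Proof. by move=> [oO ss OV] [k rf]; exact: (rat_section oO ss sV OV rf). Qed.

(** Along a section through th both sides are mixed partial derivatives of one smooth function. *)
Lemma DtC f a b th : ra V f -> V th -> Dt a (Dt b f) th = Dt b (Dt a f) th.
Proof.
move=> rf Vth; have [_ rV _] := gV; have [A [s [jO Oth sth]]] := rV _ Vth.
have [oO ss OV] := jO; have [sf df] := ra_section jO rf.
have D c d : Dt c (Dt d f) th = pder c (pder d (fun q => f (jet_of s q))) (base th).
  have [_ dd] := ra_section jO (ra_Dt d rf).
  have e := dd _ c Oth; rewrite sth in e; apply: (etrans (esym e)).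
  exact: (@pder_on _ A _ _ c oO (fun q Aq => esym (df q d Aq)) _ Oth).
by rewrite !D; exact: (pderC a b oO sf).
Qed.

End Good.

End Realize.

Section Explicit.
Variable R : realType.
Notation V4 := 'rV[R]_4.
Notation jt := (jet R).
Implicit Types (f g : jt -> R) (th : jt) (V : jt -> Prop) (a b : 'I_4).
Notation I1 := (@I1 R).
Notation I2a := (@I2a R).
Notation I2b := (@I2b R).
Notation c1_23 := (@c1_23 R).

(** * The invariant frame in coordinates *)

Lemma row4E (x y z t : R) : [/\ row4 x y z t 0 iu = x, row4 x y z t 0 ix1 = y,
  row4 x y z t 0 ix2 = z & row4 x y z t 0 iv = t].
Proof. by split; rewrite mxE. Qed.

Lemma row4P (X Y : V4) : X 0 iu = Y 0 iu -> X 0 ix1 = Y 0 ix1 -> X 0 ix2 = Y 0 ix2 ->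
  X 0 iv = Y 0 iv -> X = Y.
Proof. by move=> e0 e1 e2 e3; apply/rowP => a; case: (ord4P a) => ->. Qed.

Lemma mul_metric (y : fibre -> R) (X : V4) : X *m metric_mx y = row4
  (X 0 iu * y fH + X 0 ix1 * y fW1 / 2 + X 0 ix2 * y fW2 / 2 + X 0 iv / 2)
  (X 0 iu * y fW1 / 2 + X 0 ix1 * y fh11 + X 0 ix2 * y fh12)
  (X 0 iu * y fW2 / 2 + X 0 ix1 * y fh12 + X 0 ix2 * y fh22)
  (X 0 iu / 2).
Proof.
by apply: row4P; rewrite !mxE big_ord4 !mxE /=; ring.
Qed.

Lemma unitmx_inj n (A : 'M[R]_n) : (forall v : 'rV_n, v *m A = 0 -> v = 0) -> A \in unitmx.
Proof. by move=> h; rewrite -row_free_unit; apply: inj_row_free. Qed.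

Lemma metric_unit th : Eoo th -> gmx th \in unitmx.
Proof.
move=> Eth; have d0 := deth_gt0 Eth; apply: unitmx_inj => X; rewrite /gmx mul_metric => /rowP h.
have e a := h a; have := e iv; have := e ix1; have := e ix2; have := e iu.
rewrite !mxE /= => h0 h2 h1 hv.
have Xu : X 0 iu = 0 by move: hv => /eqP; rewrite mulf_eq0 invr_eq0 pnatr_eq0 orbF => /eqP.
rewrite Xu !mul0r !add0r in h0 h1 h2.
have X1 : X 0 ix1 = 0.
  apply: (mulfI (lt0r_neq0 d0)); rewrite mulr0 /deth.
  transitivity ((X 0 ix1 * jet0 th fh11 + X 0 ix2 * jet0 th fh12) * jet0 th fh22 -
    (X 0 ix1 * jet0 th fh12 + X 0 ix2 * jet0 th fh22) * jet0 th fh12); first by ring.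
  by rewrite h1 h2 !mul0r subrr.
have X2 : X 0 ix2 = 0.
  apply: (mulfI (lt0r_neq0 d0)); rewrite mulr0 /deth.
  transitivity ((X 0 ix1 * jet0 th fh12 + X 0 ix2 * jet0 th fh22) * jet0 th fh11 -
    (X 0 ix1 * jet0 th fh11 + X 0 ix2 * jet0 th fh12) * jet0 th fh12); first by ring.
  by rewrite h1 h2 !mul0r subrr.
apply: row4P; rewrite ?Xu ?X1 ?X2 !mxE //.
by move/eqP: h0; rewrite X1 X2 !mul0r !add0r mulf_eq0 invr_eq0 pnatr_eq0 orbF => /eqP.
Qed.

Lemma sharpP th (om X : V4) : Eoo th -> X *m gmx th = om -> sharp th om = X.
Proof. by move=> Eth <-; rewrite /sharp mulmxK // metric_unit. Qed.

Lemma gdot_sharp th (om X : V4) : Eoo th -> gdot th (sharp th om) X = \sum_a om 0 a * X 0 a.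
Proof.
move=> Eth; rewrite /gdot /sharp mulmxKV ?metric_unit // mxE.
by apply: eq_bigr => a _; rewrite mxE.
Qed.

Section Gradient.
Variable J : jt -> R.
Definition gx1 th := (jet0 th fh22 * Dt ix1 J th - jet0 th fh12 * Dt ix2 J th) / deth th.
Definition gx2 th := (jet0 th fh11 * Dt ix2 J th - jet0 th fh12 * Dt ix1 J th) / deth th.
(** The factor 2 inverts the entry 1/2 that du dv contributes to the metric. The D_u-component of
    the gradient is 0 when D_v J = 0. *)
Definition gv th := 2 * Dt iu J th - gx1 th * jet0 th fW1 - gx2 th * jet0 th fW2.
Definition grad th := row4 0 (gx1 th) (gx2 th) (gv th).

Lemma gxP th : Eoo th ->
  gx1 th * jet0 th fh11 + gx2 th * jet0 th fh12 = Dt ix1 J th /\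
  gx1 th * jet0 th fh12 + gx2 th * jet0 th fh22 = Dt ix2 J th.
Proof.
move=> Eth; have d0 := lt0r_neq0 (deth_gt0 Eth).
by rewrite /gx1 /gx2; split; rewrite /deth in d0 *; field.
Qed.

Lemma sharp_hd th : Eoo th -> Dt iv J th = 0 -> sharp th (hd J th) = grad th.
Proof.
move=> Eth Jv; apply: sharpP => //; have [h1 h2] := gxP Eth.
rewrite mul_metric /grad; have [-> -> -> ->] := row4E 0 (gx1 th) (gx2 th) (gv th).
apply: row4P; rewrite !mxE /= ?mul0r ?add0r //.
by rewrite /gv; field.
Qed.
End Gradient.

Definition w1 th := jcoord th fW1 dv.
Definition w2 th := jcoord th fW2 dv.
Definition Kw th := jcoord th fW1 (midxS ix2 dv) - jcoord th fW2 (midxS ix1 dv).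

Lemma vconst f th : (forall t, f (flow iv t th) = f th) -> Dt iv f th = 0.
Proof.
move=> h; rewrite /Dt (_ : (fun t => _) = cst (f th)); first exact: derive1_cst.
by apply/funext => t; rewrite h.
Qed.

Local Opaque Dt.

Lemma jcoord_v0 th c (al : midx) : Eoo th -> (vdeg c <= al iv)%N -> jcoord th c (midxS iv al) = 0.
Proof. by move=> /EooP[_ h] ca; rewrite h // ffunE eqxx addn1. Qed.

Lemma jcoord_vflow th c (al : midx) t : Eoo th -> (vdeg c <= al iv)%N ->
  jcoord (flow iv t th) c al = jcoord th c al.
Proof. by move=> Eth ca; rewrite /= jcoord_v0 // mulr0 addr0. Qed.

(** Only coordinates of the highest v-order allowed occur, and the v-flow adds to each a multiple of
    a coordinate that vanishes on the equation. *)
Lemma I_vflow th t : Eoo th -> [/\ I1 (flow iv t th) = I1 th,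
  I2a (flow iv t th) = I2a th & I2b (flow iv t th) = I2b th].
Proof.
move=> Eth; have jv := fun c al => @jcoord_vflow th c al t Eth.
by rewrite /Defs.I1 /Defs.I2a /Defs.I2b !jv ?ffunE // !ffunE.
Qed.

Lemma Dt_v_I th : Eoo th -> [/\ Dt iv I1 th = 0, Dt iv I2a th = 0 & Dt iv I2b th = 0].
Proof. by move=> Eth; split; apply: vconst => t; case: (I_vflow t Eth). Qed.

Definition D2 th := Dt ix1 I2a th * Dt ix2 I2b th - Dt ix2 I2a th * Dt ix1 I2b th.
Definition D3 th :=
  Dt iu I1 th * D2 th -
  Dt iu I2a th * (Dt ix1 I1 th * Dt ix2 I2b th - Dt ix2 I1 th * Dt ix1 I2b th) +
  Dt iu I2b th * (Dt ix1 I1 th * Dt ix2 I2a th - Dt ix2 I1 th * Dt ix1 I2a th).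

(* On [U] the frame is defined and the derivative of c^1_23 along v does not vanish. *)
Definition U th := [/\ Eoo th, Kw th != 0, D2 th != 0 & D3 th != 0].

Lemma UE th : U th -> Eoo th. Proof. by case. Qed.

(* The 1-form whose dual is nabla_1 is alpha du. *)
Definition alpha th := D3 th / D2 th.

Lemma ra_jet0 V c : ra V (fun th => jet0 th c).
Proof. exact: ra_jcoord. Qed.

Lemma ra_deth V : ra V (@deth R).
Proof. by apply: raB; [apply: raM|apply: raX]; exact: ra_jet0. Qed.

Lemma ra_dethV V : (forall th, V th -> Eoo th) -> ra V (fun th => (deth th)^-1).
Proof. by move=> VE; apply: raV; [exact: ra_deth|move=> th /VE/deth_gt0/lt0r_neq0]. Qed.

Lemma ra_I2a V : ra V I2a. Proof. exact: ra_jcoord. Qed.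

Section OnGood.
Variable V : jt -> Prop.
Hypothesis gV : good V.
Let VE th : V th -> Eoo th. Proof. by case: gV => _ _; apply. Qed.

Lemma ra_I1 : ra V I1.
Proof.
apply: raM; last exact: (ra_dethV VE).
by do ?[exact: ra_cst|exact: ra_jcoord|apply: raD|apply: raN|apply: raM|apply: raX].
Qed.

Lemma ra_I2b : ra V I2b.
Proof.
apply: raM; last exact: (ra_dethV VE).
by do ?[exact: ra_cst|exact: ra_jcoord|apply: raD|apply: raN|apply: raM|apply: raX].
Qed.

Lemma ra_gx1 J : ra V J -> ra V (gx1 J).
Proof.
move=> rJ; apply: raM; last exact: (ra_dethV VE).
by do ?[exact: (ra_Dt gV)|exact: ra_jet0|apply: raD|apply: raN|apply: raM].
Qed.

Lemma ra_gx2 J : ra V J -> ra V (gx2 J).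
Proof.
move=> rJ; apply: raM; last exact: (ra_dethV VE).
by do ?[exact: (ra_Dt gV)|exact: ra_jet0|apply: raD|apply: raN|apply: raM].
Qed.

Lemma ra_gv J : ra V J -> ra V (gv J).
Proof.
move=> rJ; by do ?[exact: (ra_Dt gV)|exact: ra_jet0|exact: ra_cst|exact: ra_gx1|exact: ra_gx2|
  apply: raD|apply: raN|apply: raM].
Qed.

Lemma ra_grad J a : ra V J -> ra V (fun th => grad J th 0 a).
Proof.
move=> rJ; case: (ord4P a) => ->.
- by apply: ra_ext (ra_cst V 0) => th _; rewrite mxE.
- by apply: ra_ext (ra_gx1 rJ) => th _; rewrite mxE.
- by apply: ra_ext (ra_gx2 rJ) => th _; rewrite mxE.
- by apply: ra_ext (ra_gv rJ) => th _; rewrite mxE.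
Qed.

Lemma ra_D2 : ra V D2.
Proof.
have [rf rk] := (ra_I2a V, ra_I2b).
by apply: raB; apply: raM; apply: (ra_Dt gV).
Qed.

Lemma ra_D3 : ra V D3.
Proof.
have [rf rk r1] := And3 (ra_I2a V) ra_I2b ra_I1.
have D a J : ra V J -> ra V (Dt a J) by exact: (ra_Dt gV).
apply: raD; first apply: raB.
- by apply: raM; [exact: D|exact: ra_D2].
- by apply: raM; [exact: D|apply: raB; apply: raM; exact: D].
- by apply: raM; [exact: D|apply: raB; apply: raM; exact: D].
Qed.
End OnGood.

(** The numerators of [D2] and [D3], which are rational on the equation, times [Kw] cut out U. This
    gives both genericity and [good_U]. *)
Lemma U_poly : exists k u, polyfun k u /\ forall th, U th <-> Enz u th.
Proof.
have [k2 [p2 [q2 [pp2 _ h2]]]] := ra_D2 (good_Eoo R).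
have [k3 [p3 [q3 [pp3 _ h3]]]] := ra_D3 (good_Eoo R).
have num (x p q : R) : q != 0 /\ x = p / q -> (x != 0) = (p != 0).
  by move=> [q0 ->]; rewrite mulf_eq0 invr_eq0 (negbTE q0) orbF.
pose k := maxn 2 (maxn k2 k3).
exists k, (fun th => Kw th * (p2 th * p3 th)); split.
  apply: alg_mul; last apply: alg_mul.
  - apply: (@polyfunW _ 2); first exact: leq_maxl.
    by apply: alg_sub; apply: alg_gen; constructor; rewrite !midx_orderS /midx_order big1 // => a _;
      rewrite ffunE.
  - by apply: polyfunW pp2; rewrite /k !leq_max leqnn orbT.
  - by apply: polyfunW pp3; rewrite /k !leq_max leqnn !orbT.
move=> th; split=> [[Eth K0 d2 d3]|[Eth]].
  by split=> //; rewrite !mulf_neq0 // -?(num _ _ _ (h2 th Eth)) -?(num _ _ _ (h3 th Eth)).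
rewrite !mulf_eq0 !negb_or => /and3P[K0 d2 d3]; split=> //.
  by rewrite (num _ _ _ (h2 th Eth)).
by rewrite (num _ _ _ (h3 th Eth)).
Qed.

Lemma good_U : good U.
Proof.
have [k [u [pu hu]]] := U_poly; apply: good_eq (good_Enz pu) => th.
by split => /hu.
Qed.

Ltac gen_Dt := match goal with |- context [Dt ?a ?f ?t] => generalize (Dt a f t); intros ? end.

Lemma nabla2E th : Eoo th -> nabla2 th = grad I2a th.
Proof. by move=> Eth; apply: sharp_hd => //; case: (Dt_v_I Eth). Qed.

Lemma nabla3E th : Eoo th -> nabla3 th = grad I2b th.
Proof. by move=> Eth; apply: sharp_hd => //; case: (Dt_v_I Eth). Qed.

Lemma acoefP th : D2 th != 0 -> forall i, omega (acoef th) th 0 (ix i) = 0.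
Proof.
move=> d2.
pose a1 := (Dt ix2 I1 th * Dt ix1 I2b th - Dt ix1 I1 th * Dt ix2 I2b th) / D2 th.
pose a2 := (Dt ix1 I1 th * Dt ix2 I2a th - Dt ix2 I1 th * Dt ix1 I2a th) / D2 th.
pose a : 'rV[R]_2 := \row_j (if j == ord0 then a1 else a2).
have ha : [set a | forall i : 'I_2, omega a th 0 (ix i) = 0] a.
  by move=> i; rewrite /omega !mxE /= /a1 /a2 /ix; case: ifP => _; move: d2; rewrite /D2;
    repeat gen_Dt; move=> d2; field.
exact: (xgetPex 0 (ex_intro _ a ha)).
Qed.

Lemma omegaE th : U th -> omega (acoef th) th = row4 (alpha th) 0 0 0.
Proof.
move=> [Eth _ d2 _]; have h := acoefP d2; have [v1 v2 v3] := Dt_v_I Eth.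
have o1 := h ord0; have o2 := h (lift ord0 ord0).
set om := omega _ _ in h o1 o2 *.
have e a : om 0 a = Dt a I1 th + acoef th 0 0 * Dt a I2a th + acoef th 0 1 * Dt a I2b th.
  by rewrite /om /omega !mxE.
rewrite /ix /= !e in o1 o2.
apply: row4P; rewrite [RHS]mxE /= e.
(* D3 is a determinant of the differentials of I_1, I_2a, I_2b. Adding multiples of the last two to
   the first turns it into [omega], whose x-components vanish, so D3 is the u-component of [omega]
   times D2. *)
- rewrite /alpha; apply: (mulIf d2); rewrite divfK // /D3.
  set A := acoef th 0 0 in o1 o2 *; set B := acoef th 0 1 in o1 o2 *.
  move/eqP: o1; rewrite -addrA addr_eq0 => /eqP ->.
  move/eqP: o2; rewrite -addrA addr_eq0 => /eqP ->.
  by rewrite /D2; generalize A B; repeat gen_Dt; move=> *; ring.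
- exact: o1.
- exact: o2.
- by rewrite v1 v2 v3 !mulr0 !addr0.
Qed.

Lemma alpha_neq0 th : U th -> alpha th != 0.
Proof. by move=> [_ _ d2 d3]; rewrite mulf_neq0 ?invr_eq0. Qed.

Lemma nabla1E th : U th -> nabla1 th = row4 0 0 0 (2 * alpha th).
Proof.
move=> Uth; apply: sharpP; first exact: UE.
rewrite omegaE // mul_metric; have [-> -> -> ->] := row4E 0 0 0 (2 * alpha th).
by apply: row4P; rewrite !mxE /=; field.
Qed.

Definition Delta th := gx1 I2a th * gx2 I2b th - gx2 I2a th * gx1 I2b th.

Lemma DeltaE th : Eoo th -> Delta th = D2 th / deth th.
Proof.
move=> Eth; have d0 := lt0r_neq0 (deth_gt0 Eth).
by rewrite /Delta /gx1 /gx2 /D2; rewrite /deth in d0 *; field.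
Qed.

Lemma Delta_neq0 th : U th -> Delta th != 0.
Proof.
by move=> [Eth _ d2 _]; rewrite DeltaE // mulf_neq0 ?invr_eq0 // lt0r_neq0 // deth_gt0.
Qed.

Lemma nabla4P th : U th -> [/\ gdot th (nabla1 th) (nabla4 th) = 1,
  gdot th (nabla2 th) (nabla4 th) = 0, gdot th (nabla3 th) (nabla4 th) = 0 &
  gdot th (nabla4 th) (nabla4 th) = 0].
Proof.
move=> Uth; have [Eth _ d2 _] := Uth; have a0 := alpha_neq0 Uth.
have [_ fv kv] := Dt_v_I Eth.
(* b is forced by g(nabla_1, X) = 1; g1 and g2 come by Cramer's rule from the vanishing of dI_2a and
   dI_2b on X; the v-component solves g(X, X) = 0, which is affine in it with slope b. *)
pose b := (alpha th)^-1.
pose g1 := b * (Dt ix2 I2a th * Dt iu I2b th - Dt iu I2a th * Dt ix2 I2b th) / D2 th.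
pose g2 := b * (Dt iu I2a th * Dt ix1 I2b th - Dt ix1 I2a th * Dt iu I2b th) / D2 th.
pose q := b * jet0 th fH + g1 * jet0 th fW1 + g2 * jet0 th fW2.
pose X := row4 b g1 g2 (- (q + (g1 ^+ 2 * jet0 th fh11 + 2 * g1 * g2 * jet0 th fh12 +
  g2 ^+ 2 * jet0 th fh22) / b)).
have XX : [set X | [/\ gdot th (nabla1 th) X = 1, gdot th (nabla2 th) X = 0,
                      gdot th (nabla3 th) X = 0 & gdot th X X = 0]] X.
  split.
  - rewrite gdot_sharp // omegaE // big_ord4 /= !mxE /= /b; by field.
  - rewrite gdot_sharp // big_ord4 /= !mxE /= fv mul0r addr0 /g1 /g2.
    by move: d2; rewrite /D2; generalize b; do 6!gen_Dt; move=> ? ?; field.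
  - rewrite gdot_sharp // big_ord4 /= !mxE /= kv mul0r addr0 /g1 /g2.
    by move: d2; rewrite /D2; generalize b; do 6!gen_Dt; move=> ? ?; field.
  - rewrite /gdot /gmx mul_metric mxE big_ord4 /= !mxE /= /q; field.
    by rewrite invr_eq0.
exact: (xgetPex 0 (ex_intro _ X XX)).
Qed.

Lemma nabla4_u th : U th -> alpha th * nabla4 th 0 iu = 1.
Proof.
move=> Uth; have [h _ _ _] := nabla4P Uth; move: h.
rewrite gdot_sharp; last exact: UE.
by rewrite omegaE // big_ord4 /= !mxE /= !mul0r !addr0.
Qed.

Definition frame_mx th : 'M[R]_4 := \matrix_b nabla b th.

Lemma frame_row th (r : V4) : r *m frame_mx th =
  r 0 iu *: nabla1 th + r 0 ix1 *: nabla2 th + r 0 ix2 *: nabla3 th + r 0 iv *: nabla4 th.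
Proof. by rewrite mulmx_sum_row big_ord4 /= !rowK /nabla /= !addrA. Qed.

Lemma frame_unit th : U th -> frame_mx th \in unitmx.
Proof.
move=> Uth; have Eth := UE Uth; apply: unitmx_inj => r; rewrite frame_row.
rewrite nabla1E // nabla2E // nabla3E // => /rowP h.
have := h iu; have := h ix1; have := h ix2; have := h iv; rewrite !mxE /= => hv h2 h1 h0.
have d0 := Delta_neq0 Uth; have a0 := alpha_neq0 Uth.
have ru : r 0 iv = 0.
  move: h0; rewrite !mulr0 !add0r => /eqP; rewrite mulf_eq0 => /orP[/eqP //|/eqP n0].
  by have := nabla4_u Uth; rewrite n0 mulr0 => /esym/eqP; rewrite oner_eq0.
rewrite ru !mulr0 !mul0r !add0r !addr0 in hv h1 h2.
have r1 : r 0 ix1 = 0.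
  apply: (mulIf d0); rewrite mul0r /Delta.
  transitivity ((r 0 ix1 * gx1 I2a th + r 0 ix2 * gx1 I2b th) * gx2 I2b th -
    (r 0 ix1 * gx2 I2a th + r 0 ix2 * gx2 I2b th) * gx1 I2b th); first by ring.
  by rewrite h1 h2 !mul0r subrr.
have r2 : r 0 ix2 = 0.
  apply: (mulIf d0); rewrite mul0r /Delta.
  transitivity ((r 0 ix1 * gx2 I2a th + r 0 ix2 * gx2 I2b th) * gx1 I2a th -
    (r 0 ix1 * gx1 I2a th + r 0 ix2 * gx1 I2b th) * gx2 I2a th); first by ring.
  by rewrite h1 h2 !mul0r subrr.
apply: row4P; rewrite ?ru ?r1 ?r2 !mxE //.
move/eqP: hv; rewrite r1 r2 !mul0r !addr0 mulf_eq0 mulf_eq0 (negbTE a0).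
by rewrite pnatr_eq0 !orbF => /eqP.
Qed.

Definition BR a th := \sum_b grad I2a th 0 b * Dt b (fun z => grad I2b z 0 a) th -
  \sum_b grad I2b th 0 b * Dt b (fun z => grad I2a z 0 a) th.

(** [nabla2] and [nabla3] equal the explicit gradients on the equation, which is stable under small
    flows, so the equality may be differentiated. *)
Lemma bracketE th : Eoo th -> bracket (@nabla2 R) (@nabla3 R) th = \row_a BR a th.
Proof.
move=> Eth; apply/rowP => a; rewrite !mxE /BR /vapp nabla2E // nabla3E //.
have gE := good_Eoo R.
have e2 b : Dt b (fun z => nabla2 z 0 a) th = Dt b (fun z => grad I2a z 0 a) th.
  apply/esym/(Dt_eq gE) => //; first exact/(ra_grad gE)/ra_I2a.
  by move=> z Ez; rewrite nabla2E.
have e3 b : Dt b (fun z => nabla3 z 0 a) th = Dt b (fun z => grad I2b z 0 a) th.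
  apply/esym/(Dt_eq gE) => //; first exact/(ra_grad gE)/ra_I2b.
  by move=> z Ez; rewrite nabla3E.
by congr (_ - _); apply: eq_bigr => b _; rewrite ?e2 ?e3.
Qed.

(** Coefficients of nabla_2, nabla_3 and nabla_1 in the bracket: Cramer's rule on the x-components,
    then what is left of the v-component. The coefficient of nabla_4 is 0 because fields annihilated
    by du have a bracket without D_u-component. *)
Definition cc2 th := (BR ix1 th * gx2 I2b th - BR ix2 th * gx1 I2b th) / Delta th.
Definition cc3 th := (gx1 I2a th * BR ix2 th - gx2 I2a th * BR ix1 th) / Delta th.
Definition cex th := (BR iv th - cc2 th * gv I2a th - cc3 th * gv I2b th) / (2 * alpha th).

Lemma BR_u th : Eoo th -> BR iu th = 0.
Proof.
move=> Eth.
have h J b : Dt b (fun z => grad J z 0 iu) th = 0.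
  by apply: (Dt_zero (good_Eoo R) b Eth) => z _; rewrite mxE.
have s J J' : \sum_b grad J th 0 b * Dt b (fun z => grad J' z 0 iu) th = 0.
  by apply: big1 => b _; rewrite (h J' b) mulr0.
exact: (etrans (f_equal2 (fun x y => x - y) (s I2a I2b) (s I2b I2a)) (subrr 0)).
Qed.

Lemma c1_23E th : U th -> c1_23 th = cex th.
Proof.
move=> Uth; have Eth := UE Uth; have d0 := Delta_neq0 Uth; have a0 := alpha_neq0 Uth.
rewrite /Defs.c1_23 /structure_fun.
rewrite -[nabla (Ordinal _)]/(@nabla2 R) -[X in bracket _ X]/(@nabla3 R) bracketE //.
rewrite -[\matrix_b _]/(frame_mx th).
have -> : \row_a BR a th = row4 (cex th) (cc2 th) (cc3 th) 0 *m frame_mx th.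
  rewrite frame_row; have [-> -> -> ->] := row4E (cex th) (cc2 th) (cc3 th) 0.
  rewrite nabla1E // nabla2E // nabla3E //.
  apply: row4P; rewrite !mxE /= ?BR_u // ?mulr0 ?mul0r ?addr0 ?add0r //.
  - move: d0; rewrite /cc2 /cc3 /Delta; generalize (gx1 I2a th) (gx2 I2a th) (gx1 I2b th) (gx2 I2b th).
    by generalize (BR ix1 th) (BR ix2 th) => *; field.
  - move: d0; rewrite /cc2 /cc3 /Delta; generalize (gx1 I2a th) (gx2 I2a th) (gx1 I2b th) (gx2 I2b th).
    by generalize (BR ix1 th) (BR ix2 th) => *; field.
  - by rewrite /cex; field.
by rewrite mulmxK ?frame_unit // mxE.
Qed.

Section OnU.
Let gU := good_U.
Let rf := ra_I2a U.
Let rk := ra_I2b gU.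

Lemma ra_BR a : ra U (BR a).
Proof.
by apply: raB; apply: ra_sum => b; apply: raM; do ?apply: (ra_Dt gU); exact: (ra_grad gU).
Qed.

Lemma ra_Delta : ra U Delta.
Proof. by apply: raB; apply: raM; do ?[exact: (ra_gx1 gU)|exact: (ra_gx2 gU)]. Qed.

Lemma ra_cc2 : ra U cc2.
Proof.
apply: raM; last by apply: raV ra_Delta _; exact: Delta_neq0.
by apply: raB; apply: raM; do ?[exact: (ra_gx1 gU)|exact: (ra_gx2 gU)|exact: ra_BR].
Qed.

Lemma ra_cc3 : ra U cc3.
Proof.
apply: raM; last by apply: raV ra_Delta _; exact: Delta_neq0.
by apply: raB; apply: raM; do ?[exact: (ra_gx1 gU)|exact: (ra_gx2 gU)|exact: ra_BR].
Qed.

Lemma ra_alpha : ra U alpha.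
Proof.
apply: raM; first exact: ra_D3.
by apply: raV; [exact: ra_D2|move=> th []].
Qed.

Lemma ra_cex : ra U cex.
Proof.
apply: raM; last first.
  apply: raV; first by apply: raM; [exact: ra_cst|exact: ra_alpha].
  by move=> th Uth; rewrite mulf_neq0 ?pnatr_eq0 // alpha_neq0.
apply: raB; first apply: raB; first exact: ra_BR.
  by apply: raM; [exact: ra_cc2|exact: (ra_gv gU)].
by apply: raM; [exact: ra_cc3|exact: (ra_gv gU)].
Qed.

Lemma ra_c1_23 : ra U c1_23.
Proof. by apply: ra_ext ra_cex => th Uth; rewrite c1_23E. Qed.

(** * The derivative of the fourth invariant along the null direction *)

Lemma Dt_v_jet0 c th : Eoo th -> vdeg c = 0%N -> Dt iv (fun z => jet0 z c) th = 0.
Proof. by move=> Eth c0; rewrite Dt_coord jcoord_v0 // c0. Qed.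

(** Closed under arithmetic and under [Dt]. In the computation below, what really varies with v is
    then W_1 and W_2 inside [gv]. *)
Definition vc f := ra U f /\ forall z, U z -> Dt iv f z = 0.

Lemma vc_cst r : vc (fun=> r).
Proof. by split=> [|z _]; [exact: ra_cst|rewrite Dt_cst]. Qed.

Lemma vcM f g : vc f -> vc g -> vc (fun z => f z * g z).
Proof.
move=> [rf1 f0] [rg g0]; split=> [|z Uz]; first exact: raM.
by rewrite (Dt_mul gU) // f0 // g0 // mul0r mulr0 addr0.
Qed.

Lemma vcD f g : vc f -> vc g -> vc (fun z => f z + g z).
Proof.
move=> [rf1 f0] [rg g0]; split=> [|z Uz]; first exact: raD.
by rewrite (Dt_add gU) // f0 // g0 // addr0.
Qed.

Lemma vcN f : vc f -> vc (fun z => - f z).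
Proof.
move=> [rf1 f0]; split=> [|z Uz]; first exact: raN.
by rewrite (Dt_opp gU) // f0 // oppr0.
Qed.

Lemma vcB f g : vc f -> vc g -> vc (fun z => f z - g z).
Proof. by move=> vf vg; apply: vcD => //; exact: vcN. Qed.

Lemma vcV f : vc f -> (forall z, U z -> f z != 0) -> vc (fun z => (f z)^-1).
Proof.
move=> [rf1 f0] n0; split=> [|z Uz]; first exact: raV.
by rewrite (Dt_inv gU) ?n0 // f0 // oppr0 mul0r.
Qed.

Lemma vc_Dt f a : vc f -> vc (Dt a f).
Proof.
move=> [rf1 f0]; split=> [|z Uz]; first exact: (ra_Dt gU).
by rewrite (DtC gU) // (Dt_zero gU).
Qed.

Lemma vc_ext f g : (forall z, U z -> f z = g z) -> vc f -> vc g.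
Proof.
move=> fg [rf1 f0]; split=> [|z Uz]; first exact: ra_ext rf1.
by rewrite -(Dt_eq gU _ rf1) ?f0.
Qed.

Lemma vc_jet0 c : vdeg c = 0%N -> vc (fun z => jet0 z c).
Proof. by move=> c0; split=> [|z /UE Ez]; [exact: ra_jet0|exact: Dt_v_jet0]. Qed.

Lemma vc_w1 : vc w1.
Proof.
split=> [|z /UE Ez]; first exact: ra_jcoord.
by rewrite Dt_coord jcoord_v0 // !ffunE.
Qed.

Lemma vc_w2 : vc w2.
Proof.
split=> [|z /UE Ez]; first exact: ra_jcoord.
by rewrite Dt_coord jcoord_v0 // !ffunE.
Qed.

Lemma vc_dethV : vc (fun z => (deth z)^-1).
Proof.
apply: vcV => [|z /UE/deth_gt0/lt0r_neq0 //].
apply: vcB; first by apply: vcM; exact: vc_jet0.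
by apply: (vcM (f := fun z => jet0 z fh12) (g := fun z => jet0 z fh12)); exact: vc_jet0.
Qed.

Lemma vc_gx1 J : vc J -> vc (gx1 J).
Proof.
move=> vJ; apply: vcM vc_dethV.
by apply: vcB; apply: vcM; do ?[exact: vc_jet0|exact: vc_Dt].
Qed.

Lemma vc_gx2 J : vc J -> vc (gx2 J).
Proof.
move=> vJ; apply: vcM vc_dethV.
by apply: vcB; apply: vcM; do ?[exact: vc_jet0|exact: vc_Dt].
Qed.

Lemma vc_I1 : vc I1.
Proof. by split=> [|z /UE/Dt_v_I[]//]; exact: ra_I1. Qed.

Lemma vc_I2a : vc I2a. Proof. by split=> // z /UE/Dt_v_I[]. Qed.

Lemma vc_I2b : vc I2b. Proof. by split=> // z /UE/Dt_v_I[]. Qed.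

Local Opaque gx1 gx2.

Lemma Dt_v_gv J th : vc J -> U th ->
  Dt iv (gv J) th = - (gx1 J th * w1 th + gx2 J th * w2 th).
Proof.
move=> vJ Uth; have [r1 g1] := vc_gx1 vJ; have [r2 g2] := vc_gx2 vJ.
have rj := ra_jet0 U.
have m1 : ra U (fun z => gx1 J z * jet0 z fW1) by exact: raM.
have m2 : ra U (fun z => gx2 J z * jet0 z fW2) by exact: raM.
have [rd vd] := vcM (vc_cst 2) (vc_Dt iu vJ).
have e1 : Dt iv (fun z => gx1 J z * jet0 z fW1) th = gx1 J th * w1 th.
  rewrite (@Dt_mul _ _ gU (gx1 J) (fun z => jet0 z fW1)) // g1 // mul0r add0r.
  by congr (_ * _); exact: Dt_coord.
have e2 : Dt iv (fun z => gx2 J z * jet0 z fW2) th = gx2 J th * w2 th.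
  rewrite (@Dt_mul _ _ gU (gx2 J) (fun z => jet0 z fW2)) // g2 // mul0r add0r.
  by congr (_ * _); exact: Dt_coord.
rewrite (@Dt_sub _ _ gU (fun z => 2 * Dt iu J z - gx1 J z * jet0 z fW1)) //; last exact: raB.
by rewrite (@Dt_sub _ _ gU (fun z => 2 * Dt iu J z)) // e1 e2 vd // sub0r opprD.
Qed.

Local Opaque gv Defs.I1 Defs.I2a Defs.I2b w1 w2.

Lemma Dt_v_Dt_gv J a th : vc J -> U th -> Dt iv (Dt a (gv J)) th =
  - (Dt a (gx1 J) th * w1 th + gx1 J th * Dt a w1 th +
     (Dt a (gx2 J) th * w2 th + gx2 J th * Dt a w2 th)).
Proof.
move=> vJ Uth; have [r1 g1] := vc_gx1 vJ; have [r2 g2] := vc_gx2 vJ.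
have [[rw1 _] [rw2 _]] := (vc_w1, vc_w2); have [rJ _] := vJ.
have rg : ra U (gv J) by exact: (ra_gv gU).
rewrite (@DtC _ _ gU) // (@Dt_eq _ _ gU _ (fun z => - (gx1 J z * w1 z + gx2 J z * w2 z))) //.
- rewrite (@Dt_opp _ _ gU (fun z => gx1 J z * w1 z + gx2 J z * w2 z)) //; last by apply: raD; exact: raM.
  rewrite (@Dt_add _ _ gU (fun z => gx1 J z * w1 z)); try exact: raM; last by [].
  by rewrite (@Dt_mul _ _ gU (gx1 J) w1) // (@Dt_mul _ _ gU (gx2 J) w2).
- exact: (ra_Dt gU).
- by move=> z Uz; exact: Dt_v_gv.
Qed.

Lemma gradE J : [/\ (fun z => grad J z 0 iu) = (fun=> 0), (fun z => grad J z 0 ix1) = gx1 J,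
  (fun z => grad J z 0 ix2) = gx2 J & (fun z => grad J z 0 iv) = gv J].
Proof. by split; apply/funext => z; rewrite /grad mxE. Qed.

Definition along J (F : jt -> R) th :=
  gx1 J th * Dt ix1 F th + gx2 J th * Dt ix2 F th + gv J th * Dt iv F th.

Lemma sum_grad J F th : \sum_b grad J th 0 b * Dt b F th = along J F th.
Proof.
rewrite big_ord4 /= /along /grad; have [-> -> -> ->] := row4E 0 (gx1 J th) (gx2 J th) (gv J th).
by rewrite mul0r add0r !addrA.
Qed.

Lemma BRE th : [/\ BR ix1 th = along I2a (gx1 I2b) th - along I2b (gx1 I2a) th,
  BR ix2 th = along I2a (gx2 I2b) th - along I2b (gx2 I2a) th &
  BR iv th = along I2a (gv I2b) th - along I2b (gv I2a) th].
Proof.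
have [_ a1 a2 a3] := gradE I2a; have [_ b1 b2 b3] := gradE I2b.
have S a J J' F : (fun z => grad J' z 0 a) = F ->
    \sum_b grad J th 0 b * Dt b (fun z => grad J' z 0 a) th = along J F th.
  by move=> <-; exact: sum_grad.
split; [exact: (f_equal2 (fun x y => x - y) (S _ _ _ _ b1) (S _ _ _ _ a1))
       |exact: (f_equal2 (fun x y => x - y) (S _ _ _ _ b2) (S _ _ _ _ a2))
       |exact: (f_equal2 (fun x y => x - y) (S _ _ _ _ b3) (S _ _ _ _ a3))].
Qed.

Lemma vc_along J F : vc J -> vc F -> vc (along J F).
Proof.
move=> vJ vF; apply: (vc_ext (f := fun z => gx1 J z * Dt ix1 F z + gx2 J z * Dt ix2 F z)).
  by move=> z Uz; rewrite /along (vF.2 z Uz) mulr0 addr0.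
by apply: vcD; apply: vcM; do ?[exact: vc_Dt|exact: vc_gx1|exact: vc_gx2].
Qed.

Lemma vc_BR : vc (BR ix1) /\ vc (BR ix2).
Proof.
have [va vb] := (vc_I2a, vc_I2b).
split.
  apply: (vc_ext (f := fun z => along I2a (gx1 I2b) z - along I2b (gx1 I2a) z)).
    by move=> z _; have [e _ _] := BRE z; exact: esym e.
  by apply: vcB; apply: vc_along => //; exact: vc_gx1.
apply: (vc_ext (f := fun z => along I2a (gx2 I2b) z - along I2b (gx2 I2a) z)).
  by move=> z _; have [_ e _] := BRE z; exact: esym e.
by apply: vcB; apply: vc_along => //; exact: vc_gx2.
Qed.

Lemma Dt_v_along_gv J J' th : vc J -> vc J' -> U th ->
  Dt iv (along J (gv J')) th =
    gx1 J th * Dt iv (Dt ix1 (gv J')) th + gx2 J th * Dt iv (Dt ix2 (gv J')) th +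
    Dt iv (gv J) th * Dt iv (gv J') th.
Proof.
move=> vJ vJ' Uth; have [r1 g1] := vc_gx1 vJ; have [r2 g2] := vc_gx2 vJ.
have [rv rv'] := (ra_gv gU vJ.1, ra_gv gU vJ'.1).
have rD a : ra U (Dt a (gv J')) by exact: (ra_Dt gU).
have p1 : ra U (fun z => gx1 J z * Dt ix1 (gv J') z) by exact: raM.
have p2 : ra U (fun z => gx2 J z * Dt ix2 (gv J') z) by exact: raM.
have p3 : ra U (fun z => gv J z * Dt iv (gv J') z) by exact: raM.
have vv : Dt iv (Dt iv (gv J')) th = 0.
  have [vx1 vx2] := (vc_gx1 vJ', vc_gx2 vJ').
  by rewrite Dt_v_Dt_gv // vx1.2 // vx2.2 // vc_w1.2 // vc_w2.2 // !mul0r !mulr0 !addr0 oppr0.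
rewrite (@Dt_add _ _ gU (fun z => gx1 J z * Dt ix1 (gv J') z + gx2 J z * Dt ix2 (gv J') z)
  (fun z => gv J z * Dt iv (gv J') z)) //; last exact: raD.
rewrite (@Dt_add _ _ gU (fun z => gx1 J z * Dt ix1 (gv J') z)) //.
rewrite (@Dt_mul _ _ gU (gx1 J)) // (@Dt_mul _ _ gU (gx2 J)) // (@Dt_mul _ _ gU (gv J)) //.
rewrite (g1 _ Uth) (g2 _ Uth) vv; generalize (gx1 J th) (gx2 J th) (gv J th).
by do 6!gen_Dt; move=> *; ring.
Qed.

Lemma vc_Delta : vc Delta.
Proof.
have [va vb] := (vc_I2a, vc_I2b).
by apply: vcB; apply: vcM; do ?[exact: vc_gx1|exact: vc_gx2].
Qed.

Lemma vc_DeltaV : vc (fun z => (Delta z)^-1).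
Proof. by apply: vcV; [exact: vc_Delta|exact: Delta_neq0]. Qed.

Lemma vc_cc : vc cc2 /\ vc cc3.
Proof.
have [va vb] := (vc_I2a, vc_I2b); have [vB1 vB2] := vc_BR.
by split; apply: vcM vc_DeltaV; apply: vcB; apply: vcM; do ?[exact: vc_gx1|exact: vc_gx2].
Qed.

Lemma vc_D2 : vc D2.
Proof.
have [va vb] := (vc_I2a, vc_I2b).
by apply: vcB; apply: vcM; exact: vc_Dt.
Qed.

Lemma vc_alphaV : vc (fun z => (2 * alpha z)^-1).
Proof.
have [va vb v1] := And3 vc_I2a vc_I2b vc_I1.
have D a J : vc J -> vc (Dt a J) by exact: vc_Dt.
apply: vcV => [|z Uz]; last by rewrite mulf_neq0 ?pnatr_eq0 // alpha_neq0.
apply: (vcM (f := fun=> 2)); first exact: vc_cst.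
apply: vcM; last by apply: vcV; [exact: vc_D2|move=> z []].
apply: vcD; first apply: vcB.
- by apply: vcM; [exact: D|exact: vc_D2].
- by apply: vcM; [exact: D|apply: vcB; apply: vcM; exact: D].
- by apply: vcM; [exact: D|apply: vcB; apply: vcM; exact: D].
Qed.

Lemma cc_BR th : U th ->
  cc2 th * gx1 I2a th + cc3 th * gx1 I2b th = BR ix1 th /\
  cc2 th * gx2 I2a th + cc3 th * gx2 I2b th = BR ix2 th.
Proof.
move=> Uth; have := Delta_neq0 Uth; rewrite /cc2 /cc3 /Delta.
generalize (gx1 I2a th) (gx2 I2a th) (gx1 I2b th) (gx2 I2b th) (BR ix1 th) (BR ix2 th).
by move=> *; split; field.
Qed.

Local Opaque along Delta cc2 cc3 BR Kw.

(** Put w = w1 dx^1 + w2 dx^2 and let X, Y be the x-parts of the two gradients. The v-derivatives of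
    their v-components are -w(X) and -w(Y), so the numerator of [cex] has v-derivative -X(w(Y)) +
    Y(w(X)) + w([X, Y]) = -dw(X, Y) by Cartan's formula, and dw = -K dx^1 dx^2. Products of two such
    v-derivatives are symmetric in X and Y and cancel. *)
Lemma Dt_v_cex th : U th -> 2 * alpha th * Dt iv cex th = Delta th * Kw th.
Proof.
move=> Uth; have [va vb] := (vc_I2a, vc_I2b); have [v2 v3] := vc_cc.
have rB : ra U (BR iv) by exact: ra_BR.
have [ga gb] := (ra_gv gU va.1, ra_gv gU vb.1).
have m2 : ra U (fun z => cc2 z * gv I2a z) by apply: raM => //; exact: v2.1.
have m3 : ra U (fun z => cc3 z * gv I2b z) by apply: raM => //; exact: v3.1.
have mB : ra U (fun z => BR iv z - cc2 z * gv I2a z) by exact: raB.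
have mBB : ra U (fun z => BR iv z - cc2 z * gv I2a z - cc3 z * gv I2b z) by exact: raB.
have a0 : 2 * alpha th != 0 by rewrite mulf_neq0 ?pnatr_eq0 // alpha_neq0.
rewrite (@Dt_mul _ _ gU (fun z => BR iv z - cc2 z * gv I2a z - cc3 z * gv I2b z)
  (fun z => (2 * alpha z)^-1)) //; last exact: vc_alphaV.1.
rewrite vc_alphaV.2 // mulr0 addr0 mulrC divfK //.
rewrite (@Dt_sub _ _ gU (fun z => BR iv z - cc2 z * gv I2a z)) // (@Dt_sub _ _ gU (BR iv)) //.
rewrite (@Dt_mul _ _ gU cc2) //; last exact: v2.1.
rewrite (@Dt_mul _ _ gU cc3) //; last exact: v3.1.
rewrite (v2.2 _ Uth) (v3.2 _ Uth).
have along_ra J J' : vc J -> vc J' -> ra U (along J (gv J')).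
  move=> vJ vJ'; have rg := ra_gv gU vJ'.1.
  apply: raD; first apply: raD.
  - by apply: raM; [exact: (vc_gx1 vJ).1|exact: (ra_Dt gU)].
  - by apply: raM; [exact: (vc_gx2 vJ).1|exact: (ra_Dt gU)].
  - by apply: raM; [exact: (ra_gv gU vJ.1)|exact: (ra_Dt gU)].
rewrite (@Dt_eq _ _ gU (BR iv) (fun z => along I2a (gv I2b) z - along I2b (gv I2a) z)) //;
  last by move=> z _; have [_ _ e] := BRE z; exact: e.
rewrite (@Dt_sub _ _ gU (along I2a (gv I2b))) //; try exact: along_ra.
have Fab := Dt_v_along_gv va vb Uth; have Fba := Dt_v_along_gv vb va Uth.
have Ga1 := @Dt_v_Dt_gv I2a ix1 th va Uth; have Ga2 := @Dt_v_Dt_gv I2a ix2 th va Uth.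
have Gb1 := @Dt_v_Dt_gv I2b ix1 th vb Uth; have Gb2 := @Dt_v_Dt_gv I2b ix2 th vb Uth.
have Ha := Dt_v_gv va Uth; have Hb := Dt_v_gv vb Uth.
have [B1 B2] := cc_BR Uth; have [E1 E2 _] := BRE th.
have alE J F : along J F th = gx1 J th * Dt ix1 F th + gx2 J th * Dt ix2 F th +
  gv J th * Dt iv F th by [].
have A1 := alE I2a (gx1 I2b); have A2 := alE I2a (gx2 I2b).
have A3 := alE I2b (gx1 I2a); have A4 := alE I2b (gx2 I2a).
have Z1 := (vc_gx1 va).2 _ Uth; have Z2 := (vc_gx1 vb).2 _ Uth.
have Z3 := (vc_gx2 va).2 _ Uth; have Z4 := (vc_gx2 vb).2 _ Uth.
have DE : Delta th = gx1 I2a th * gx2 I2b th - gx2 I2a th * gx1 I2b th by [].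
have KE : Kw th = Dt ix2 w1 th - Dt ix1 w2 th by rewrite !Dt_coord.
clear alE.
move: KE DE Z1 Z2 Z3 Z4 A1 A2 A3 A4 E1 E2 B1 B2 Ha Hb Ga1 Ga2 Gb1 Gb2 Fab Fba.
repeat gen_Dt.
generalize (gx1 I2a th) (gx2 I2a th) (gx1 I2b th) (gx2 I2b th) (gv I2a th) (gv I2b th).
generalize (cc2 th) (cc3 th) (w1 th) (w2 th) (Delta th) (Kw th) (BR ix1 th) (BR ix2 th).
generalize (along I2a (gx1 I2b) th) (along I2a (gx2 I2b) th).
generalize (along I2b (gx1 I2a) th) (along I2b (gx2 I2a) th).
move=> al3 al4 al1 al2 c2 c3 u1 u2 De K b1 b2 X1 X2 Y1 Y2 xv yv.
move=> -> -> -> -> -> -> -> -> -> -> e1 e2 B1 B2 -> -> -> -> -> -> -> ->.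
move: e1 e2; rewrite -B1 -B2 => e1 e2.
(* The goal follows by combining the identities for the two x-components of the bracket with
   coefficients w1 and w2. *)
match type of e1 with ?l = ?r => match type of e2 with ?l' = ?r' => match goal with
  |- _ = ?rhs => transitivity ((l - r) * u1 + (l' - r') * u2 + rhs) end end end.
  by clear; ring.
by rewrite e1 e2 !subrr !mul0r !add0r.
Qed.

Lemma Dt_v_c1_23 th : U th -> Dt iv c1_23 th != 0.
Proof.
move=> Uth; have [_ K0 _ _] := Uth.
have -> : Dt iv c1_23 th = Dt iv cex th.
  by apply: (Dt_eq gU iv ra_c1_23 Uth) => z Uz; exact: c1_23E.
have := Dt_v_cex Uth; apply: contra_eq_neq => ->.
by rewrite mulr0 eq_sym mulf_neq0 // Delta_neq0.
Qed.

End OnU.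

End Explicit.

Section Pullback.
Variable R : realType.
Notation V4 := 'rV[R]_4.
Notation jt := (jet R).
Implicit Types (f g : jt -> R) (th : jt) (V : jt -> Prop) (a b : 'I_4) (F : V4 -> R)
  (O : set V4) (p q : V4).

(** * Pullback of Kundt metrics *)

Definition jac (phi : V4 -> V4) q a b : R := pder a (fun z => phi z 0 b) q.

(** The Jacobian pattern of a pseudogroup element is all that pulling back a Kundt metric requires.
    It avoids C, A^i and B, about which [pseudogroup_at] states no differentiability. *)
Definition Gform O (phi : V4 -> V4) :=
  (forall b, smooth_on O (fun q => phi q 0 b)) /\
  forall q, O q -> [/\ jac phi q ix1 iu = 0, jac phi q ix2 iu = 0 & jac phi q iv iu = 0] /\
    [/\ jac phi q iv ix1 = 0, jac phi q iv ix2 = 0, jac phi q iu iu * jac phi q iv iv = 1 &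
    jac phi q ix1 ix1 * jac phi q ix2 ix2 - jac phi q ix1 ix2 * jac phi q ix2 ix1 != 0].

Lemma metric_bilinear (y : fibre -> R) (X Y : V4) : (X *m metric_mx y *m Y^T) 0 0 =
  X 0 iu * Y 0 iu * y fH +
  (X 0 iu * Y 0 ix1 + X 0 ix1 * Y 0 iu) * y fW1 / 2 +
  (X 0 iu * Y 0 ix2 + X 0 ix2 * Y 0 iu) * y fW2 / 2 +
  (X 0 iu * Y 0 iv + X 0 iv * Y 0 iu) / 2 +
  X 0 ix1 * Y 0 ix1 * y fh11 + (X 0 ix1 * Y 0 ix2 + X 0 ix2 * Y 0 ix1) * y fh12 +
  X 0 ix2 * Y 0 ix2 * y fh22.
Proof.
by rewrite mul_metric mxE big_ord4 /= !mxE /=; field.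
Qed.

(** The components of J g J^T for a matrix J of the pattern in [Gform]; the du dv term is unchanged
    because the u,u and v,v entries are inverse to each other. *)
Definition pull (J : 'I_4 -> 'I_4 -> R) (y : fibre -> R) (c : fibre) : R :=
  match c with
  | fH => J iu iu ^+ 2 * y fH + J iu iu * (J iu ix1 * y fW1 + J iu ix2 * y fW2) +
      J iu iu * J iu iv + (J iu ix1 ^+ 2 * y fh11 +
      2 * J iu ix1 * J iu ix2 * y fh12 + J iu ix2 ^+ 2 * y fh22)
  | fW1 => J iu iu * (J ix1 ix1 * y fW1 + J ix1 ix2 * y fW2 + J ix1 iv) +
      2 * (J iu ix1 * (J ix1 ix1 * y fh11 + J ix1 ix2 * y fh12) +
           J iu ix2 * (J ix1 ix1 * y fh12 + J ix1 ix2 * y fh22))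
  | fW2 => J iu iu * (J ix2 ix1 * y fW1 + J ix2 ix2 * y fW2 + J ix2 iv) +
      2 * (J iu ix1 * (J ix2 ix1 * y fh11 + J ix2 ix2 * y fh12) +
           J iu ix2 * (J ix2 ix1 * y fh12 + J ix2 ix2 * y fh22))
  | fh11 => J ix1 ix1 ^+ 2 * y fh11 + 2 * J ix1 ix1 * J ix1 ix2 * y fh12 +
      J ix1 ix2 ^+ 2 * y fh22
  | fh12 => J ix1 ix1 * J ix2 ix1 * y fh11 +
      (J ix1 ix1 * J ix2 ix2 + J ix1 ix2 * J ix2 ix1) * y fh12 +
      J ix1 ix2 * J ix2 ix2 * y fh22
  | fh22 => J ix2 ix1 ^+ 2 * y fh11 + 2 * J ix2 ix1 * J ix2 ix2 * y fh12 +
      J ix2 ix2 ^+ 2 * y fh22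
  end.

Lemma jacobianE phi q a b : jacobian phi q a b = jac phi q a b.
Proof. by rewrite mxE. Qed.

Lemma metric_pull O phi q (y : fibre -> R) : Gform O phi -> O q ->
  jacobian phi q *m metric_mx y *m (jacobian phi q)^T = metric_mx (pull (jac phi q) y).
Proof.
move=> [_ h] Oq; have [[j1 j2 j3] [j4 j5 j6 _]] := h q Oq.
apply/matrixP => a b.
transitivity ((row a (jacobian phi q) *m metric_mx y *m (row b (jacobian phi q))^T) 0 0).
  rewrite [LHS]mxE [RHS]mxE; apply: eq_bigr => c _; congr (_ * _); last by rewrite !mxE.
  by rewrite -row_mul [in RHS]mxE.
have rE c d : row c (jacobian phi q) 0 d = jac phi q c d by rewrite mxE jacobianE.
rewrite metric_bilinear !rE.
case: (ord4P a) => ->; case: (ord4P b) => ->; rewrite [RHS]mxE /= ?j1 ?j2 ?j3 ?j4 ?j5;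
  try rewrite -[X in _ = X / _]j6; clear;
  repeat match goal with |- context [jac phi q ?a ?b] => generalize (jac phi q a b); intro end;
  generalize (y fH) (y fW1) (y fW2) (y fh11) (y fh12) (y fh22); intros; by field.
Qed.

(** Degree below n in v: level 1 means independence of v, and a Kundt component [c] has level
    [(vdeg c).+1]. *)
Definition vdegree O n F := smooth_on O F /\ forall q, O q -> Dw (nseq n iv) F q = 0.

Section VDegree.
Variable O : set V4.
Hypothesis oO : open O.

Lemma vdegreeS n F : vdegree O n.+1 F <-> smooth_on O F /\ vdegree O n (pder iv F).
Proof.
have e q : Dw (nseq n.+1 iv) F q = Dw (nseq n iv) (pder iv F) q.
  by rewrite -Dw_rcons -cats1 -[[:: iv]]/(nseq 1 iv) -nseqD addn1.
split=> [[sF h]|[sF [_ h]]].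
  by split=> //; split=> [|q Oq]; [exact: smooth_on_pder|rewrite -e h].
by split=> // q Oq; rewrite e h.
Qed.

Lemma vdegree_ext n F G : (forall q, O q -> F q = G q) -> vdegree O n F -> vdegree O n G.
Proof.
move=> FG [sF h]; split; first exact: smooth_ext oO FG sF.
by move=> q Oq; rewrite -(Dw_on _ oO FG) // h.
Qed.

Lemma vdegreeW n m F : (n <= m)%N -> vdegree O n F -> vdegree O m F.
Proof.
move=> nm [sF h]; split=> // q Oq.
rewrite -(subnK nm) nseqD Dw_cat (@Dw_on _ O _ (fun=> 0)) //.
by case: (m - n)%N => [|k]; rewrite //= -[pder _ _]/(Dw (iv :: nseq k iv) (fun=> 0)) Dw_cst.
Qed.

Lemma vdegreeD n F G : vdegree O n F -> vdegree O n G -> vdegree O n (fun q => F q + G q).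
Proof.
move=> [sF hF] [sG hG]; split; first exact: smoothD.
by move=> q Oq; rewrite (@Dw_add _ O) // hF // hG // addr0.
Qed.

Lemma vdegreeM n F G : vdegree O 1 F -> vdegree O n G -> vdegree O n (fun q => F q * G q).
Proof.
move=> [sF hF]; elim: n G => [|n IH] G.
  move=> [sG hG]; split; first exact: smoothM.
  by move=> q Oq /=; rewrite [G q]hG // mulr0.
move=> /vdegreeS[sG vG]; apply/vdegreeS; split; first exact: smoothM.
apply: vdegree_ext (IH _ vG) => q Oq.
rewrite pderM; [|exact: smooth_on_diff sF Oq|exact: smooth_on_diff sG Oq].
by rewrite (hF q Oq : pder iv F q = 0) mul0r add0r.
Qed.

Lemma vdegree_cst c : vdegree O 1 (fun=> c).
Proof. by split=> [|q _]; [exact: smooth_cst|rewrite /= pder_cst]. Qed.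

Lemma vdegree_pder_midx n F (al : midx) q : vdegree O n F -> (n <= al iv)%N -> O q ->
  pder_midx al F q = 0.
Proof.
move=> vF nal Oq; rewrite pder_midxE /wd !Dw_cat.
have [_ h] := vdegreeW nal vF.
rewrite -2!Dw_cat (@Dw_on _ O (Dw (nseq (al iv) iv) F) (fun=> 0)) //.
by case: (_ ++ _) => // a w; rewrite Dw_cst.
Qed.
End VDegree.

Section Gmap.
Variables (O : set V4) (phi : V4 -> V4).
Hypothesis oO : open O.
Hypothesis gphi : Gform O phi.

Let sphi b : smooth_on O (fun q => phi q 0 b). Proof. by case: gphi. Qed.

Lemma smooth_jac a b : smooth_on O (fun q => jac phi q a b).
Proof. exact: smooth_on_pder. Qed.

Lemma jacC a b c q : O q -> pder c (fun z => jac phi z a b) q = pder a (fun z => jac phi z c b) q.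
Proof. by move=> Oq; exact: (pderC c a oO (sphi b)). Qed.

Lemma jac_const0 a b c q k : O q -> (forall z, O z -> jac phi z c b = k) ->
  pder c (fun z => jac phi z a b) q = 0.
Proof. by move=> Oq h; rewrite jacC // (@pder_on _ O _ (fun=> k)) // pder_cst. Qed.

Lemma jac_zero z : O z -> [/\ jac phi z ix1 iu = 0, jac phi z ix2 iu = 0 & jac phi z iv iu = 0] /\
  (jac phi z iv ix1 = 0 /\ jac phi z iv ix2 = 0).
Proof. by case: gphi => _ h /h[? []]. Qed.

Lemma jac_uu_neq0 z : O z -> jac phi z iu iu != 0.
Proof.
case: gphi => _ h /h[_ [_ _ e _]]; apply: contra_eq_neq e => ->.
by rewrite mul0r eq_sym oner_neq0.
Qed.

Lemma jac_vvE z : O z -> jac phi z iv iv = (jac phi z iu iu)^-1.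
Proof.
move=> Oz; have c0 := jac_uu_neq0 Oz; case: gphi => _ /(_ z Oz)[_ [_ _ e _]].
by apply: (mulfI c0); rewrite e mulfV.
Qed.

Lemma pder_jac_uu a z : O z -> a != iu -> pder a (fun q => jac phi q iu iu) z = 0.
Proof.
move=> Oz au; apply: (@jac_const0 _ _ _ _ 0) => // y /jac_zero[[h1 h2 h3] _].
by case: (ord4P a) au => -> au; [rewrite eqxx in au|exact: h1|exact: h2|exact: h3].
Qed.

Lemma pder_jac_vv a z : O z -> a != iu -> pder a (fun q => jac phi q iv iv) z = 0.
Proof.
move=> Oz au; rewrite (@pder_on _ O _ (fun q => (jac phi q iu iu)^-1)) //; last exact: jac_vvE.
rewrite pderV; [|exact: smooth_on_diff (smooth_jac iu iu) Oz|exact: jac_uu_neq0].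
by rewrite pder_jac_uu // mulr0.
Qed.

Lemma vdegree_jac_x a (i : 'I_4) : i = ix1 \/ i = ix2 -> vdegree O 1 (fun q => jac phi q a i).
Proof.
move=> hi; split=> [|q Oq]; first exact: smooth_jac.
apply: (@jac_const0 _ _ _ _ 0) => // z /jac_zero[_ [h4 h5]].
by case: hi => ->.
Qed.

Lemma vdegree_jac_u : vdegree O 1 (fun q => jac phi q iu iu).
Proof. by split=> [|q Oq]; [exact: smooth_jac|exact: pder_jac_uu]. Qed.

Lemma vdegree_jac_vv : vdegree O 1 (fun q => jac phi q iv iv).
Proof. by split=> [|q Oq]; [exact: smooth_jac|exact: pder_jac_vv]. Qed.

Lemma vdegree_jac_xv i : i = ix1 \/ i = ix2 -> vdegree O 1 (fun q => jac phi q i iv).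
Proof.
move=> hi; split=> [|q Oq]; first exact: smooth_jac.
by rewrite /= jacC // pder_jac_vv //; case: hi => ->.
Qed.

(** By symmetry of second derivatives the v-derivative of this entry is the u-derivative of the v,v
    entry, which does not depend on v. *)
Lemma vdegree_jac_uv : vdegree O 2 (fun q => jac phi q iu iv).
Proof.
apply/vdegreeS; split; first exact: smooth_jac.
split=> [|q Oq]; first by do 2!apply: smooth_on_pder.
have h z : O z -> pder iv (fun y => jac phi y iu iv) z = pder iu (fun y => jac phi y iv iv) z.
  exact: jacC.
apply: (etrans (pder_on iv oO h Oq)); rewrite (pderC _ _ oO (smooth_jac iv iv) Oq).
have h' z : O z -> pder iv (fun y => jac phi y iv iv) z = 0 by move=> Oz; exact: pder_jac_vv.
by apply: (etrans (pder_on iu oO h' Oq)); rewrite pder_cst.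
Qed.

(** The v-derivative of F(phi) is F_v(phi) times the v,v entry, and that factor is independent of
    v. *)
Lemma vdegree_comp O' n F : open O' -> (forall q, O q -> O' (phi q)) -> vdegree O' n F ->
  vdegree O n (fun q => F (phi q)).
Proof.
move=> oO' OO'; elim: n F => [|n IH] F.
  move=> [sF hF]; split=> [|q Oq]; first exact: smooth_comp OO'.
  by apply: hF; exact: OO'.
move=> /vdegreeS[sF vF]; apply/vdegreeS; split; first exact: (smooth_comp oO sF).
apply: (vdegree_ext oO _ (vdegreeM oO vdegree_jac_vv (IH _ vF))) => q Oq.
rewrite (@pder_comp _ F phi); last 2 first.
- by apply: smooth_on_diff sF _; exact: OO'.
- by move=> b; exact: smooth_on_diff (sphi b) Oq.
have [[_ _ h3] [h4 h5]] := jac_zero Oq.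
rewrite big_ord4 /= -/(jac phi q iv iu) -/(jac phi q iv ix1) -/(jac phi q iv ix2) -/(jac phi q iv iv).
rewrite h3 h4 h5; generalize (pder iu F (phi q)) (pder ix1 F (phi q)) (pder ix2 F (phi q)).
by generalize (pder iv F (phi q)) (jac phi q iv iv) => *; ring.
Qed.
End Gmap.

Definition pullsec (phi : V4 -> V4) (s : V4 -> fibre -> R) q : fibre -> R :=
  pull (jac phi q) (s (phi q)).

Lemma metric_inj (y y' : fibre -> R) : metric_mx y = metric_mx y' -> y = y'.
Proof.
move=> /matrixP h; have n2 : (2 : R) != 0 by rewrite pnatr_eq0.
apply/funext; case.
- by have := h iu iu; rewrite !mxE.
- by have := h iu ix1; rewrite !mxE /= => /(divIf n2).
- by have := h iu ix2; rewrite !mxE /= => /(divIf n2).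
- by have := h ix1 ix1; rewrite !mxE.
- by have := h ix1 ix2; rewrite !mxE.
- by have := h ix2 ix2; rewrite !mxE.
Qed.

Lemma posdef_pull (J : 'I_4 -> 'I_4 -> R) (y : fibre -> R) : posdef y ->
  J ix1 ix1 * J ix2 ix2 - J ix1 ix2 * J ix2 ix1 != 0 -> posdef (pull J y).
Proof.
move=> py d0 s t st.
pose s' := s * J ix1 ix1 + t * J ix2 ix1; pose t' := s * J ix1 ix2 + t * J ix2 ix2.
have st' : (s', t') != (0, 0).
  apply: contra_neq st => -[e1 e2].
  have es : s = 0.
    apply: (mulIf d0); rewrite mul0r.
    transitivity (s' * J ix2 ix2 - t' * J ix2 ix1); first by rewrite /s' /t'; ring.
    by rewrite e1 e2 !mul0r subrr.
  have et : t = 0.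
    apply: (mulIf d0); rewrite mul0r.
    transitivity (t' * J ix1 ix1 - s' * J ix1 ix2); first by rewrite /s' /t'; ring.
    by rewrite e1 e2 !mul0r subrr.
  by rewrite es et.
have := py _ _ st'; congr (_ < _); rewrite /s' /t' /=; ring.
Qed.

Section PullFunctions.
Variables (O : set V4) (J : V4 -> 'I_4 -> 'I_4 -> R) (y : V4 -> fibre -> R).
Hypothesis oO : open O.

Lemma smooth_pull c : (forall a b, smooth_on O (fun q => J q a b)) ->
  (forall c, smooth_on O (fun q => y q c)) -> smooth_on O (fun q => pull (J q) (y q) c).
Proof.
move=> sj sc; have s2 : smooth_on O (fun=> 2 : R) by exact: smooth_cst.
have sX a b : smooth_on O (fun q => J q a b ^+ 2).
  by apply: (smooth_ext oO _ (smoothM oO (sj a b) (sj a b))) => q _; rewrite expr2.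
by case: c; rewrite /pull;
  do ?[exact: sj|exact: sc|exact: sX|exact: s2|apply: (smoothD oO)|apply: (smoothM oO)].
Qed.

Hypothesis jx : forall a i, i = ix1 \/ i = ix2 -> vdegree O 1 (fun q => J q a i).
Hypothesis ju : vdegree O 1 (fun q => J q iu iu).
Hypothesis jv : forall i, i = ix1 \/ i = ix2 -> vdegree O 1 (fun q => J q i iv).
Hypothesis juv : vdegree O 2 (fun q => J q iu iv).
Hypothesis vc : forall c, vdegree O (vdeg c).+1 (fun q => y q c).

(** Term by term: the Jacobian factors in front of H, W_i and h_ij do not depend on v, and the u,v
    entry, of degree 1, occurs in the H-component only. *)
Lemma vdegree_pull c : vdegree O (vdeg c).+1 (fun q => pull (J q) (y q) c).
Proof.
have j1 a := jx a (or_introl erefl); have j2 a := jx a (or_intror erefl).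
have jv1 := jv (or_introl erefl); have jv2 := jv (or_intror erefl).
have v2 : vdegree O 1 (fun=> 2 : R) by exact: vdegree_cst.
have X F : vdegree O 1 F -> vdegree O 1 (fun q => F q ^+ 2).
  by move=> vF; apply: (vdegree_ext oO _ (vdegreeM oO vF vF)) => q _; rewrite expr2.
have W n F : vdegree O n F -> vdegree O n.+1 F by exact: vdegreeW.
have M := fun n F G => @vdegreeM O oO n F G.
have h11 : vdegree O 1 (fun q => y q fh11) := vc fh11.
have h12 : vdegree O 1 (fun q => y q fh12) := vc fh12.
have h22 : vdegree O 1 (fun q => y q fh22) := vc fh22.
have tac (F1 F2 F3 F4 : V4 -> R) : vdegree O 1 F1 -> vdegree O 1 F2 -> vdegree O 1 F3 ->
    vdegree O 1 F4 -> vdegree O 1 (fun q => F1 q * F2 q + F3 q * F4 q).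
  by move=> *; apply: (vdegreeD oO); apply: M.
have D := fun n F G => @vdegreeD O oO n F G.
case: c; rewrite /pull /=.
- apply: (vdegreeD oO); first apply: (vdegreeD oO); first apply: (vdegreeD oO).
  + by apply: M; [exact: X|exact: vc fH].
  + have w1 := M _ _ _ (j1 iu) (vc fW1); have w2 := M _ _ _ (j2 iu) (vc fW2).
    exact: M _ _ _ ju (W _ _ (D _ _ _ w1 w2)).
  + exact: M _ _ _ ju (W _ _ juv).
  + apply: (vdegreeW oO (isT : 1 <= 3)%N).
    have q11 := M _ _ _ (X _ (j1 iu)) h11; have q22 := M _ _ _ (X _ (j2 iu)) h22.
    have q12 := M _ _ _ (M _ _ _ (M _ _ _ v2 (j1 iu)) (j2 iu)) h12.
    exact: D _ _ _ (D _ _ _ q11 q12) q22.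
- have l1 := M _ _ _ (j1 ix1) (vc fW1); have l2 := M _ _ _ (j2 ix1) (vc fW2).
  have l := M _ _ _ ju (D _ _ _ (D _ _ _ l1 l2) (W _ _ jv1)).
  have k1 := M _ _ _ (j1 iu) (tac _ _ _ _ (j1 ix1) h11 (j2 ix1) h12).
  have k2 := M _ _ _ (j2 iu) (tac _ _ _ _ (j1 ix1) h12 (j2 ix1) h22).
  exact: D _ _ _ l (W _ _ (M _ _ _ v2 (D _ _ _ k1 k2))).
- have l1 := M _ _ _ (j1 ix2) (vc fW1); have l2 := M _ _ _ (j2 ix2) (vc fW2).
  have l := M _ _ _ ju (D _ _ _ (D _ _ _ l1 l2) (W _ _ jv2)).
  have k1 := M _ _ _ (j1 iu) (tac _ _ _ _ (j1 ix2) h11 (j2 ix2) h12).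
  have k2 := M _ _ _ (j2 iu) (tac _ _ _ _ (j1 ix2) h12 (j2 ix2) h22).
  exact: D _ _ _ l (W _ _ (M _ _ _ v2 (D _ _ _ k1 k2))).
- have q11 := M _ _ _ (X _ (j1 ix1)) h11; have q22 := M _ _ _ (X _ (j2 ix1)) h22.
  have q12 := M _ _ _ (M _ _ _ (M _ _ _ v2 (j1 ix1)) (j2 ix1)) h12.
  exact: D _ _ _ (D _ _ _ q11 q12) q22.
- have q11 := M _ _ _ (M _ _ _ (j1 ix1) (j1 ix2)) h11.
  have q22 := M _ _ _ (M _ _ _ (j2 ix1) (j2 ix2)) h22.
  have q12 := M _ _ _ (tac _ _ _ _ (j1 ix1) (j2 ix2) (j2 ix1) (j1 ix2)) h12.
  exact: D _ _ _ (D _ _ _ q11 q12) q22.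
- have q11 := M _ _ _ (X _ (j1 ix2)) h11; have q22 := M _ _ _ (X _ (j2 ix2)) h22.
  have q12 := M _ _ _ (M _ _ _ (M _ _ _ v2 (j1 ix2)) (j2 ix2)) h12.
  exact: D _ _ _ (D _ _ _ q11 q12) q22.
Qed.
End PullFunctions.

Section PullSection.
Variables (O O' : set V4) (phi : V4 -> V4).
Hypotheses (oO : open O) (oO' : open O') (gphi : Gform O phi).
Hypothesis OO' : forall q, O q -> O' (phi q).
Variable s' : V4 -> fibre -> R.

Lemma smooth_pullsec c : (forall c, smooth_on O' (fun q => s' q c)) ->
  smooth_on O (fun q => pullsec phi s' q c).
Proof.
move=> ss'; apply: (@smooth_pull O (fun q => jac phi q) (fun q => s' (phi q)) oO c) => [a b|c'].
  exact: smooth_jac.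
by case: gphi => sphi _; exact: (smooth_comp oO (ss' c') sphi OO').
Qed.

Lemma vdegree_pullsec c : (forall c, vdegree O' (vdeg c).+1 (fun q => s' q c)) ->
  vdegree O (vdeg c).+1 (fun q => pullsec phi s' q c).
Proof.
move=> vs'; apply: (@vdegree_pull O (fun q => jac phi q) (fun q => s' (phi q)) oO).
- by move=> a i hi; exact: vdegree_jac_x.
- exact: vdegree_jac_u.
- by move=> i hi; exact: vdegree_jac_xv.
- exact: vdegree_jac_uv.
move=> c'.
by apply: (vdegree_comp oO gphi (F := fun z => s' z c') (O' := O')).
Qed.
End PullSection.

Lemma jets_in_Eoo O s : open O -> jets_in (@Eoo R) O s <->
  (forall c, vdegree O (vdeg c).+1 (fun q => s q c)) /\ (forall q, O q -> posdef (s q)).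
Proof.
move=> oO; have j0 q : jet0 (jet_of s q) = s q.
  by apply/funext => c; rewrite /jet0 /= pder_midx4 !ffunE.
split=> [[_ ss h]|[vs ps]].
  split=> [c|q /h/EooP[]]; last by rewrite j0.
  split=> // q Oq; have /EooP[_ hv] := h q Oq.
  apply: (etrans (@Dw_wcnt R O (fun q => s q c) (nseq (vdeg c).+1 iv) q oO (ss c) Oq)).
  by apply: (hv c); rewrite ffunE count_nseq [X in (X * _)%N](_ : _ = 1%N) ?mul1n.
split=> // [c|q Oq]; first by case: (vs c).
apply/EooP; split; first by rewrite j0; exact: ps.
by move=> c al cal /=; apply: (vdegree_pder_midx oO (vs c)).
Qed.

(** * Pairs of isometric Kundt sections *)

(** Unlike in [prolong], the sections are Kundt on open sets and not only to finite order at a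
    point. *)
Definition isometric V O O' phi s s' :=
  [/\ Gform O phi, (forall q, O q -> O' (phi q)), jets_in V O s, jets_in V O' s' &
    forall q, O q -> s q = pullsec phi s' q].

Section Isometric.
Variables (V : jt -> Prop) (O O' : set V4) (phi : V4 -> V4) (s s' : V4 -> fibre -> R).
Hypothesis gV : good V.
Hypothesis iso : isometric V O O' phi s s'.

Let gphi : Gform O phi. Proof. by case: iso. Qed.
Let OO' : forall q, O q -> O' (phi q). Proof. by case: iso. Qed.
Let jO : jets_in V O s. Proof. by case: iso. Qed.
Let jO' : jets_in V O' s'. Proof. by case: iso. Qed.
Let ss' : forall q, O q -> s q = pullsec phi s' q. Proof. by case: iso. Qed.
Let oO : open O. Proof. by case: jO. Qed.
Let sphi b : smooth_on O (fun q => phi q 0 b). Proof. by case: gphi. Qed.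

Notation j := (jet_of s).
Notation j' := (jet_of s').

Lemma Dt_invariant f a q : ra V f -> (forall z, O z -> f (j z) = f (j' (phi z))) -> O q ->
  Dt a f (j q) = \sum_b jac phi q a b * Dt b f (j' (phi q)).
Proof.
move=> rf inv Oq; have [sf df] := ra_section gV jO rf; have [sf' df'] := ra_section gV jO' rf.
rewrite -df // (@pder_on _ O _ (fun z => f (j' (phi z))) a oO inv q Oq).
rewrite (@pder_comp _ (fun z => f (j' z)) phi); last 2 first.
- by apply: smooth_on_diff sf' _; exact: OO'.
- by move=> b; exact: smooth_on_diff (sphi b) Oq.
by apply: eq_bigr => b _; rewrite mulrC df' //; exact: OO'.
Qed.

Lemma jet0_section (t : V4 -> fibre -> R) q : jet0 (jet_of t q) = t q.
Proof. by apply/funext => c; rewrite /jet0 /= pder_midx4 !ffunE. Qed.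

Lemma jet0_invariant q : O q -> jet0 (j q) = pull (jac phi q) (jet0 (j' (phi q))).
Proof. by move=> Oq; rewrite !jet0_section ss'. Qed.

Lemma gmx_invariant q : O q -> gmx (j q) = jacobian phi q *m gmx (j' (phi q)) *m (jacobian phi q)^T.
Proof. by move=> Oq; rewrite /gmx (metric_pull _ gphi Oq) jet0_invariant. Qed.

Definition det_x q := jac phi q ix1 ix1 * jac phi q ix2 ix2 - jac phi q ix1 ix2 * jac phi q ix2 ix1.

Lemma det_x_neq0 q : O q -> det_x q != 0.
Proof. by case: gphi => _ h /h[_ []]. Qed.

Lemma deth_invariant q : O q -> deth (j q) = det_x q ^+ 2 * deth (j' (phi q)).
Proof.
move=> Oq; rewrite /deth jet0_invariant //= /det_x.
generalize (jet0 (j' (phi q)) fh11) (jet0 (j' (phi q)) fh12) (jet0 (j' (phi q)) fh22).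
generalize (jac phi q ix1 ix1) (jac phi q ix1 ix2) (jac phi q ix2 ix1) (jac phi q ix2 ix2).
by move=> *; ring.
Qed.

Let sE q : O q -> Eoo (j q). Proof. by case: gV => _ _ VE; case: jO => _ _ h /h/VE. Qed.
Let sE' q : O q -> Eoo (j' (phi q)).
Proof. by case: gV => _ _ VE; case: jO' => _ _ h /OO'/h/VE. Qed.

Lemma jets_vdegree c : vdegree O (vdeg c).+1 (fun q => s q c) /\
  vdegree O' (vdeg c).+1 (fun q => s' q c).
Proof.
have [oO' _ _] := jO'; case: gV => _ _ VE; split.
  have [h _] := (@jets_in_Eoo O s oO).1 (And3 oO (let: And3 _ ss _ := jO in ss)
    (fun q Oq => sE Oq)).
  exact: h.
have [_ ss1 h1] := jO'.
have [h _] := (@jets_in_Eoo O' s' oO').1 (And3 oO' ss1 (fun q Oq => VE _ (h1 q Oq))).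
exact: h.
Qed.

Lemma pder_v_comp F q : smooth_on O' F -> O q ->
  pder iv (fun z => F (phi z)) q = jac phi q iv iv * pder iv F (phi q).
Proof.
move=> sF Oq; rewrite (@pder_comp _ F phi); last 2 first.
- by apply: smooth_on_diff sF _; exact: OO'.
- by move=> b; exact: smooth_on_diff (sphi b) Oq.
have [[_ _ h3] [h4 h5]] := jac_zero gphi Oq.
rewrite big_ord4 /= -/(jac phi q iv iu) -/(jac phi q iv ix1) -/(jac phi q iv ix2) -/(jac phi q iv iv).
rewrite h3 h4 h5; generalize (pder iu F (phi q)) (pder ix1 F (phi q)) (pder ix2 F (phi q)).
by generalize (pder iv F (phi q)) (jac phi q iv iv) => *; ring.
Qed.

Lemma pder_x_comp F i q : i = ix1 \/ i = ix2 -> vdegree O' 1 F -> O q ->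
  pder i (fun z => F (phi z)) q =
  jac phi q i ix1 * pder ix1 F (phi q) + jac phi q i ix2 * pder ix2 F (phi q).
Proof.
move=> hi [sF vF] Oq; rewrite (@pder_comp _ F phi); last 2 first.
- by apply: smooth_on_diff sF _; exact: OO'.
- by move=> b; exact: smooth_on_diff (sphi b) Oq.
have hv : pder iv F (phi q) = 0 by apply: vF; exact: OO'.
have h0 : jac phi q i iu = 0 by have [[h1 h2 _] _] := jac_zero gphi Oq; case: hi => ->.
rewrite big_ord4 /= hv mul0r addr0 -/(jac phi q i iu) h0 mulr0 add0r.
by rewrite /jac; congr (_ + _); rewrite mulrC.
Qed.

End Isometric.

End Pullback.

Section Invariance.
Variable R : realType.
Notation V4 := 'rV[R]_4.
Notation jt := (jet R).
Implicit Types (f g : jt -> R) (th : jt) (V : jt -> Prop) (a b : 'I_4) (F G : V4 -> R)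
  (O : set V4) (p q : V4).

(** * Invariance of the frame and of the four invariants *)

Section VLinear.
Variables (O : set V4) (c p1 p2 r t : V4 -> R).
Hypothesis oO : open O.
Hypotheses (vc : vdegree O 1 c) (v1 : vdegree O 1 p1) (v2 : vdegree O 1 p2)
  (vr : vdegree O 1 r) (vt : vdegree O 1 t).

Lemma pder_v_lin F G q : smooth_on O F -> smooth_on O G -> O q ->
  pder iv (fun z => c z * (p1 z * F z + p2 z * G z + r z) + t z) q =
  c q * (p1 q * pder iv F q + p2 q * pder iv G q).
Proof.
move=> sF sG Oq.
have d H : smooth_on O H -> differentiable H q by move=> sH; exact: smooth_on_diff sH Oq.
have z H : vdegree O 1 H -> pder iv H q = 0 by case=> _; exact.
have sm H : vdegree O 1 H -> smooth_on O H by case.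
have s1 : smooth_on O (fun z => p1 z * F z) by apply: smoothM => //; exact: sm.
have s2 : smooth_on O (fun z => p2 z * G z) by apply: smoothM => //; exact: sm.
have s3 : smooth_on O (fun z => p1 z * F z + p2 z * G z) by exact: smoothD.
have s4 : smooth_on O (fun z => p1 z * F z + p2 z * G z + r z).
  by apply: smoothD => //; exact: sm.
have s5 : smooth_on O (fun z => c z * (p1 z * F z + p2 z * G z + r z)).
  by apply: smoothM => //; exact: sm.
have [dc d1 d2 dr] : [/\ differentiable c q, differentiable p1 q, differentiable p2 q &
  differentiable r q] by split; apply: d; exact: sm.
rewrite (pderD _ (d _ s5) (d _ (sm _ vt))) (pderM _ dc (d _ s4)) (z _ vt) (z _ vc).
rewrite (pderD _ (d _ s3) dr) (z _ vr) (pderD _ (d _ s1) (d _ s2)).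
rewrite (pderM _ d1 (d _ sF)) (pderM _ d2 (d _ sG)) (z _ v1) (z _ v2).
by rewrite !mul0r !add0r !addr0.
Qed.
End VLinear.

Section IsoE.
Variables (V : jt -> Prop) (O O' : set V4) (phi : V4 -> V4) (s s' : V4 -> fibre -> R).
Hypothesis gV : good V.
Hypothesis iso : isometric V O O' phi s s'.

Let gphi : Gform O phi. Proof. by case: iso. Qed.
Let OO' : forall q, O q -> O' (phi q). Proof. by case: iso. Qed.
Let jO : jets_in V O s. Proof. by case: iso. Qed.
Let jO' : jets_in V O' s'. Proof. by case: iso. Qed.
Let ss' : forall q, O q -> s q = pullsec phi s' q. Proof. by case: iso. Qed.
Let oO : open O. Proof. by case: jO. Qed.
Let oO' : open O'. Proof. by case: jO'. Qed.
Let VE th : V th -> Eoo th. Proof. by case: gV => _ _; apply. Qed.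
Let sE q : O q -> Eoo (jet_of s q). Proof. by case: jO => _ _ h /h/VE. Qed.
Let sE' q : O q -> Eoo (jet_of s' (phi q)). Proof. by case: jO' => _ _ h /OO'/h/VE. Qed.
Let sphi b : smooth_on O (fun q => phi q 0 b). Proof. by case: gphi. Qed.
Let ssec c : smooth_on O (fun q => s q c). Proof. by case: jO. Qed.
Let ssec' c : smooth_on O' (fun q => s' q c). Proof. by case: jO'. Qed.
Let sj a b : smooth_on O (fun q => jac phi q a b). Proof. exact: smooth_jac. Qed.

Notation j := (jet_of s).
Notation j' := (jet_of s').

Lemma jcoord_dv A (t : V4 -> fibre -> R) c q : open A -> smooth_on A (fun q => t q c) -> A q ->
  jcoord (jet_of t q) c dv = pder iv (fun q => t q c) q.
Proof.
move=> oA sA Aq; rewrite /= -(pder_midxS iv midx0 oA sA Aq).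
by apply: (pder_on _ oA) Aq => z _; rewrite pder_midx4 !ffunE.
Qed.

Lemma pull_W i (J : 'I_4 -> 'I_4 -> R) (y : fibre -> R) : i = ix1 \/ i = ix2 ->
  pull J y (if i == ix1 then fW1 else fW2) =
  J iu iu * (J i ix1 * y fW1 + J i ix2 * y fW2 + J i iv) +
      2 * (J iu ix1 * (J i ix1 * y fh11 + J i ix2 * y fh12) +
           J iu ix2 * (J i ix1 * y fh12 + J i ix2 * y fh22)).
Proof. by case=> ->. Qed.

(** The factor C' in the transformed W_i is undone by the factor 1 / C' from one v-derivative, and
    the other terms do not depend on v. So w = (W_i)_v dx^i behaves as a 1-form in x. *)
Lemma w_invariant i q : i = ix1 \/ i = ix2 -> O q ->
  jcoord (j q) (if i == ix1 then fW1 else fW2) dv =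
  jac phi q i ix1 * w1 (j' (phi q)) + jac phi q i ix2 * w2 (j' (phi q)).
Proof.
move=> hi Oq; rewrite (jcoord_dv oO) //.
pose t z := 2 * (jac phi z iu ix1 * (jac phi z i ix1 * s' (phi z) fh11 + jac phi z i ix2 * s' (phi z) fh12) +
  jac phi z iu ix2 * (jac phi z i ix1 * s' (phi z) fh12 + jac phi z i ix2 * s' (phi z) fh22)).
have j1 a := vdegree_jac_x oO gphi a (or_introl erefl : ix1 = ix1 \/ ix1 = ix2).
have j2 a := vdegree_jac_x oO gphi a (or_intror erefl : ix2 = ix1 \/ ix2 = ix2).
have vs c : vdegree O (vdeg c).+1 (fun z => s' (phi z) c).
  by apply: (vdegree_comp oO gphi (F := fun z => s' z c) oO' OO'); case: (jets_vdegree gV iso c).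
have M F1 F2 : vdegree O 1 F1 -> vdegree O 1 F2 -> vdegree O 1 (fun z => F1 z * F2 z).
  exact: vdegreeM.
have D F1 F2 : vdegree O 1 F1 -> vdegree O 1 F2 -> vdegree O 1 (fun z => F1 z + F2 z).
  exact: vdegreeD.
have vt : vdegree O 1 t.
  have k1 := M _ _ (j1 iu) (D _ _ (M _ _ (j1 i) (vs fh11)) (M _ _ (j2 i) (vs fh12))).
  have k2 := M _ _ (j2 iu) (D _ _ (M _ _ (j1 i) (vs fh12)) (M _ _ (j2 i) (vs fh22))).
  exact: M _ _ (vdegree_cst O 2) (D _ _ k1 k2).
rewrite (@pder_on _ O _ (fun z => jac phi z iu iu * (jac phi z i ix1 * s' (phi z) fW1 +
  jac phi z i ix2 * s' (phi z) fW2 + jac phi z i iv) + t z)) //; last first.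
  by move=> z Oz; rewrite ss' // /pullsec pull_W.
have sW c : smooth_on O (fun z => s' (phi z) c).
  exact: smooth_comp (ssec' c) sphi OO'.
rewrite (pder_v_lin oO (vdegree_jac_u oO gphi) (j1 i) (j2 i) (vdegree_jac_xv oO gphi hi) vt
  (sW fW1) (sW fW2) Oq).
rewrite (pder_v_comp iso (ssec' fW1) Oq) (pder_v_comp iso (ssec' fW2) Oq).
have e c : jcoord (j' (phi q)) c dv = pder iv (fun z => s' z c) (phi q).
  by rewrite (jcoord_dv oO' (ssec' c)) //; exact: OO'.
rewrite /w1 /w2 !e; have e1 : jac phi q iu iu * jac phi q iv iv = 1.
  by case: gphi => _ /(_ q Oq)[_ []].
generalize (pder iv (fun z => s' z fW1) (phi q)) (pder iv (fun z => s' z fW2) (phi q)).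
generalize (jac phi q i ix1) (jac phi q i ix2); move: e1.
generalize (jac phi q iu iu) (jac phi q iv iv) => c d cd x y z t'.
transitivity ((c * d) * (x * z + y * t')); first by ring.
by rewrite cd mul1r.
Qed.

Lemma w1_invariant q : O q ->
  w1 (j q) = jac phi q ix1 ix1 * w1 (j' (phi q)) + jac phi q ix1 ix2 * w2 (j' (phi q)).
Proof. exact: (w_invariant (or_introl erefl)). Qed.

Lemma w2_invariant q : O q ->
  w2 (j q) = jac phi q ix2 ix1 * w1 (j' (phi q)) + jac phi q ix2 ix2 * w2 (j' (phi q)).
Proof. exact: (w_invariant (or_intror erefl)). Qed.

(** I_1 is the squared norm of the 1-form w with respect to (h_ij). *)
Lemma I1_invariant q : O q -> Defs.I1 (j q) = Defs.I1 (j' (phi q)).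
Proof.
move=> Oq; have d0 := det_x_neq0 iso Oq; have h0 := lt0r_neq0 (deth_gt0 (sE' Oq)).
have hE th : Defs.I1 th = (w1 th ^+ 2 * jet0 th fh22 - 2 * w1 th * w2 th * jet0 th fh12 +
  w2 th ^+ 2 * jet0 th fh11) / deth th by [].
rewrite !hE (deth_invariant iso Oq) w1_invariant // w2_invariant // (jet0_invariant iso) //.
rewrite /pull /det_x; move: d0 h0; rewrite /det_x /deth.
generalize (jet0 (j' (phi q)) fh11) (jet0 (j' (phi q)) fh12) (jet0 (j' (phi q)) fh22).
generalize (jac phi q ix1 ix1) (jac phi q ix1 ix2) (jac phi q ix2 ix1) (jac phi q ix2 ix2).
generalize (w1 (j' (phi q))) (w2 (j' (phi q))); move=> *; field.
by apply/andP.
Qed.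

Lemma jcoord_dvv A (t : V4 -> fibre -> R) c q : open A -> smooth_on A (fun q => t q c) -> A q ->
  jcoord (jet_of t q) c (midxS iv dv) = pder iv (pder iv (fun q => t q c)) q.
Proof.
move=> oA sA Aq; rewrite /= -(pder_midxS iv dv oA sA Aq).
by apply: (pder_on _ oA) Aq => z Az; exact: (jcoord_dv oA sA Az).
Qed.

(** H is multiplied by C'^2, which two v-derivatives undo; the remaining terms of [pull], collected
    in [t], have degree at most 1 in v. *)
Lemma I2a_invariant q : O q -> Defs.I2a (j q) = Defs.I2a (j' (phi q)).
Proof.
move=> Oq.
rewrite (jcoord_dvv oO (ssec fH) Oq : Defs.I2a (j q) = _).
rewrite (jcoord_dvv oO' (ssec' fH) (OO' Oq) : Defs.I2a (j' (phi q)) = _).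
have j1 a := vdegree_jac_x oO gphi a (or_introl erefl : ix1 = ix1 \/ ix1 = ix2).
have j2 a := vdegree_jac_x oO gphi a (or_intror erefl : ix2 = ix1 \/ ix2 = ix2).
have vs c : vdegree O (vdeg c).+1 (fun z => s' (phi z) c).
  by apply: (vdegree_comp oO gphi (F := fun z => s' z c) oO' OO'); case: (jets_vdegree gV iso c).
have vu := vdegree_jac_u oO gphi.
have M n F1 F2 : vdegree O 1 F1 -> vdegree O n F2 -> vdegree O n (fun z => F1 z * F2 z).
  exact: vdegreeM.
have D n F1 F2 : vdegree O n F1 -> vdegree O n F2 -> vdegree O n (fun z => F1 z + F2 z).
  exact: vdegreeD.
pose t z := jac phi z iu iu * (jac phi z iu ix1 * s' (phi z) fW1 + jac phi z iu ix2 * s' (phi z) fW2) +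
  jac phi z iu iu * jac phi z iu iv + (jac phi z iu ix1 * jac phi z iu ix1 * s' (phi z) fh11 +
  2 * jac phi z iu ix1 * jac phi z iu ix2 * s' (phi z) fh12 +
  jac phi z iu ix2 * jac phi z iu ix2 * s' (phi z) fh22).
have vt : vdegree O 2 t.
  have k1 := M _ _ _ vu (D _ _ _ (M _ _ _ (j1 iu) (vs fW1)) (M _ _ _ (j2 iu) (vs fW2))).
  have k2 := M _ _ _ vu (vdegree_jac_uv oO gphi).
  have k3 := M _ _ _ (M _ _ _ (j1 iu) (j1 iu)) (vs fh11).
  have k4 := M _ _ _ (M _ _ _ (M _ _ _ (vdegree_cst O 2) (j1 iu)) (j2 iu)) (vs fh12).
  have k5 := M _ _ _ (M _ _ _ (j2 iu) (j2 iu)) (vs fh22).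
  exact: D _ _ _ (D _ _ _ k1 k2) (vdegreeW oO (isT : (1 <= 2)%N) (D _ _ _ (D _ _ _ k3 k4) k5)).
pose c z := jac phi z iu iu * jac phi z iu iu.
have vc : vdegree O 1 c := M _ _ _ vu vu.
have sc : smooth_on O c by case: vc.
have st : smooth_on O t by case: vt.
have sH : smooth_on O (fun z => s' (phi z) fH) by case: (vs fH).
have d F z : smooth_on O F -> O z -> differentiable F z by exact: smooth_on_diff.
have e1 z : O z -> pder iv (fun q => s q fH) z =
    jac phi z iu iu * pder iv (fun q => s' q fH) (phi z) + pder iv t z.
  move=> Oz; rewrite (@pder_on _ O _ (fun z => c z * s' (phi z) fH + t z)) //; last first.
    by move=> y Oy; rewrite ss' // /pullsec /pull /c /t !expr2 !addrA.
  rewrite (pderD _ (d _ _ (smoothM oO sc sH) Oz) (d _ _ st Oz)) (pderM _ (d _ _ sc Oz) (d _ _ sH Oz)).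
  rewrite (pder_v_comp iso (ssec' fH) Oz) (vc.2 z Oz : pder iv c z = 0) mul0r add0r.
  congr (_ + _); rewrite /c mulrA -(mulrA (jac phi z iu iu)).
  by have [_ _ -> _] : [/\ True, True, jac phi z iu iu * jac phi z iv iv = 1 & True];
    [split=> //; case: gphi => _ /(_ z Oz)[_ []]|rewrite mulr1].
rewrite (@pder_on _ O _ (fun z => jac phi z iu iu * pder iv (fun q => s' q fH) (phi z) + pder iv t z)) //.
have sHv' : smooth_on O' (pder iv (fun q => s' q fH)) by exact: smooth_on_pder.
have sHv : smooth_on O (fun z => pder iv (fun q => s' q fH) (phi z)) by exact: smooth_comp sHv' sphi OO'.
have stv : smooth_on O (pder iv t) by exact: smooth_on_pder.
rewrite (pderD _ (d _ _ (smoothM oO (sj iu iu) sHv) Oq) (d _ _ stv Oq)).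
rewrite (pderM _ (d _ _ (sj iu iu) Oq) (d _ _ sHv Oq)).
rewrite (pder_v_comp iso sHv' Oq) (vt.2 q Oq : pder iv (pder iv t) q = 0) addr0.
rewrite (vu.2 q Oq : pder iv _ q = 0) mul0r add0r mulrA.
by have [_ _ -> _] : [/\ True, True, jac phi q iu iu * jac phi q iv iv = 1 & True];
    [split=> //; case: gphi => _ /(_ q Oq)[_ []]|rewrite mul1r].
Qed.

(** Up to sign K is the coefficient of the exterior derivative of w along x: second derivatives of
    A^i cancel and det A_x comes out. *)
Lemma K_invariant q : O q -> Kw (j q) = det_x phi q * Kw (j' (phi q)).
Proof.
move=> Oq.
have rw c : ra V (fun th => jcoord th c dv) by exact: ra_jcoord.
have E c i : jcoord (j q) c (midxS i dv) = pder i (fun z => jcoord (j z) c dv) q.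
  by have [_ d] := ra_section gV jO (rw c); rewrite d // Dt_coord.
have E' c i : jcoord (j' (phi q)) c (midxS i dv) = pder i (fun z => jcoord (j' z) c dv) (phi q).
  by have [_ d] := ra_section gV jO' (rw c); rewrite d ?Dt_coord //; exact: OO'.
have vw c : vdegree O' (vdeg c).+1 (fun z => s' z c) by case: (jets_vdegree gV iso c).
have v1 c : vdeg c = 1%N -> vdegree O' 1 (fun z => jcoord (j' z) c dv).
  move=> c1; have := vw c; rewrite c1 => /vdegreeS[sc vcc].
  by apply: (vdegree_ext oO' _ vcc) => z Oz; rewrite (jcoord_dv oO').
rewrite /Kw !E !E'.
have v11 := v1 fW1 erefl; have v12 := v1 fW2 erefl.
have [s1 s2] := (v11.1, v12.1).
have c1 : smooth_on O (fun z => jcoord (j' (phi z)) fW1 dv) by exact: (smooth_comp oO s1 sphi OO').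
have c2 : smooth_on O (fun z => jcoord (j' (phi z)) fW2 dv) by exact: (smooth_comp oO s2 sphi OO').
have d F : smooth_on O F -> differentiable F q by move=> sF; exact: smooth_on_diff sF Oq.
have X i k (w : V4 -> R) : i = ix1 \/ i = ix2 -> k = ix1 \/ k = ix2 ->
    (forall z, O z -> w z = jac phi z k ix1 * jcoord (j' (phi z)) fW1 dv + jac phi z k ix2 * jcoord (j' (phi z)) fW2 dv) ->
    pder i w q = pder i (fun z => jac phi z k ix1) q * jcoord (j' (phi q)) fW1 dv +
      pder i (fun z => jac phi z k ix2) q * jcoord (j' (phi q)) fW2 dv +
      jac phi q k ix1 * (jac phi q i ix1 * pder ix1 (fun z => jcoord (j' z) fW1 dv) (phi q) +
                         jac phi q i ix2 * pder ix2 (fun z => jcoord (j' z) fW1 dv) (phi q)) +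
      jac phi q k ix2 * (jac phi q i ix1 * pder ix1 (fun z => jcoord (j' z) fW2 dv) (phi q) +
                         jac phi q i ix2 * pder ix2 (fun z => jcoord (j' z) fW2 dv) (phi q)).
  move=> hi hk we; rewrite (pder_on i oO we Oq).
  rewrite (pderD _ (d _ (smoothM oO (sj k ix1) c1)) (d _ (smoothM oO (sj k ix2) c2))).
  rewrite (pderM _ (d _ (sj k ix1)) (d _ c1)) (pderM _ (d _ (sj k ix2)) (d _ c2)).
  rewrite (pder_x_comp iso hi v11 Oq) (pder_x_comp iso hi v12 Oq).
  generalize (pder i (fun z => jac phi z k ix1) q) (pder i (fun z => jac phi z k ix2) q).
  generalize (jcoord (j' (phi q)) fW1 dv) (jcoord (j' (phi q)) fW2 dv).
  generalize (jac phi q k ix1) (jac phi q k ix2) (jac phi q i ix1) (jac phi q i ix2).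
  do 4![match goal with |- context [pder ?a ?f (phi q)] => generalize (pder a f (phi q)) end].
  by move=> *; ring.
rewrite (X ix2 ix1 _ (or_intror erefl) (or_introl erefl) w1_invariant).
rewrite (X ix1 ix2 _ (or_introl erefl) (or_intror erefl) w2_invariant).
rewrite (jacC oO gphi ix2 ix1 ix1 Oq) (jacC oO gphi ix2 ix2 ix1 Oq) /det_x.
generalize (pder ix2 (fun z => jac phi z ix1 ix1) q) (pder ix2 (fun z => jac phi z ix1 ix2) q).
generalize (jcoord (j' (phi q)) fW1 dv) (jcoord (j' (phi q)) fW2 dv).
generalize (jac phi q ix1 ix1) (jac phi q ix1 ix2) (jac phi q ix2 ix1) (jac phi q ix2 ix2).
do 4![match goal with |- context [pder ?a ?f (phi q)] => generalize (pder a f (phi q)) end].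
by move=> *; ring.
Qed.

Lemma I2b_invariant q : O q -> Defs.I2b (j q) = Defs.I2b (j' (phi q)).
Proof.
move=> Oq; have d0 := det_x_neq0 iso Oq; have h0 := lt0r_neq0 (deth_gt0 (sE' Oq)).
have hE th : Defs.I2b th = Kw th ^+ 2 / deth th by [].
rewrite !hE (deth_invariant iso Oq) K_invariant //; move: d0 h0.
generalize (det_x phi q) (Kw (j' (phi q))) (deth (j' (phi q))) => x k h x0 h0; field.
by rewrite h0.
Qed.

End IsoE.
End Invariance.

Section FrameInvariance.
Variable R : realType.
Notation V4 := 'rV[R]_4.
Notation jt := (jet R).
Implicit Types (f g : jt -> R) (th : jt) (V : jt -> Prop) (a b : 'I_4) (F G : V4 -> R)
  (O : set V4) (p q : V4).
Notation I1 := (@I1 R).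
Notation I2a := (@I2a R).
Notation I2b := (@I2b R).
Notation c1_23 := (@c1_23 R).
Local Opaque Dt.

Lemma jacobian_unit O phi q : Gform O phi -> O q -> jacobian phi q \in unitmx (R := R).
Proof.
move=> gphi Oq; have [[a1 a2 a3] [b1 b2]] := jac_zero gphi Oq.
have c0 := jac_uu_neq0 gphi Oq; case: gphi => _ /(_ q Oq)[_ [_ _ cd d0]].
have v0 : jac phi q iv iv != 0.
  by apply: contra_eq_neq cd => ->; rewrite mulr0 eq_sym oner_neq0.
apply: unitmx_inj => X /rowP h.
have := h iv; have := h ix2; have := h ix1; have := h iu.
rewrite !mxE !big_ord4 /= !jacobianE; move: a1 a2 a3 b1 b2 c0 d0 v0.
generalize (jac phi q ix1 ix1) (jac phi q ix1 ix2) (jac phi q ix2 ix1) (jac phi q ix2 ix2).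
generalize (jac phi q iu iu) (jac phi q iu ix1) (jac phi q iu ix2) (jac phi q iu iv).
generalize (jac phi q ix1 iv) (jac phi q ix2 iv) (jac phi q iv iv) (jac phi q ix1 iu).
generalize (jac phi q ix2 iu) (jac phi q iv iu) (jac phi q iv ix1) (jac phi q iv ix2).
clear => k1 k2 k3 k4 k5 k6 c k7 d k8 k9 k10 j11 j12 j21 j22 -> -> -> -> -> c0 d0 v0.
rewrite !mulr0 !addr0 => h0 h1 h2 h3.
have X0 : X 0 iu = 0 by move/eqP: h0; rewrite mulf_eq0 (negbTE c0) orbF => /eqP.
rewrite X0 !mul0r !add0r in h1 h2 h3.
have X1 : X 0 ix1 = 0.
  apply: (mulIf d0); rewrite mul0r.
  transitivity ((X 0 ix1 * j11 + X 0 ix2 * j21) * j22 -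
    (X 0 ix1 * j12 + X 0 ix2 * j22) * j21); first by ring.
  by rewrite h1 h2 !mul0r subrr.
have X2 : X 0 ix2 = 0.
  apply: (mulIf d0); rewrite mul0r.
  transitivity ((X 0 ix1 * j12 + X 0 ix2 * j22) * j11 -
    (X 0 ix1 * j11 + X 0 ix2 * j21) * j12); first by ring.
  by rewrite h1 h2 !mul0r subrr.
rewrite X1 X2 !mul0r !add0r in h3.
have X3 : X 0 iv = 0 by move/eqP: h3; rewrite mulf_eq0 (negbTE v0) orbF => /eqP.
by apply: row4P; rewrite ?X0 ?X1 ?X2 ?X3 !mxE.
Qed.

Section Iso.
Variables (V : jt -> Prop) (O O' : set V4) (phi : V4 -> V4) (s s' : V4 -> fibre -> R).
Hypothesis gV : good V.
Hypothesis iso : isometric V O O' phi s s'.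

Let gphi : Gform O phi. Proof. by case: iso. Qed.
Let OO' : forall q, O q -> O' (phi q). Proof. by case: iso. Qed.
Let jO : jets_in V O s. Proof. by case: iso. Qed.
Let jO' : jets_in V O' s'. Proof. by case: iso. Qed.
Let oO : open O. Proof. by case: jO. Qed.
Let oO' : open O'. Proof. by case: jO'. Qed.
Let VE th : V th -> Eoo th. Proof. by case: gV => _ _; apply. Qed.
Let sE q : O q -> Eoo (jet_of s q). Proof. by case: jO => _ _ h /h/VE. Qed.
Let sE' q : O q -> Eoo (jet_of s' (phi q)). Proof. by case: jO' => _ _ h /OO'/h/VE. Qed.
Let sphi b : smooth_on O (fun q => phi q 0 b). Proof. by case: gphi. Qed.
Let sj a b : smooth_on O (fun q => jac phi q a b). Proof. exact: smooth_jac. Qed.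

Notation j := (jet_of s).
Notation j' := (jet_of s').

Definition invariant f := forall z, O z -> f (j z) = f (j' (phi z)).

Lemma hd_invariant f q : ra V f -> invariant f -> O q ->
  hd f (j q) = hd f (j' (phi q)) *m (jacobian phi q)^T.
Proof.
move=> rf inv Oq; apply/rowP => a; rewrite !mxE (Dt_invariant gV iso a rf inv Oq).
by apply: eq_bigr => b _; rewrite !mxE mulrC.
Qed.

Definition vconst_inv f := [/\ ra V f, invariant f & forall th, Eoo th -> Dt iv f th = 0].

Lemma grad_invariant f q : vconst_inv f -> O q ->
  grad f (j q) *m jacobian phi q = grad f (j' (phi q)).
Proof.
move=> [rf inv fv] Oq; have [E E'] := (sE Oq, sE' Oq).
rewrite -(sharp_hd E' (fv _ E')); apply/esym/sharpP => //.
have uj : (jacobian phi q)^T \in unitmx by rewrite unitmx_tr (jacobian_unit gphi Oq).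
apply: (can_inj (mulmxK uj)); rewrite -hd_invariant // -!mulmxA (mulmxA (jacobian phi q)).
by rewrite -(gmx_invariant iso Oq) -(sharp_hd E (fv _ E)) /sharp mulmxKV ?metric_unit.
Qed.

Lemma Dt_x_invariant f i q : i = ix1 \/ i = ix2 -> vconst_inv f -> O q ->
  Dt i f (j q) = jac phi q i ix1 * Dt ix1 f (j' (phi q)) + jac phi q i ix2 * Dt ix2 f (j' (phi q)).
Proof.
move=> hi [rf inv fv] Oq; rewrite (Dt_invariant gV iso i rf inv Oq) big_ord4 /=.
have -> : jac phi q i iu = 0 by have [[? ? ?] _] := jac_zero gphi Oq; case: hi => ->.
by rewrite (fv _ (sE' Oq)) mul0r add0r mulr0 addr0.
Qed.

Lemma Dt_u_invariant f q : vconst_inv f -> O q ->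
  Dt iu f (j q) = jac phi q iu iu * Dt iu f (j' (phi q)) +
    (jac phi q iu ix1 * Dt ix1 f (j' (phi q)) + jac phi q iu ix2 * Dt ix2 f (j' (phi q))).
Proof.
move=> [rf inv fv] Oq; rewrite (Dt_invariant gV iso iu rf inv Oq) big_ord4 /=.
by rewrite (fv _ (sE' Oq)) mulr0 addr0 !addrA.
Qed.

Lemma vconst_I1 : vconst_inv I1.
Proof. by split=> [|z Oz|th /Dt_v_I[]//]; [exact: ra_I1|exact: (I1_invariant gV iso)]. Qed.

Lemma vconst_I2a : vconst_inv I2a.
Proof. by split=> [|z Oz|th /Dt_v_I[]//]; [exact: ra_I2a|exact: (I2a_invariant gV iso)]. Qed.

Lemma vconst_I2b : vconst_inv I2b.
Proof. by split=> [|z Oz|th /Dt_v_I[]//]; [exact: ra_I2b|exact: (I2b_invariant gV iso)]. Qed.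

Let E1 f := fun q (h : vconst_inv f) (Oq : O q) => Dt_x_invariant (or_introl erefl) h Oq : Dt ix1 f (j q) = _.
Let E2 f := fun q (h : vconst_inv f) (Oq : O q) => Dt_x_invariant (or_intror erefl) h Oq : Dt ix2 f (j q) = _.

Lemma D2_invariant q : O q -> D2 (j q) = det_x phi q * D2 (j' (phi q)).
Proof.
move=> Oq; have [ha hb] := (vconst_I2a, vconst_I2b).
rewrite /D2 (E1 ha Oq) (E2 ha Oq) (E1 hb Oq) (E2 hb Oq) /det_x.
do 4![match goal with |- context [Dt ?a ?f ?t] => generalize (Dt a f t) end].
generalize (jac phi q ix1 ix1) (jac phi q ix1 ix2) (jac phi q ix2 ix1) (jac phi q ix2 ix2).
by move=> *; ring.
Qed.

Lemma D3_invariant q : O q -> D3 (j q) = jac phi q iu iu * det_x phi q * D3 (j' (phi q)).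
Proof.
move=> Oq; have [ha hb h1] := And3 vconst_I2a vconst_I2b vconst_I1.
rewrite /D3 D2_invariant // (E1 ha Oq) (E2 ha Oq) (E1 hb Oq) (E2 hb Oq) (E1 h1 Oq) (E2 h1 Oq).
rewrite (Dt_u_invariant h1 Oq) (Dt_u_invariant ha Oq) (Dt_u_invariant hb Oq) /det_x /D2.
do 9![match goal with |- context [Dt ?a ?f ?t] => generalize (Dt a f t) end].
generalize (jac phi q ix1 ix1) (jac phi q ix1 ix2) (jac phi q ix2 ix1) (jac phi q ix2 ix2).
generalize (jac phi q iu iu) (jac phi q iu ix1) (jac phi q iu ix2).
by move=> *; ring.
Qed.

Lemma U_invariant q : O q -> U (j q) <-> U (j' (phi q)).
Proof.
move=> Oq; have d0 := det_x_neq0 iso Oq; have c0 := jac_uu_neq0 gphi Oq.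
rewrite /U (D2_invariant Oq) (D3_invariant Oq) (K_invariant gV iso Oq) !mulf_eq0 !negb_or d0 c0 /=.
by split=> -[_ h1 h2 h3]; split=> //; [exact: sE'|exact: sE].
Qed.

(* The derivatives of the Jacobian matrix are symmetric, hence cancel in the bracket. *)
Lemma BR_invariant q : O q ->
  (\row_a BR a (j q)) *m jacobian phi q = \row_a BR a (j' (phi q)).
Proof.
move=> Oq; have [ha hb] := (vconst_I2a, vconst_I2b).
pose X f f' b (z : jt) := \sum_c grad f z 0 c * Dt c (fun y => grad f' y 0 b) z.
have D F : smooth_on O F -> differentiable F q by move=> sF; exact: smooth_on_diff sF Oq.
have key f f' a : vconst_inv f -> vconst_inv f' -> X f f' a (j' (phi q)) =
    \sum_d X f f' d (j q) * jac phi q d a +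
    \sum_b \sum_d grad f (j q) 0 b * grad f' (j q) 0 d * pder b (fun z => jac phi z d a) q.
  move=> hf hf'; have [rf' _ _] := hf'.
  have rg b : ra V (fun y => grad f' y 0 b) by exact: (ra_grad gV).
  have sg b := (ra_section gV jO (rg b)).1; have dg b := (ra_section gV jO (rg b)).2.
  have [sg' dg'] := ra_section gV jO' (rg a).
  have e1 : X f f' a (j' (phi q)) = \sum_b grad f (j q) 0 b * pder b (fun z => grad f' (j' (phi z)) 0 a) q.
    rewrite /X -(grad_invariant hf Oq).
    under eq_bigr => c _ do rewrite mxE mulr_suml.
    rewrite exchange_big /=; apply: eq_bigr => b _.
    rewrite (@pder_comp _ (fun z => grad f' (j' z) 0 a) phi); last 2 first.
    - by apply: smooth_on_diff sg' _; exact: OO'.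
    - by move=> d; exact: D.
    rewrite mulr_sumr; apply: eq_bigr => c _.
    by rewrite dg' ?jacobianE /jac -?mulrA; [rewrite [X in _ * X]mulrC|exact: OO'].
  have e2 b : pder b (fun z => grad f' (j' (phi z)) 0 a) q =
      \sum_d (Dt b (fun y => grad f' y 0 d) (j q) * jac phi q d a +
              grad f' (j q) 0 d * pder b (fun z => jac phi z d a) q).
    rewrite (@pder_on _ O _ (fun z => \sum_d grad f' (j z) 0 d * jac phi z d a)) //; last first.
      move=> z Oz; rewrite -(grad_invariant hf' Oz) mxE.
      by apply: eq_bigr => d _; rewrite jacobianE.
    apply: (etrans (@Dw_sum _ O [:: b] q 4 (fun d z => grad f' (j z) 0 d * jac phi z d a) oO Oq
      (fun d => smoothM oO (sg d) (sj d a)))).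
    by apply: eq_bigr => d _ /=; rewrite (pderM _ (D _ (sg d)) (D _ (sj d a))) dg.
  rewrite e1; under eq_bigr => b _ do rewrite e2 mulr_sumr.
  under [X in _ = X + _]eq_bigr => d _ do rewrite mulr_suml.
  rewrite [X in _ = X + _]exchange_big -big_split /=; apply: eq_bigr => b _.
  by rewrite -big_split /=; apply: eq_bigr => d _; rewrite mulrDr !mulrA.
apply/rowP => a; rewrite !mxE; under eq_bigr => d _ do rewrite mxE jacobianE.
have -> : BR a (j' (phi q)) = X I2a I2b a (j' (phi q)) - X I2b I2a a (j' (phi q)) by [].
rewrite !key // opprD addrACA -sumrB [X in _ + (X - _)]exchange_big -sumrB /=.
rewrite [X in _ + X]big1 ?addr0.
  by apply: eq_bigr => d _; rewrite -mulrBl.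
move=> d _; rewrite -sumrB big1 // => b _.
by rewrite (jacC oO gphi) // -mulrBl [X in X - _]mulrC subrr mul0r.
Qed.

End Iso.

Section IsoU.
Variables (O O' : set V4) (phi : V4 -> V4) (s s' : V4 -> fibre -> R).
Hypothesis iso : isometric (@U R) O O' phi s s'.
Let gU := good_U R.
Notation j := (jet_of s).
Notation j' := (jet_of s').

(** Both brackets are expanded in the gradients of I_2a, I_2b and in D_v. The gradients correspond
    under the Jacobian and Delta is nonzero, so their coefficients agree. The rest lies along D_v,
    where the factor C' of alpha is undone by the v,v entry 1 / C'. *)
Lemma c1_23_invariant q : O q -> c1_23 (j q) = c1_23 (j' (phi q)).
Proof.
move=> Oq; have [gphi OO' [_ _ Uj] [_ _ Uj'] _] := iso.
have [Uq Uq'] := (Uj q Oq, Uj' _ (OO' q Oq)).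
have [va vb] := (vconst_I2a gU iso, vconst_I2b gU iso).
have BRE th : U th -> \row_a BR a th =
    cc2 th *: grad I2a th + cc3 th *: grad I2b th + row4 0 0 0 (2 * alpha th * cex th).
  move=> Uth; have [h1 h2] := cc_BR Uth.
  have a0 : 2 * alpha th != 0 by apply: mulf_neq0; [rewrite pnatr_eq0|exact: alpha_neq0].
  apply: row4P; rewrite !mxE /= ?mulr0 ?addr0.
  - by rewrite BR_u //; exact: UE.
  - by rewrite h1.
  - by rewrite h2.
  - rewrite [_ * cex th]mulrC /cex (divfK a0).
    by generalize (BR iv th) (cc2 th * gv I2a th) (cc3 th * gv I2b th) => *; ring.
have := BR_invariant gU iso Oq; rewrite (BRE _ Uq) (BRE _ Uq') !mulmxDl -!scalemxAl.
rewrite (grad_invariant gU iso va Oq) (grad_invariant gU iso vb Oq).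
have [[a1 a2 a3] [b1 b2]] := jac_zero gphi Oq.
have -> : row4 0 0 0 (2 * alpha (j q) * cex (j q)) *m jacobian phi q =
    row4 0 0 0 (2 * alpha (j q) * cex (j q) * jac phi q iv iv).
  apply: row4P; rewrite !mxE big_ord4 /= !mxE /= !mul0r !add0r.
  - by rewrite -[pder _ _ _]/(jac phi q iv iu) a3 mulr0.
  - by rewrite -[pder _ _ _]/(jac phi q iv ix1) b1 mulr0.
  - by rewrite -[pder _ _ _]/(jac phi q iv ix2) b2 mulr0.
  - by [].
move=> /rowP h; have := h ix1; have := h ix2; have := h iv.
rewrite !mxE /= !addr0 => hv h2 h1.
have d0 := Delta_neq0 Uq'.
have e2 : cc2 (j q) = cc2 (j' (phi q)).
  apply: (mulIf d0); move: h1 h2; rewrite /Delta.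
  generalize (gx1 I2a (j' (phi q))) (gx2 I2a (j' (phi q))) (gx1 I2b (j' (phi q))) (gx2 I2b (j' (phi q))).
  generalize (cc2 (j q)) (cc3 (j q)) (cc2 (j' (phi q))) (cc3 (j' (phi q))).
  clear => c d c' d' x y x' y' h1 h2.
  transitivity ((c * x + d * x') * y' - (c * y + d * y') * x'); first by ring.
  by rewrite h1 h2; ring.
have e3 : cc3 (j q) = cc3 (j' (phi q)).
  apply: (mulIf d0); move: h1 h2; rewrite /Delta.
  generalize (gx1 I2a (j' (phi q))) (gx2 I2a (j' (phi q))) (gx1 I2b (j' (phi q))) (gx2 I2b (j' (phi q))).
  generalize (cc2 (j q)) (cc3 (j q)) (cc2 (j' (phi q))) (cc3 (j' (phi q))).
  clear => c d c' d' x y x' y' h1 h2.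
  transitivity ((c * y + d * y') * x - (c * x + d * x') * y); first by ring.
  by rewrite h1 h2; ring.
move: hv; rewrite e2 e3 => /addrI.
have ea : alpha (j q) = jac phi q iu iu * alpha (j' (phi q)).
  rewrite /alpha (D3_invariant gU iso Oq) (D2_invariant gU iso Oq).
  have [_ _ d2 _] := Uq'; have dx := det_x_neq0 iso Oq.
  by move: d2 dx; generalize (D2 (j' (phi q))) (D3 (j' (phi q))) (det_x phi q) => x y z x0 z0; field;
    rewrite x0.
have a0 := alpha_neq0 Uq'.
rewrite !c1_23E // ea => e.
have cd : jac phi q iu iu * jac phi q iv iv = 1 by case: gphi => _ /(_ q Oq)[_ []].
apply: (mulfI a0); apply: (mulfI (_ : (2 : R) != 0)); first by rewrite pnatr_eq0.
rewrite (mulrA _ _ (cex (j' (phi q)))) -e -[in LHS](mulr1 (2 * _)) -cd.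
by generalize (cex (j q)) (alpha (j' (phi q))) => *; ring.
Qed.
End IsoU.
End FrameInvariance.

Section Tresse.
Variable R : realType.
Notation V4 := 'rV[R]_4.
Notation jt := (jet R).
Implicit Types (f g : jt -> R) (th : jt) (V : jt -> Prop) (a b : 'I_4) (F G : V4 -> R)
  (O : set V4) (p q : V4).
Notation I1 := (@I1 R).
Notation I2a := (@I2a R).
Notation I2b := (@I2b R).
Notation c1_23 := (@c1_23 R).
Notation J := (@kundt_invariants R).
Notation U := (@U R).
Local Opaque Dt.

(** * Tresse derivatives *)

Lemma JE : [/\ J iu = I1, J ix1 = I2a, J ix2 = I2b & J iv = c1_23].
Proof. by []. Qed.

(** Along v only J_4 has a nonzero derivative, so the matrix is block triangular with determinant D3
    times D_v c^1_23. *)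
Lemma dJ_unit th : U th -> dJ_mx J th \in unitmx.
Proof.
move=> Uth; have [Eth _ d2 d3] := Uth; have [v1 va vb] := Dt_v_I Eth.
have vc := Dt_v_c1_23 Uth.
apply: unitmx_inj => X /rowP h; have := h iv; have := h ix2; have := h ix1; have := h iu.
rewrite !mxE !big_ord4 /= !mxE; have [-> -> -> ->] := JE; rewrite v1 va vb !mulr0 !addr0.
move: d2 d3 vc; rewrite /D3 /D2; repeat match goal with |- context [Dt ?a ?f ?t] => generalize (Dt a f t) end.
clear => c3 c2 c1 cu b1 b2 a2 a1 bu y2 y1 au yu d2 d3 c0 e1 e2 e3 e4.
have X0 : X 0 iu = 0.
  apply: (mulIf d3); rewrite mul0r.
  transitivity ((X 0 iu * bu + (X 0 ix1 * a2 + X 0 ix2 * b2)) * (yu * au - y1 * y2) -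
    (X 0 iu * a1 + (X 0 ix1 * yu + X 0 ix2 * y1)) * (a2 * au - b2 * y2) +
    (X 0 iu * b1 + (X 0 ix1 * y2 + X 0 ix2 * au)) * (a2 * y1 - b2 * yu)); first by ring.
  by rewrite e1 e2 e3 !mul0r subrr addr0.
rewrite X0 !mul0r !add0r in e2 e3 e4.
have X1 : X 0 ix1 = 0.
  apply: (mulIf d2); rewrite mul0r.
  transitivity ((X 0 ix1 * yu + X 0 ix2 * y1) * au - (X 0 ix1 * y2 + X 0 ix2 * au) * y1); first by ring.
  by rewrite e2 e3 !mul0r subrr.
have X2 : X 0 ix2 = 0.
  apply: (mulIf d2); rewrite mul0r.
  transitivity ((X 0 ix1 * y2 + X 0 ix2 * au) * yu - (X 0 ix1 * yu + X 0 ix2 * y1) * y2); first by ring.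
  by rewrite e2 e3 !mul0r subrr.
rewrite X1 X2 !mul0r !add0r in e4.
have X3 : X 0 iv = 0 by move/eqP: e4; rewrite mulf_eq0 (negbTE c0) orbF => /eqP.
by apply: row4P; rewrite ?X0 ?X1 ?X2 ?X3 !mxE.
Qed.

Section Closure.
Variable V : jt -> Prop.

Lemma ra_bsum (I : Type) (r : seq I) (F : I -> jt -> R) : (forall i, ra V (F i)) ->
  ra V (fun z => \sum_(i <- r) F i z).
Proof.
move=> h; elim: r => [|i r IH].
  by apply: ra_ext (ra_cst V 0) => z _; rewrite big_nil.
by apply: ra_ext (raD (h i) IH) => z _; rewrite big_cons.
Qed.

Lemma ra_bprod (I : Type) (r : seq I) (F : I -> jt -> R) : (forall i, ra V (F i)) ->
  ra V (fun z => \prod_(i <- r) F i z).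
Proof.
move=> h; elim: r => [|i r IH].
  by apply: ra_ext (ra_cst V 1) => z _; rewrite big_nil.
by apply: ra_ext (raM (h i) IH) => z _; rewrite big_cons.
Qed.

Lemma ra_det n (M : jt -> 'M[R]_n) : (forall i j, ra V (fun z => M z i j)) ->
  ra V (fun z => \det (M z)).
Proof.
move=> h; apply: ra_bsum => s; apply: raM; first exact: ra_cst.
by apply: ra_bprod => i; exact: h.
Qed.

Lemma ra_invmx n (M : jt -> 'M[R]_n) i j : (forall i j, ra V (fun z => M z i j)) ->
  (forall z, V z -> M z \in unitmx) -> ra V (fun z => invmx (M z) i j).
Proof.
move=> h u; apply: (ra_ext (f := fun z => (\det (M z))^-1 * cofactor (M z) j i)).
  by move=> z Vz; rewrite /invmx u // !mxE.
apply: raM.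
  apply: raV; first exact: ra_det.
  by move=> z /u; rewrite unitmxE unitfE.
apply: raM; first exact: ra_cst.
by apply: ra_det => a b; apply: ra_ext (h (lift j a) (lift i b)) => z _; rewrite !mxE.
Qed.
End Closure.

Let gU := good_U R.

Lemma ra_J i : ra U (J i).
Proof.
have [e0 e1 e2 e3] := JE; case: (ord4P i) => ->; rewrite ?e0 ?e1 ?e2 ?e3.
- exact: ra_I1.
- exact: ra_I2a.
- exact: ra_I2b.
- exact: ra_c1_23.
Qed.

Definition fr th : 'M[R]_4 := tresse_frame J th.

Lemma ra_fr i a : ra U (fun z => fr z i a).
Proof.
apply: ra_invmx => [b k|]; last exact: dJ_unit.
by apply: ra_ext (ra_Dt gU b (ra_J k)) => z _; rewrite mxE.
Qed.

Lemma tresseE i f th : tresse J i f th = \sum_a fr th i a * Dt a f th.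
Proof. by apply: eq_bigr => a _; rewrite mxE. Qed.

Lemma GcompE i j th : Gcomp J i j th = (fr th *m gmx th *m (fr th)^T) i j.
Proof.
rewrite /Gcomp /gdot -row_mul mxE [RHS]mxE; apply: eq_bigr => a _.
by rewrite !mxE.
Qed.

Lemma ra_gmx V a b : ra V (fun z => gmx z a b).
Proof.
by case: (ord4P a) => ->; case: (ord4P b) => ->;
  (eapply ra_ext; [move=> z _; rewrite mxE /=; reflexivity|]);
  do ?[exact: ra_cst|exact: ra_jet0|apply: raM].
Qed.

Lemma ra_Gcomp i j : ra U (Gcomp J i j).
Proof.
apply: (ra_ext (f := fun z => \sum_b (\sum_a fr z i a * gmx z a b) * fr z j b)).
  by move=> z _; rewrite GcompE mxE; apply: eq_bigr => b _; rewrite !mxE.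
apply: ra_bsum => b; apply: raM; last exact: ra_fr.
by apply: ra_bsum => a; apply: raM; [exact: ra_fr|exact: ra_gmx].
Qed.

Lemma level_ex (I : finType) (F : I -> jt -> R) : (forall i, ra U (F i)) ->
  exists l, forall i, rat U l l (F i).
Proof.
move=> /choice[k hk]; exists (\max_i k i)%N => i.
by apply: (ra_max (hk i)); exact: (@leq_bigmax_cond _ xpredT k i isT).
Qed.

(** One order for the invariants, the frame and the G_ij; it leads to the common bound on the
    denominators of all Tresse derivatives. *)
Lemma common_level : exists l0 : nat, [/\ forall i, rat U l0 l0 (J i),
  forall i a, rat U l0 l0 (fun z => fr z i a) & forall i j, rat U l0 l0 (Gcomp J i j)].
Proof.
have [l1 h1] := level_ex ra_J.
have [l2 h2] := @level_ex _ (fun ia : 'I_4 * 'I_4 => fun z => fr z ia.1 ia.2) (fun ia => ra_fr ia.1 ia.2).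
have [l3 h3] := @level_ex _ (fun ij : 'I_4 * 'I_4 => Gcomp J ij.1 ij.2) (fun ij => ra_Gcomp ij.1 ij.2).
have m k l m (f : jt -> R) : rat U k k f -> (k <= maxn l m)%N -> rat U (maxn l m) (maxn l m) f.
  by move=> rf kl; exact: (ratW kl kl rf).
exists (maxn (maxn l1 l2) l3); split=> [i|i a|i j].
- by apply: m (h1 i) _; rewrite leq_max leq_maxl.
- by apply: m (h2 (i, a)) _; rewrite leq_max leq_maxr.
- by apply: m (h3 (i, j)) _; rewrite leq_maxr.
Qed.

(** Each step multiplies by entries of the frame, of order l0, and applies [Dt], which does not
    raise the order of denominators. *)
Lemma rat_tresse_gen l0 m f : (forall i, rat U l0 l0 (J i)) ->
  (forall i a, rat U l0 l0 (fun z => fr z i a)) -> (forall i j, rat U l0 l0 (Gcomp J i j)) ->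
  tresse_gen J m f -> exists2 k, (l0 <= k)%N & rat U k l0 f.
Proof.
move=> hJ hf hG; elim=> {m f} [m i|m i j|m i f _ [k lk rf]]; [by exists l0|by exists l0|].
have [sU _ _] := gU; exists k.+1; first exact: leqW.
apply: rat_ext (rat_sum (leqW lk) _) => [th _|a]; first exact/esym/tresseE.
apply: ratM; last exact: rat_Dt.
by apply: ratW (hf i a) => //; exact: leqW.
Qed.

Lemma ra_tresse_gen m f : tresse_gen J m f -> ra U f.
Proof.
have [l0 [h1 h2 h3]] := common_level => /(rat_tresse_gen h1 h2 h3)[k lk rf].
by exists k; exact: ratW rf.
Qed.

(** * Invariance of the Tresse derivatives *)

Section Iso.
Variables (O O' : set V4) (phi : V4 -> V4) (s s' : V4 -> fibre -> R).
Hypothesis iso : isometric U O O' phi s s'.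
Notation j := (jet_of s).
Notation j' := (jet_of s').

Lemma J_invariant i q : O q -> J i (j q) = J i (j' (phi q)).
Proof.
move=> Oq; have [e0 e1 e2 e3] := JE; case: (ord4P i) => ->; rewrite ?e0 ?e1 ?e2 ?e3.
- exact: (I1_invariant gU iso).
- exact: (I2a_invariant gU iso).
- exact: (I2b_invariant gU iso).
- exact: (c1_23_invariant iso).
Qed.

Lemma fr_invariant q : O q -> fr (j q) *m jacobian phi q = fr (j' (phi q)).
Proof.
move=> Oq; have [gphi OO' [_ _ Uj] [_ _ Uj'] _] := iso.
have uj := jacobian_unit gphi Oq; have u' := dJ_unit (Uj' _ (OO' q Oq)).
have e : dJ_mx J (j q) = jacobian phi q *m dJ_mx J (j' (phi q)); last first.
  apply: (can_inj (mulmxK u')); rewrite -mulmxA -e mulVmx ?mulVmx //.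
  by rewrite e unitmx_mul uj.
apply/matrixP => a i; rewrite mxE.
rewrite (Dt_invariant gU iso a (ra_J i) (J_invariant i) Oq) mxE.
by apply: eq_bigr => b _; rewrite !mxE.
Qed.

Lemma tresse_gen_invariant m f q : tresse_gen J m f -> O q -> f (j q) = f (j' (phi q)).
Proof.
move=> gf; elim: gf q => {m f} [m i|m i k|m i f gf IH] q Oq.
- exact: J_invariant.
- rewrite !GcompE (gmx_invariant iso Oq) -(fr_invariant Oq) trmx_mul.
  by rewrite !mulmxA.
- rewrite !tresseE -(fr_invariant Oq).
  under [RHS]eq_bigr => b _ do rewrite mxE mulr_suml.
  rewrite exchange_big /=; apply: eq_bigr => a _.
  rewrite (Dt_invariant gU iso a (ra_tresse_gen gf) IH Oq) mulr_sumr.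
  by apply: eq_bigr => b _; rewrite jacobianE mulrA.
Qed.
End Iso.

(** * From orbits of jets to pairs of isometric sections *)

(** U is invariant, so it cuts corresponding open subsets out of both domains. *)
Lemma isometric_U O O' phi (s s' : V4 -> fibre -> R) : isometric (@Eoo R) O O' phi s s' ->
  exists A A', [/\ isometric U A A' phi s s', forall q, O q -> U (jet_of s q) -> A q &
    forall q, A q -> O q].
Proof.
move=> iso; have [gphi OO' jO jO' ss'] := iso; have [k [u [pu hu]]] := U_poly R.
have gE := good_Eoo R.
have oneq : open [set y : R | y != 0] by exact: open_neq.
pose A := [set q | O q /\ [set y : R | y != 0] (u (jet_of s q))].
pose A' := [set q | O' q /\ [set y : R | y != 0] (u (jet_of s' q))].
have [oO so EO] := jO; have [oO' so' EO'] := jO'.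
have oA : open A by apply: open_cut => // p Op; exact: jets_in_cont jO pu Op.
have oA' : open A' by apply: open_cut => // p Op; exact: jets_in_cont jO' pu Op.
have AU q : O q -> A q <-> U (jet_of s q).
  by move=> Oq; split=> [[_ uq]|/hu[_ uq]]; [apply/hu; split=> //; exact: EO|split].
have AU' q : O' q -> A' q <-> U (jet_of s' q).
  by move=> Oq; split=> [[_ uq]|/hu[_ uq]]; [apply/hu; split=> //; exact: EO'|split].
exists A, A'; split=> [|q Oq /(AU q Oq)//|q [] //].
split=> //.
- case: gphi => sp h; split=> [b|q [Oq _]]; last exact: h.
  by apply: smooth_onS (sp b) => q [].
- move=> q [Oq uq]; apply/(AU' _ (OO' q Oq)).
  by apply/(U_invariant gE iso Oq)/(AU q Oq).
- split=> // [c|q [Oq uq]]; first by apply: smooth_onS (so c) => q [].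
  by apply/(AU q Oq).
- split=> // [c|q [Oq uq]]; first by apply: smooth_onS (so' c) => q [].
  by apply/(AU' q Oq).
- by move=> q [Oq _]; exact: ss'.
Qed.

(** For C, A^i and B no differentiability is given; partial derivatives of phi are reached through
    one-variable functions that match it on a coordinate line. *)
Lemma pder_line F (c : R -> R) a q : (\forall h \near (0 : R), F (h *: delta_mx 0 a + q) = c (h + q 0 a)) ->
  pder a F q = derive1 c (q 0 a).
Proof.
move=> h; rewrite /pder /derive /derive1.
have e0 : F q = c (q 0 a) by have := nbhs_singleton h; rewrite scale0r !add0r.
have h' : \forall k \near (0 : R)^', k^-1 *: ((F \o shift q) (k *: delta_mx 0 a) - F q) =
    k^-1 *: (c (k + q 0 a) - c (q 0 a)).
  by rewrite near_withinE; apply: filterS h => k /= hk _; rewrite hk e0.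
congr lim; apply/seteqP; split=> A /=.
  by move=> hA; apply: (@filterS2 _ (0 : R)^' _ _ _ _ _ h' hA) => k /= <-.
by move=> hA; apply: (@filterS2 _ (0 : R)^' _ _ _ _ _ h' hA) => k /= ->.
Qed.

Lemma nbhs_open p (A : set V4) : nbhs p A -> exists O, [/\ open O, O p & O `<=` A].
Proof. by rewrite nbhsE => -[Q [oO Op] OA]; exists Q. Qed.

Lemma smooth_at_on p F : smooth_at p F -> exists O, [/\ open O, O p & smooth_on O F].
Proof. by move=> /nbhs_open[Q [oO Op OF]]; exists Q; split=> // q /OF. Qed.

Lemma near_line O a q : open O -> O q -> \forall h \near (0 : R), O (h *: delta_mx 0 a + q).
Proof.
move=> oO Oq; have c : (fun h : R => h *: (delta_mx 0 a : V4) + q) @ (0 : R) --> (0 : R) *: (delta_mx 0 a : V4) + q.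
  by apply: cvgD; [apply: cvgZr_tmp; exact: cvg_id|exact: cvg_cst].
have := c O; rewrite /= scale0r add0r => /(_ (open_nbhs_nbhs (conj oO Oq))).
exact.
Qed.

Lemma det2 (A : 'M[R]_2) : \det A = A ord0 ord0 * A (lift ord0 ord0) (lift ord0 ord0) -
  A ord0 (lift ord0 ord0) * A (lift ord0 ord0) ord0.
Proof.
rewrite (expand_det_row _ ord0) big_ord_recl big_ord1 /cofactor !det_mx11 !mxE /= expr0 mul1r.
rewrite expr1 mulN1r mulrN; congr (_ * A _ _ - _ * A _ _); exact: val_inj.
Qed.

Lemma pseudogroup_Gform p phi : pseudogroup_at p phi -> exists O, [/\ open O, O p & Gform O phi].
Proof.
move=> [sphi [C [A1 [A2 [B /nbhs_open[Q2 [oO2 O2p h2]]]]]]].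
have [N1 h1] : exists N1 : 'I_4 -> set V4, forall b,
  [/\ open (N1 b), N1 b p & smooth_on (N1 b) (fun q => phi q 0 b)].
  by have /choice[N hN] := fun b => smooth_at_on (sphi b); exists N.
pose O := Q2 `&` (N1 iu `&` (N1 ix1 `&` (N1 ix2 `&` N1 iv))).
have oN1 b : open (N1 b) by case: (h1 b).
have N1p b : N1 b p by case: (h1 b).
have oO : open O by do ?apply: openI.
have ON1 b q : O q -> N1 b q by move=> [_ [? [? []]]]; case: (ord4P b) => ->.
exists O; split=> //; split=> [b|q Oq].
  by case: (h1 b) => _ _; apply: smooth_onS => q; exact: ON1.
(* A component that stays constant while only coordinate a moves has zero derivative along a. The
   normal form of phi shows this for every zero entry of the pattern. *)
have Lz a b : (forall z, O z -> (forall i, i != a -> z 0 i = q 0 i) -> phi z 0 b = phi q 0 b) ->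
    jac phi q a b = 0.
  move=> hz; rewrite /jac (@pder_line (fun z => phi z 0 b) (fun=> phi q 0 b) a q) ?derive1_cst //.
  apply: filterS (near_line a oO Oq) => h Oh; apply: hz => // i ia.
  by rewrite !mxE (negbTE ia) andbF mulr0 add0r.
have hO z : O z -> _ := fun Oz => h2 z Oz.1.
have [eq dq Cq] := hO q Oq.
have vu a b : (forall z, O z -> (forall i, i != a -> z 0 i = q 0 i) -> phi z 0 b = phi q 0 b) ->
  jac phi q a b = 0 := @Lz a b.
have Z a b : a != iu -> (b == iu) || (a == iv) && (b != iv) -> jac phi q a b = 0.
  move=> au ab; apply: Lz => z Oz zq; have [-> _ _] := hO z Oz; rewrite eq.
  have zu : z 0 iu = q 0 iu by apply: zq; rewrite eq_sym.
  case/orP: ab => [/eqP ->|/andP[/eqP ea bv]]; first by rewrite !mxE /= zu.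
  have z1 : z 0 ix1 = q 0 ix1 by apply: zq; rewrite ea.
  have z2 : z 0 ix2 = q 0 ix2 by apply: zq; rewrite ea.
  by rewrite !mxE zu z1 z2; case: (ord4P b) bv => ->.
split; first by split; exact: Z.
split; try exact: Z.
- have -> : jac phi q iu iu = derive1 C (q 0 iu).
    rewrite /jac (@pder_line (fun z => phi z 0 iu) C iu q) //.
    apply: filterS (near_line iu oO Oq) => h Oh; have [-> _ _] := hO _ Oh.
    by rewrite !mxE /= mulr1.
  have -> : jac phi q iv iv = (derive1 C (q 0 iu))^-1.
    pose b0 := B (q 0 iu) (q 0 ix1) (q 0 ix2).
    rewrite /jac (@pder_line (fun z => phi z 0 iv) (fun t => t * (derive1 C (q 0 iu))^-1 + b0) iv q) //.
      pose k := (derive1 C (q 0 iu))^-1.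
      rewrite -(@pder_line (fun z => z 0 iv * k + b0) (fun t => t * k + b0)); last first.
        by near=> h; rewrite !mxE /= mulr1.
      have dv1 : differentiable (fun z : V4 => z 0 iv) q by exact: differentiable_coord.
      have dk r : differentiable (fun=> r : R) q by exact: differentiable_cst.
      rewrite (pderD _ _ (dk b0)); last exact: differentiableM.
      by rewrite (pderM _ dv1 (dk k)) pder_coord !pder_cst eqxx mulr0 !addr0 mul1r.
    apply: filterS (near_line iv oO Oq) => h Oh; have [-> _ _] := hO _ Oh.
    by rewrite !mxE /= mulr1 !mulr0 !add0r.
  by rewrite mulfV.
- move: dq; rewrite det2 !mxE -[ix ord0]/ix1 -[ix (lift _ _)]/ix2.
  by rewrite [X in _ - X]mulrC.
Unshelve. all: by end_near. Qed.

Lemma eqjet_pull O k p (J1 J2 : V4 -> 'I_4 -> 'I_4 -> R) (y1 y2 : V4 -> fibre -> R) c :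
  open O -> O p ->
  (forall a b, [/\ smooth_on O (fun q => J1 q a b), smooth_on O (fun q => J2 q a b) &
     eqjet k p (fun q => J1 q a b) (fun q => J2 q a b)]) ->
  (forall c, [/\ smooth_on O (fun q => y1 q c), smooth_on O (fun q => y2 q c) &
     eqjet k p (fun q => y1 q c) (fun q => y2 q c)]) ->
  eqjet k p (fun q => pull (J1 q) (y1 q) c) (fun q => pull (J2 q) (y2 q) c).
Proof.
move=> oO Op hJ hy.
pose P F G := [/\ smooth_on O F, smooth_on O G & eqjet k p F G].
have pM F G F' G' : P F G -> P F' G' -> P (fun q => F q * F' q) (fun q => G q * G' q).
  by move=> [s1 s2 s3] [t1 t2 t3]; split; [exact: smoothM|exact: smoothM|exact: (eqjetM oO)].
have pD F G F' G' : P F G -> P F' G' -> P (fun q => F q + F' q) (fun q => G q + G' q).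
  by move=> [s1 s2 s3] [t1 t2 t3]; split; [exact: smoothD|exact: smoothD|exact: (eqjetD oO)].
have p2 : P (fun=> 2) (fun=> 2) by split; [exact: smooth_cst|exact: smooth_cst|exact: eqjet_refl].
have pX a b : P (fun q => J1 q a b ^+ 2) (fun q => J2 q a b ^+ 2).
  by under [fun q => J1 q a b ^+ 2]eq_fun => q do rewrite expr2;
     under [fun q => J2 q a b ^+ 2]eq_fun => q do rewrite expr2; exact: pM.
suff [] : P (fun q => pull (J1 q) (y1 q) c) (fun q => pull (J2 q) (y2 q) c) by [].
have pJ a b : P (fun q => J1 q a b) (fun q => J2 q a b) by exact: hJ.
have py (d : fibre) : P (fun q => y1 q d) (fun q => y2 q d) by exact: hy.
clear hJ hy; clearbody P.
by case: c; rewrite /pull; do ?[exact: pJ|exact: py|exact: pX|exact: p2|apply pD|apply pM].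
Qed.


Lemma Gform_near O O' p phi : open O -> open O' -> O p -> O' (phi p) -> Gform O phi ->
  exists A, [/\ open A, A p, A `<=` O, forall q, A q -> O' (phi q) & Gform A phi].
Proof.
move=> oO oO' Op O'p gphi; have [sphi h] := gphi.
have oA : open [set q | O q /\ O' (phi q)].
  rewrite openE => q [Oq O'q].
  have c : {for q, continuous phi}.
    apply: differentiable_continuous; apply: differentiable_row => b.
    exact: smooth_on_diff (sphi b) Oq.
  apply: filterS2 (near_open oO Oq (fun q h => h)) (c O' (open_nbhs_nbhs (conj oO' O'q))).
  by [].
exists [set q | O q /\ O' (phi q)]; split=> // [q []//|q []//|].
split=> [b|q [Oq _]]; last exact: h.
by apply: smooth_onS (sphi b) => q [].
Qed.

Lemma isometric_pullsec O O' phi s' : open O -> jets_in (@Eoo R) O' s' -> Gform O phi ->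
  (forall q, O q -> O' (phi q)) -> isometric (@Eoo R) O O' phi (pullsec phi s') s'.
Proof.
move=> oO jO' gphi OO'; have [oO' so' EO'] := jO'.
have [vs ps] := (jets_in_Eoo s' oO').1 jO'.
split=> //; apply/(jets_in_Eoo _ oO); split=> [c|q Oq].
  by apply: (vdegree_pullsec oO oO' gphi OO').
apply: posdef_pull; first exact/ps/OO'.
by case: gphi => _ /(_ q Oq)[_ []].
Qed.

Lemma eqjet_agree k s1 s2 O p : open O -> O p -> (forall c, smooth_on O (fun q => s1 q c)) ->
  (forall c, smooth_on O (fun q => s2 q c)) ->
  agree k (jet_of s1 p) (jet_of s2 p) <-> forall c, eqjet k.+1 p (fun q => s1 q c) (fun q => s2 q c).
Proof.
move=> oO Op h1 h2; split=> [[_ h] c w wk|h].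
  rewrite (Dw_wcnt w oO (h1 c) Op) (Dw_wcnt w oO (h2 c) Op).
  by apply: h; rewrite midx_order_wcnt.
split=> //= c al alk; rewrite !pder_midxE; apply: h.
by rewrite size_wd.
Qed.

(** A jet in [Ek k] may violate equations of higher order; filling the higher coordinates with 0
    gives a point of the infinite prolongation with the same k-jet. *)
Definition trunc_jet k th : jt :=
  Jet (base th) (fun c al => if (midx_order al <= k)%N then jcoord th c al else 0).

Lemma trunc_Eoo k th : Ek k th -> Eoo (trunc_jet k th).
Proof.
move=> [ph hv]; apply/EooP; split.
  have -> : jet0 (trunc_jet k th) = jet0 th; last by [].
  by apply/funext => c; rewrite /jet0 /= /midx_order big1 // => a _; rewrite ffunE.
by move=> c al cal /=; case: ifP => // alk; exact: hv.
Qed.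

Lemma agree_trunc k th : agree k th (trunc_jet k th).
Proof. by split=> // c al /= ->. Qed.

Lemma agree_sym k th th' : agree k th th' -> agree k th' th.
Proof. by move=> [e h]; split=> // c al /h. Qed.

Lemma agree_trans k th1 th2 th3 : agree k th1 th2 -> agree k th2 th3 -> agree k th1 th3.
Proof.
move=> [e h] [e' h']; split=> [|c al alk]; first by rewrite e.
by rewrite h // h'.
Qed.

(* The k-jet of a pulled back section only depends on the k-jet of the section,
   so both points may be represented by Kundt metrics. *)
Lemma orbit_isometric k th th' : Ek k th' -> same_orbit k th th' -> exists O O' phi s s',
  [/\ isometric (@Eoo R) O O' phi s s', O (base th), phi (base th) = base th',
      agree k th (jet_of s (base th)) & agree k th' (jet_of s' (base th'))].
Proof.
move=> Eth' [phi [pphi [phib [s0 [s0' [sec0 sec0' met th0 th0']]]]]].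
have [Q1 [oQ1 Q1p gQ1]] := pseudogroup_Gform pphi.
have [D' [s' [jO' D'b sth']]] := realizable_Eoo (trunc_Eoo Eth').
rewrite /= in D'b sth'.
have [oO' so' EO'] := jO'.
have sec_on p s : section_at p s -> exists A, [/\ open A, A p & forall c, smooth_on A (fun q => s q c)].
  move=> [ss _]; have [AH [oH pH sH]] := smooth_at_on (ss fH).
  have [A1 [oA1 p1 s1]] := smooth_at_on (ss fW1).
  have [A2 [oA2 p2 s2]] := smooth_at_on (ss fW2).
  have [A3 [oA3 p3 s3]] := smooth_at_on (ss fh11).
  have [A4 [oA4 p4 s4]] := smooth_at_on (ss fh12).
  have [A5 [oA5 p5 s5]] := smooth_at_on (ss fh22).
  exists (AH `&` (A1 `&` (A2 `&` (A3 `&` (A4 `&` A5))))); split; [by do ?apply: openI|by []|].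
  by case; [apply: smooth_onS sH|apply: smooth_onS s1|apply: smooth_onS s2|apply: smooth_onS s3
    |apply: smooth_onS s4|apply: smooth_onS s5] => q [? [? [? [? []]]]].
have [A [oA Ap sA]] := sec_on _ _ sec0; have [A' [oA' Ap' sA']] := sec_on _ _ sec0'.
have [Q2 [oQ2 Q2p Q2m]] := nbhs_open met.
have [P1 [oP1 P1p P1Q P1O gP1]] : exists P, [/\ open P, P (base th), P `<=` Q1,
    forall q, P q -> (D' `&` A') (phi q) & Gform P phi].
  by apply: Gform_near; rewrite ?phib //; exact: openI.
pose Q := P1 `&` (A `&` Q2).
have oQ : open Q by do ?apply: openI.
have Qp : Q (base th) by [].
have gQ : Gform Q phi.
  case: gP1 => sp h; split=> [b|q [Pq _]]; last exact: h.
  by apply: smooth_onS (sp b) => q [].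
exists Q, D', phi, (pullsec phi s'), s'; split=> //.
- apply: isometric_pullsec => // q [/P1O[]] //.
- apply: agree_trans th0 _.
  have QA' q : Q q -> A' (phi q) by move=> [/P1O[]].
  have QD' q : Q q -> D' (phi q) by move=> [/P1O[]].
  have s0E q : Q q -> s0 q = pullsec phi s0' q.
    move=> Qq; have [_ [_ /Q2m]] := Qq; rewrite (metric_pull _ gQ Qq) => /metric_inj.
    by [].
  have sQ c : smooth_on Q (fun q => s0 q c) by apply: smooth_onS (sA c) => q [_ []].
  have sP c : smooth_on Q (fun q => pullsec phi s' q c) by exact: (smooth_pullsec oQ gQ QD').
  apply/(eqjet_agree k oQ Qp sQ sP) => c w wk.
  rewrite (Dw_on w oQ (fun q Qq => congr1 (fun t : fibre -> R => t c) (s0E q Qq)) Qp); move: w wk.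
  apply: (@eqjet_pull Q k.+1 (base th) (fun q => jac phi q) (fun q => jac phi q)
    (fun q => s0' (phi q)) (fun q => s' (phi q)) c oQ Qp) => [a b|d].
    by split; [exact: smooth_jac|exact: smooth_jac|exact: eqjet_refl].
  have sphi b : smooth_on Q (fun q => phi q 0 b) by case: gQ.
  split; [exact: smooth_comp (sA' d) sphi QA'|exact: smooth_comp (so' d) sphi QD'|].
  have oI : open (D' `&` A') by exact: openI.
  apply: (@eqjet_comp _ Q (D' `&` A') _ _ (fun q => s0' q d) (fun q => s' q d) phi phi) => //.
  + by apply: smooth_onS (sA' d) => q [].
  + by apply: smooth_onS (so' d) => q [].
  + by move=> q [/P1O].
  + by move=> q [/P1O].
  rewrite phib; have Ip : (D' `&` A') (base th') by [].
  have := @eqjet_agree k s0' s' (D' `&` A') (base th') oI Ip => H; apply: (H _ _).1 => [c'|c'|].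
  + by apply: smooth_onS (sA' c') => q [].
  + by apply: smooth_onS (so' c') => q [].
  apply: agree_trans (agree_sym th0') _; rewrite sth'; exact: agree_trunc.
- by rewrite sth'; exact: agree_trunc.
Qed.

Lemma polyfun_agree k f th th' : polyfun k f -> agree k th th' -> f th = f th'.
Proof.
move=> pf [eb ec]; elim: pf => {f} [r|f [a|c al /ec]|f g _ IH1 _ IH2|f g _ IH1 _ IH2] //.
- by rewrite eb.
- by rewrite IH1 IH2.
- by rewrite IH1 IH2.
Qed.

(** Numerator and denominator are multiplied by [u]: then a nonvanishing denominator forces both
    jets into U, where the rational formula and the invariance along isometric pairs are
    available. *)
Lemma diff_invariant_U l0 f : (exists th, U th) ->
  (exists2 k, (l0 <= k)%N & rat U k l0 f) ->
  (forall O O' phi s s' q, isometric U O O' phi s s' -> O q -> f (jet_of s q) = f (jet_of s' (phi q))) ->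
  (exists u, polyfun l0 u /\ forall th, U th <-> Enz u th) ->
  diff_invariant l0 f.
Proof.
move=> Une [k lk [p [q [pp pq hpq]]]] inv [u [pu hu]].
have [th0 U0] := Une; have [E0 u0] := (hu th0).1 U0; have [q0 _] := hpq _ U0.
exists k, (fun th => p th * u th), (fun th => q th * u th); split=> //.
- by apply: alg_mul => //; exact: polyfunW pu.
- split; first exact: alg_mul.
  by exists th0; split=> //; rewrite mulf_neq0.
- move=> th Eth; rewrite mulf_eq0 negb_or => /andP[qt ut].
  have [_ ->] := hpq th ((hu th).2 (conj Eth ut)).
  by rewrite -mulf_div divff // mulr1.
move=> th th' Eth Eth' /(orbit_isometric Eth')[Q [Q' [phi [s [s' [iso Op phip ag ag']]]]]].
rewrite !mulf_eq0 !negb_or => /andP[qt ut] /andP[qt' ut'].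
rewrite -!mulf_div !divff // !mulr1.
have [_ OO' [_ _ EO] [_ _ EO'] _] := iso.
have Ut : U (jet_of s (base th)).
  by apply/hu; split; [exact: EO|rewrite -(polyfun_agree (polyfunW lk pu) ag)].
have Ut' : U (jet_of s' (base th')).
  apply/hu; split; first by rewrite -phip; exact/EO'/OO'.
  by rewrite -(polyfun_agree (polyfunW lk pu) ag').
have [A [A' [isoU AU _]]] := isometric_U iso.
have := inv _ _ _ _ _ _ isoU (AU _ Op Ut); rewrite phip.
have [_ ->] := hpq _ Ut; have [_ ->] := hpq _ Ut'.
rewrite -(polyfun_agree pp ag) -(polyfun_agree pp ag').
by rewrite -(polyfun_agree (polyfunW lk pq) ag) -(polyfun_agree (polyfunW lk pq) ag').
Qed.


(** * A jet in general position *)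

(** The jet at the origin of H = x1 v^2 / 2, W_1 = v (1 + u + x2 + x2^2 / 2), W_2 = 0 with h the
    identity. There I_1 = (1 + u + x2 + x2^2 / 2)^2, I_2a = x1 and I_2b = (1 + x2)^2, so K = 1, D2 =
    2 and D3 = 4 at the origin. *)
Definition pos_jet : jt := Jet 0 (fun c al =>
  let m := (al iu, al ix1, al ix2, al iv) in
  match c with
  | fH => (m == (0, 1, 0, 2)%N)%:R
  | fW1 => (m \in [:: (0, 0, 0, 1)%N; (1, 0, 0, 1)%N; (0, 0, 1, 1)%N; (0, 0, 2, 1)%N])%:R
  | fh11 | fh22 => (m == (0, 0, 0, 0)%N)%:R
  | _ => 0
  end).

Lemma Dt_line a f g th : (forall t, f (flow a t th) = g (flow a t th)) -> Dt a f th = Dt a g th.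
Proof. by move=> h; congr (derive1 _ 0); apply/funext => t; exact: h. Qed.

Lemma U_nonempty : U pos_jet.
Proof.
have h11 a t : jcoord (flow a t pos_jet) fh11 midx0 = 1.
  by case: (ord4P a) => -> /=; rewrite !ffunE /= mulr0 addr0.
have h22 a t : jcoord (flow a t pos_jet) fh22 midx0 = 1.
  by case: (ord4P a) => -> /=; rewrite !ffunE /= mulr0 addr0.
have h12 a t : jcoord (flow a t pos_jet) fh12 midx0 = 0 by rewrite /= mulr0 addr0.
have hw2 a t al : jcoord (flow a t pos_jet) fW2 al = 0 by rewrite /= mulr0 addr0.
have e1 a : Dt a I1 pos_jet = 2 * jcoord pos_jet fW1 (midxS a dv).
  rewrite (@Dt_line a _ (fun z => w1 z * w1 z)); last first.
    by move=> t; rewrite /Defs.I1 h11 h22 h12 hw2 /w1; field.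
  have dw : dflow a (@w1 R) pos_jet by apply: (@polyfun_dflow _ (midx_order dv)); apply: alg_gen; constructor.
  rewrite (DtM dw dw).2 Dt_coord /w1 /= !ffunE /= !mul1r !mulr1.
  by rewrite mulr_natl mulr2n.
have e2 a : Dt a I2b pos_jet = 2 * jcoord pos_jet fW1 (midxS a (midxS ix2 dv)).
  rewrite (@Dt_line a _ (fun z => jcoord z fW1 (midxS ix2 dv) * jcoord z fW1 (midxS ix2 dv))); last first.
    by move=> t; rewrite /Defs.I2b h11 h22 h12 hw2; field.
  have dw : dflow a (fun z : jt => jcoord z fW1 (midxS ix2 dv)) pos_jet.
    by apply: (@polyfun_dflow _ (midx_order (midxS ix2 dv))); apply: alg_gen; constructor.
  rewrite (DtM dw dw).2 Dt_coord /= !ffunE /= !mul1r !mulr1.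
  by rewrite mulr_natl mulr2n.
have Ep : Eoo pos_jet.
  apply/EooP; split.
    apply/posdefP; rewrite /jet0 /= !ffunE /= ?expr0n /= ?mulr1 ?subr0; split=> //; exact: ltr01.
  move=> c al; case: c => //= h; rewrite ?inE ?xpair_eqE.
  - by rewrite (gtn_eqF h) !andbF.
  - by rewrite !(gtn_eqF h) !andbF.
  - by rewrite (gtn_eqF h) !andbF.
  - by rewrite (gtn_eqF h) !andbF.
have ea a : Dt a I2a pos_jet = jcoord pos_jet fH (midxS a (midxS iv dv)) by exact: Dt_coord.
have d2 : D2 pos_jet = 2.
  by rewrite /D2 !ea !e2 /= !ffunE /=; ring.
split=> //.
- by rewrite /Kw /= !ffunE /= subr0 oner_neq0.
- by rewrite d2 pnatr_eq0.
- rewrite /D3 d2 !ea !e1 !e2 /= !ffunE /=.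
  by rewrite (_ : _ - _ + _ = 4); [rewrite pnatr_eq0|ring].
Qed.

Lemma level_U : exists l0 : nat, [/\ forall i, rat U l0 l0 (J i),
  forall i a, rat U l0 l0 (fun z => fr z i a), forall i j, rat U l0 l0 (Gcomp J i j) &
  exists u, polyfun l0 u /\ forall th, U th <-> Enz u th].
Proof.
have [l [h1 h2 h3]] := common_level; have [k [u [pu hu]]] := U_poly R.
have m (f : jt -> R) : rat U l l f -> rat U (maxn l k) (maxn l k) f.
  by move=> rf; apply: ratW rf; exact: leq_maxl.
exists (maxn l k); split=> [i|i a|i j|]; try exact: m.
by exists u; split=> //; apply: polyfunW pu; exact: leq_maxr.
Qed.

Lemma tresse_gen_diff_invariant : exists l0, forall m f, tresse_gen J m f -> diff_invariant l0 f.
Proof.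
have [l0 [h1 h2 h3 hu]] := level_U; exists l0 => m f gf.
apply: diff_invariant_U => //; [exists pos_jet; exact: U_nonempty|exact: rat_tresse_gen gf|].
by move=> O O' phi s s' q iso Oq; exact: (tresse_gen_invariant iso gf).
Qed.

Lemma J_diff_invariant i : exists l, diff_invariant l (J i).
Proof. by have [l0 h] := tresse_gen_diff_invariant; exists l0; exact: (h 0%N (J i) (tresse_gen_J _ _ _)). Qed.

Lemma U_generic P : (forall th, U th -> P th) -> generically P.
Proof.
move=> UP; have [k [u [pu hu]]] := U_poly R; exists k, u; split=> //.
  by exists pos_jet; apply/hu; exact: U_nonempty.
by move=> th Eth uth; apply: UP; apply/hu.
Qed.

Lemma J_independent : horizontally_independent J.
Proof. by apply: U_generic => th /dJ_unit; rewrite unitmxE unitfE. Qed.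

End Tresse.

Section Generation.
Variable R : realType.
Notation V4 := 'rV[R]_4.
Notation jt := (jet R).
Implicit Types (f g : jt -> R) (th : jt) (V : jt -> Prop) (a b : 'I_4) (F G : V4 -> R)
  (O : set V4) (p q : V4) (w : seq 'I_4).
Notation I1 := (@I1 R).
Notation I2a := (@I2a R).
Notation I2b := (@I2b R).
Notation c1_23 := (@c1_23 R).
Notation J := (@kundt_invariants R).
Notation U := (@U R).
Local Opaque Dt.

Let gU := good_U R.

(** * Jet coordinates in terms of the invariants *)

Definition Gc i j : jt -> R := Gcomp J i j.

Lemma gmxE th : U th -> gmx th = dJ_mx J th *m (\matrix_(i, j) Gc i j th) *m (dJ_mx J th)^T.
Proof.
move=> Uth; have u := dJ_unit Uth.
have -> : \matrix_(i, j) Gc i j th = fr th *m gmx th *m (fr th)^T.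
  by apply/matrixP => i j; rewrite mxE /Gc GcompE.
rewrite !mulmxA /fr /tresse_frame mulmxV // mul1mx -mulmxA -trmx_mul mulmxV //.
by rewrite trmx1 mulmx1.
Qed.

Lemma gmx_entry a b th : U th ->
  gmx th a b = \sum_j (\sum_i Dt a (J i) th * Gc i j th) * Dt b (J j) th.
Proof.
move=> Uth; rewrite gmxE // mxE; apply: eq_bigr => j _; rewrite !mxE; congr (_ * _).
by apply: eq_bigr => i _; rewrite !mxE.
Qed.

(** This is g(D_u, D_(J_4)) with the Tresse derivative D_(J_4); the term of J_4 is absent because
    G_44 = 0. *)
Definition Sg th : R := Dt iu (J iu) th * Gc iu iv th + Dt iu (J ix1) th * Gc ix1 iv th +
  Dt iu (J ix2) th * Gc ix2 iv th.

Lemma Dt_v_J th : U th -> [/\ Dt iv (J iu) th = 0, Dt iv (J ix1) th = 0 & Dt iv (J ix2) th = 0].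
Proof. by case=> /Dt_v_I. Qed.

Lemma Dt_v_J4 th : U th -> Dt iv (J iv) th != 0.
Proof. exact: Dt_v_c1_23. Qed.

(** D_v is D_v J_4 times D_(J_4), and D_v is null. *)
Lemma G44 th : U th -> Gc iv iv th = 0.
Proof.
move=> Uth; have [v0 v1 v2] := Dt_v_J Uth; have n0 := Dt_v_J4 Uth.
have := gmx_entry iv iv Uth; rewrite !big_ord4 /= v0 v1 v2 !mulr0 !mul0r !add0r => e.
apply: (mulfI n0); rewrite mulr0; apply: (mulIf n0); rewrite mul0r -e /gmx mxE /=.
by [].
Qed.

Lemma G_x i th : i = ix1 \/ i = ix2 -> U th ->
  Dt i (J iu) th * Gc iu iv th + Dt i (J ix1) th * Gc ix1 iv th + Dt i (J ix2) th * Gc ix2 iv th = 0.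
Proof.
move=> hi Uth; have [v0 v1 v2] := Dt_v_J Uth; have n0 := Dt_v_J4 Uth.
have := gmx_entry i iv Uth; rewrite !big_ord4 /= v0 v1 v2 G44 // !mulr0 !addr0 !add0r => e.
apply: (mulIf n0); rewrite mul0r -addrA -e /gmx mxE; by case: hi => ->.
Qed.

Lemma Dt_v_J4E th : U th -> Dt iv (J iv) th * (2 * Sg th) = 1.
Proof.
move=> Uth; have [v0 v1 v2] := Dt_v_J Uth.
have := gmx_entry iu iv Uth; rewrite !big_ord4 /= v0 v1 v2 G44 // !mulr0 !addr0 !add0r.
rewrite [gmx th iu iv]mxE /= => e.
by rewrite mulrCA [_ * Sg th]mulrC /Sg -addrA -e mulrC divfK ?pnatr_eq0.
Qed.

Lemma Sg_neq0 th : U th -> Sg th != 0.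
Proof.
by move=> /Dt_v_J4E e; apply: contra_eq_neq e => ->; rewrite !mulr0 eq_sym oner_eq0.
Qed.

(** Otherwise [G_x] is a homogeneous system for G_24 and G_34 with determinant D2; both vanish, and
    [Sg] with them. *)
Lemma G14_neq0 th : U th -> Gc iu iv th != 0.
Proof.
move=> Uth; have := Sg_neq0 Uth; apply: contra_neq => g0.
have e1 := G_x (or_introl erefl) Uth; have e2 := G_x (or_intror erefl) Uth.
have [_ _ d2 _] := Uth; rewrite /Sg; move: e1 e2; rewrite g0 !mulr0 !add0r => e1 e2.
have z1 : Gc ix1 iv th = 0.
  apply: (mulfI d2); rewrite mulr0 /D2.
  transitivity ((Dt ix1 (J ix1) th * Gc ix1 iv th + Dt ix1 (J ix2) th * Gc ix2 iv th) * Dt ix2 (J ix2) th -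
    (Dt ix2 (J ix1) th * Gc ix1 iv th + Dt ix2 (J ix2) th * Gc ix2 iv th) * Dt ix1 (J ix2) th).
    have [_ -> -> _] := JE R.
    by repeat match goal with |- context [Dt ?a ?f ?t] => generalize (Dt a f t) end; move=> *; ring.
  by rewrite e1 e2 !mul0r subrr.
have z2 : Gc ix2 iv th = 0.
  apply: (mulfI d2); rewrite mulr0 /D2.
  transitivity ((Dt ix2 (J ix1) th * Gc ix1 iv th + Dt ix2 (J ix2) th * Gc ix2 iv th) * Dt ix1 (J ix1) th -
    (Dt ix1 (J ix1) th * Gc ix1 iv th + Dt ix1 (J ix2) th * Gc ix2 iv th) * Dt ix2 (J ix1) th).
    have [_ -> -> _] := JE R.
    by repeat match goal with |- context [Dt ?a ?f ?t] => generalize (Dt a f t) end; move=> *; ring.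
  by rewrite e1 e2 !mul0r subrr.
by rewrite z1 z2 !mulr0 addr0.
Qed.

Lemma Dt_frame b f th : U th -> Dt b f th = \sum_i Dt b (J i) th * tresse J i f th.
Proof.
move=> Uth; have u := dJ_unit Uth.
transitivity ((dJ_mx J th *m (fr th *m \col_a Dt a f th)) b 0).
  by rewrite mulmxA mulmxV // mul1mx mxE.
rewrite mxE; apply: eq_bigr => i _; rewrite !mxE tresseE; congr (_ * _).
by apply: eq_bigr => a _; rewrite !mxE.
Qed.

Definition Dtw w f : jt -> R := foldr (@Dt R) f w.

(* The derivatives of the invariants which the pseudogroup can prescribe; those of I_1 along
   x^i are determined by the others, because g(D_v, D_xi) = 0. *)
Inductive Zf : (jt -> R) -> Prop :=
| Zf_u n : Zf (Dtw (nseq n.+1 iu) (J iu))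
| Zf_w a w i : iv \notin a :: w -> i != iu -> Zf (Dtw (a :: w) (J i)).

(* The flag tells whether the inverse of [Sg] is allowed. *)
Inductive zt (e : bool) (m : nat) : (jt -> R) -> Prop :=
| zt_cst r : zt e m (fun=> r)
| zt_T f : tresse_gen J m f -> zt e m f
| zt_Z f : Zf f -> zt e m f
| zt_G : zt e m (fun z => (Gc iu iv z)^-1)
| zt_S : e -> zt e m (fun z => (Sg z)^-1)
| zt_add f g : zt e m f -> zt e m g -> zt e m (fun z => f z + g z)
| zt_mul f g : zt e m f -> zt e m g -> zt e m (fun z => f z * g z)
| zt_ext f g : (forall z, U z -> f z = g z) -> zt e m f -> zt e m g.

Lemma tresse_genW m m' f : (m <= m')%N -> tresse_gen J m f -> tresse_gen J m' f.
Proof.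
move=> + gf; elim: gf m' => {m f} [m i|m i j|m i f _ IH] m'; try by constructor.
by case: m' => // m' mm'; constructor; exact: IH.
Qed.

Lemma ztW e m m' f : (m <= m')%N -> zt e m f -> zt e m' f.
Proof.
move=> mm'; elim=> {f} [r|f tf|f Zf||h|f g _ IH1 _ IH2|f g _ IH1 _ IH2|f g fg _ IH].
- exact: zt_cst.
- exact/zt_T/(tresse_genW mm').
- exact: zt_Z.
- exact: zt_G.
- exact: zt_S.
- exact: zt_add.
- exact: zt_mul.
- exact: zt_ext fg IH.
Qed.

Lemma zt_true e m f : zt e m f -> zt true m f.
Proof.
elim=> {f} [r|f tf|f Zf||h|f g _ IH1 _ IH2|f g _ IH1 _ IH2|f g fg _ IH].
- exact: zt_cst.
- exact: zt_T.
- exact: zt_Z.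
- exact: zt_G.
- exact: zt_S.
- exact: zt_add.
- exact: zt_mul.
- exact: zt_ext fg IH.
Qed.

Lemma ra_Dtw w f : ra U f -> ra U (Dtw w f).
Proof. by move=> rf; elim: w => //= a w IH; exact: (ra_Dt gU). Qed.

Lemma ra_Gc i j : ra U (Gc i j). Proof. exact: ra_Gcomp. Qed.

Lemma ra_Sg : ra U Sg.
Proof.
have h i : ra U (fun z => Dt iu (J i) z * Gc i iv z).
  by apply: raM; [apply: (ra_Dt gU); exact: ra_J|exact: ra_Gc].
by apply: raD; [apply: raD|]; exact: h.
Qed.

Lemma ra_Zf f : Zf f -> ra U f.
Proof. by case=> *; apply: ra_Dtw; exact: ra_J. Qed.

Lemma ra_zt e m f : zt e m f -> ra U f.
Proof.
elim=> {f} [r|f tf|f Zf||h|f g _ IH1 _ IH2|f g _ IH1 _ IH2|f g fg _ IH].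
- exact: ra_cst.
- exact: ra_tresse_gen tf.
- exact: ra_Zf.
- by apply: raV; [exact: ra_Gc|exact: G14_neq0].
- by apply: raV; [exact: ra_Sg|exact: Sg_neq0].
- exact: raD.
- exact: raM.
- exact: ra_ext fg IH.
Qed.

Definition cl e f := exists m, zt e m f.

Lemma cl2 e f g : cl e f -> cl e g -> exists m, zt e m f /\ zt e m g.
Proof.
move=> [m hf] [n hg]; exists (maxn m n).
by split; [exact: ztW (leq_maxl _ _) hf|exact: ztW (leq_maxr _ _) hg].
Qed.

Lemma clD e f g : cl e f -> cl e g -> cl e (fun z => f z + g z).
Proof. by move=> /cl2 h /h[m [hf hg]]; exists m; exact: zt_add. Qed.

Lemma clM e f g : cl e f -> cl e g -> cl e (fun z => f z * g z).
Proof. by move=> /cl2 h /h[m [hf hg]]; exists m; exact: zt_mul. Qed.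

Lemma cl_cst e r : cl e (fun=> r). Proof. by exists 0%N; exact: zt_cst. Qed.

Lemma cl_ext e f g : (forall z, U z -> f z = g z) -> cl e f -> cl e g.
Proof. by move=> fg [m h]; exists m; exact: zt_ext fg h. Qed.

Lemma cl_opp e f : cl e f -> cl e (fun z => - f z).
Proof. by move=> h; apply: cl_ext (clM (cl_cst e (-1)) h) => z _; rewrite mulN1r. Qed.

Lemma cl_sum e n (F : 'I_n -> jt -> R) : (forall i, cl e (F i)) -> cl e (fun z => \sum_i F i z).
Proof.
elim: n F => [|n IH] F hF.
  by apply: cl_ext (cl_cst e 0) => z _; rewrite big_ord0.
apply: cl_ext (clD (hF ord0) (IH _ (fun i => hF (lift ord0 i)))) => z _.
by rewrite big_ord_recl.
Qed.

Lemma cl_Gc e i j : cl e (Gc i j).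
Proof. by exists 0%N; apply: zt_T; constructor. Qed.

Lemma cl_GV e : cl e (fun z => (Gc iu iv z)^-1).
Proof. by exists 0%N; exact: zt_G. Qed.

Lemma cl_Zf e f : Zf f -> cl e f.
Proof. by move=> Zf; exists 0%N; exact: zt_Z. Qed.

Lemma cl_T e m f : tresse_gen J m f -> cl e f.
Proof. by move=> gf; exists m; exact: zt_T. Qed.

Lemma cl_inv_Dt e a f : cl e (fun z => (f z)^-1) -> ra U f -> (forall z, U z -> f z != 0) ->
  cl e (Dt a f) -> cl e (Dt a (fun z => (f z)^-1)).
Proof.
move=> cV rf f0 cD; apply: cl_ext (clM (cl_opp cD) (clM cV cV)) => z Uz.
by rewrite (Dt_inv gU) ?f0 // expr2 invfM.
Qed.

Section Closure.
Variables (e : bool) (a : 'I_4).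
Hypothesis DJ : forall i, cl e (Dt a (J i)).
Hypothesis DZ : forall f, Zf f -> cl e (Dt a f).
Hypothesis DS : e -> cl e (Dt a Sg).

Lemma cl_Dt_T m f : tresse_gen J m f -> cl e (Dt a f).
Proof.
move=> gf; apply: (cl_ext (f := fun z => \sum_i Dt a (J i) z * tresse J i f z)).
  by move=> z Uz; rewrite [RHS]Dt_frame.
by apply: cl_sum => i; apply: clM; [exact: DJ|exact: cl_T (tresse_gen_D i gf)].
Qed.

(** It suffices to differentiate the generators of [zt]. For a Tresse derivative f this is done
    through the frame: D_a f is the sum of D_a J_i times D_(J_i) f, one level higher. *)
Lemma cl_Dt f : cl e f -> cl e (Dt a f).
Proof.
move=> [m]; elim=> {f} [r|f tf|f Zf||h|f g hf IH1 hg IH2|f g hf IH1 hg IH2|f g fg hf IH].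
- by apply: cl_ext (cl_cst e 0) => z _; rewrite Dt_cst.
- exact: cl_Dt_T tf.
- exact: DZ.
- apply: cl_inv_Dt; [exact: cl_GV|exact: ra_Gc|exact: G14_neq0|].
  by apply: (@cl_Dt_T 0); constructor.
- apply: cl_inv_Dt; [by exists 0%N; exact: zt_S|exact: ra_Sg|exact: Sg_neq0|exact: DS].
- apply: cl_ext (clD IH1 IH2) => z Uz.
  by rewrite (Dt_add gU) //; [exact: ra_zt hf|exact: ra_zt hg].
- have [cf cg] : cl e f /\ cl e g by split; exists m.
  apply: cl_ext (clD (clM IH1 cg) (clM cf IH2)) => z Uz.
  by rewrite (Dt_mul gU) //; [exact: ra_zt hf|exact: ra_zt hg].
- apply: cl_ext IH => z Uz; apply: (Dt_eq gU) => //; exact: ra_zt hf.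
Qed.

End Closure.

Lemma Dtw_C a w f z : ra U f -> U z -> Dt a (Dtw w f) z = Dtw w (Dt a f) z.
Proof.
move=> rf; elim: w z => //= b w IH z Uz; rewrite (DtC gU) //; last exact: ra_Dtw.
by apply: (Dt_eq gU) => //; apply: (ra_Dt gU); exact: ra_Dtw.
Qed.

Lemma cl_DJ e i a : i != iu -> a != iv -> cl e (Dt a (J i)).
Proof.
move=> i0 av; apply: cl_Zf; apply: (@Zf_w a [::] i) => //.
by rewrite inE eq_sym.
Qed.

Lemma cl_Dt_u e f : e = false \/ cl e (Dt iu Sg) -> cl e f -> cl e (Dt iu f).
Proof.
move=> he; apply: cl_Dt => [i|{}f|et].
- have [-> |i0] := eqVneq i iu; last exact: cl_DJ.
  exact: cl_Zf (Zf_u 0).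
- case=> [n|b w i h1 h2]; first exact: cl_Zf (Zf_u n.+1).
  by apply: cl_Zf; apply: (@Zf_w iu (b :: w) i); rewrite // inE negb_or h1.
- by case: he => // e0; rewrite e0 in et.
Qed.

(** The orthogonality relation [G_x] is solved for D_xi J_1; here the inverse of G_14 enters. *)
Lemma Dx_J1 e i : i = ix1 \/ i = ix2 -> cl e (Dt i (J iu)).
Proof.
move=> hi; apply: (cl_ext (f := fun z => - (Dt i (J ix1) z * Gc ix1 iv z + Dt i (J ix2) z * Gc ix2 iv z) *
  (Gc iu iv z)^-1)).
  move=> z Uz; have g0 := G14_neq0 Uz; apply: (mulIf g0); rewrite mulfVK //.
  have := G_x hi Uz; rewrite -addrA => /eqP; rewrite addr_eq0 => /eqP ->.
  by [].
have iv0 : i != iv by case: hi => ->.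
apply: clM (cl_GV e); apply: cl_opp; apply: clD; apply: clM; try exact: cl_Gc.
  exact: cl_DJ.
exact: cl_DJ.
Qed.

(** The delicate case is D_xi of an iterated u-derivative of J_1: D_xi is moved inside onto J_1,
    where [Dx_J1] applies, and [cl_Dt_u] restores the u-derivatives. This is done with flag [false],
    where nothing about derivatives of [Sg] is required. *)
Lemma cl_Dt_x e i f : i = ix1 \/ i = ix2 -> e = false \/ cl e (Dt i Sg) -> cl e f -> cl e (Dt i f).
Proof.
move=> hi he; have iv0 : i != iv by case: hi => ->.
apply: cl_Dt => [k|{}f|et].
- have [-> |i0] := eqVneq k iu; last exact: cl_DJ.
  exact: Dx_J1.
- case=> [n|b w k h1 h2]; last first.
    by apply: cl_Zf; apply: (@Zf_w i (b :: w) k); rewrite // inE negb_or h1 eq_sym iv0.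
  apply: (cl_ext (f := Dtw (nseq n.+1 iu) (Dt i (J iu)))).
    by move=> z Uz; rewrite Dtw_C //; exact: ra_J.
  have [m h] : cl false (Dtw (nseq n.+1 iu) (Dt i (J iu))).
    elim: n.+1 => [|p IH]; first exact: Dx_J1.
    by apply: cl_Dt_u IH; left.
  by exists m; case: (e); [exact: zt_true h|].
- by case: he => // e0; rewrite e0 in et.
Qed.

Lemma cl_true e f : cl e f -> cl true f.
Proof. by move=> [m /zt_true h]; exists m. Qed.

Lemma cl_Sg : cl false Sg.
Proof.
apply: clD; first apply: clD; apply: clM; try exact: cl_Gc.
- exact: cl_Zf (Zf_u 0).
- exact: cl_DJ.
- exact: cl_DJ.
Qed.

(** Differentiating 1 / Sg calls for the derivative of [Sg]. The flag breaks the circle: [Sg] lies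
    in the class without its own inverse, and that class is already closed under D_u and D_xi. *)
Lemma cl_Dt_nv a f : a != iv -> cl true f -> cl true (Dt a f).
Proof.
case: (ord4P a) => -> // _.
- by apply: cl_Dt_u; right; apply: (@cl_true false); apply: cl_Dt_u cl_Sg; left.
- by apply: cl_Dt_x; [left|right; apply: (@cl_true false); apply: cl_Dt_x cl_Sg; left].
- by apply: cl_Dt_x; [right|right; apply: (@cl_true false); apply: cl_Dt_x cl_Sg; [right|left]].
Qed.

Lemma cl_Dtw_nv w f : iv \notin w -> cl true f -> cl true (Dtw w f).
Proof.
elim: w => //= a w IH; rewrite inE negb_or eq_sym => /andP[av vw] cf.
by apply: cl_Dt_nv => //; exact: IH.
Qed.

Lemma cl_Dv_J i : cl true (Dt iv (J i)).
Proof.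
case: (ord4P i) => ->.
- by apply: cl_ext (cl_cst _ 0) => z /Dt_v_J[].
- by apply: cl_ext (cl_cst _ 0) => z /Dt_v_J[].
- by apply: cl_ext (cl_cst _ 0) => z /Dt_v_J[].
apply: (cl_ext (f := fun z => 2^-1 * (Sg z)^-1)).
  move=> z Uz; have s0 : 2 * Sg z != 0 by rewrite mulf_neq0 ?pnatr_eq0 ?Sg_neq0.
  by apply: (mulIf s0); rewrite Dt_v_J4E // -invfM mulVf.
by apply: clM (cl_cst _ _) _; exists 0%N; exact: zt_S.
Qed.

(** D_v is moved inside onto J_i, where it gives 0 or 1 / (2 Sg). *)
Lemma cl_Dt_v_Zf f : Zf f -> cl true (Dt iv f).
Proof.
have h w i : iv \notin w -> cl true (Dt iv (Dtw w (J i))).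
  move=> vw; apply: (cl_ext (f := Dtw w (Dt iv (J i)))).
    by move=> z Uz; rewrite Dtw_C //; exact: ra_J.
  by apply: cl_Dtw_nv => //; exact: cl_Dv_J.
case=> [n|a w i vw _]; apply: h => //.
by rewrite mem_nseq.
Qed.

Lemma cl_Dt_v f : (cl true (Dt iv Sg)) -> cl true f -> cl true (Dt iv f).
Proof. by move=> hS; apply: cl_Dt => // [i|g]; [exact: cl_Dv_J|exact: cl_Dt_v_Zf]. Qed.

Lemma cl_Dv_Sg : cl true (Dt iv Sg).
Proof.
have term i : cl true (Dt iv (Dt iu (J i))) -> cl true (Dt iu (J i)) ->
    cl true (Dt iv (fun z => Dt iu (J i) z * Gc i iv z)).
  move=> h1 h2; apply: (cl_ext (f := fun z => Dt iv (Dt iu (J i)) z * Gc i iv z +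
    Dt iu (J i) z * Dt iv (Gc i iv) z)).
    by move=> z Uz; rewrite (Dt_mul gU) //; [apply: (ra_Dt gU); exact: ra_J|exact: ra_Gc].
  apply: clD; apply: clM => //; first exact: cl_Gc.
  by apply: (@cl_Dt_T true iv cl_Dv_J 0); constructor.
have rt i : ra U (fun z => Dt iu (J i) z * Gc i iv z).
  by apply: raM; [apply: (ra_Dt gU); exact: ra_J|exact: ra_Gc].
have t0 := term iu (cl_Dt_v_Zf (Zf_u 0)) (cl_Zf _ (Zf_u 0)).
have t1 := term ix1 (cl_Dt_v_Zf (@Zf_w iu [::] ix1 isT isT)) (cl_Zf _ (@Zf_w iu [::] ix1 isT isT)).
have t2 := term ix2 (cl_Dt_v_Zf (@Zf_w iu [::] ix2 isT isT)) (cl_Zf _ (@Zf_w iu [::] ix2 isT isT)).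
apply: cl_ext (clD (clD t0 t1) t2) => z Uz.
rewrite /Sg (@Dt_add _ _ gU (fun z => Dt iu (J iu) z * Gc iu iv z + Dt iu (J ix1) z * Gc ix1 iv z)) //.
  by rewrite (@Dt_add _ _ gU (fun z => Dt iu (J iu) z * Gc iu iv z)).
exact: raD.
Qed.

Lemma cl_Dt_all a f : cl true f -> cl true (Dt a f).
Proof.
by have [-> |av] := eqVneq a iv; [exact/cl_Dt_v/cl_Dv_Sg|exact: cl_Dt_nv].
Qed.

(** Order 0 is read off g = G_ij dJ_i dJ_j, the factors 2 undoing the halves of W_i; higher orders
    are total derivatives of it. *)
Lemma cl_jcoord w c : cl true (fun z => jcoord z c (wcnt w)).
Proof.
elim: w => [|a w IH]; last first.
  apply: cl_ext (cl_Dt_all a IH) => z _; rewrite Dt_coord wcnt_cons.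
  by [].
have cJ a i : cl true (Dt a (J i)).
  by apply: cl_Dt_all; apply: (@cl_T true 0); constructor.
have cg a b r : cl true (fun z => r * gmx z a b).
  apply: clM (cl_cst _ r) _.
  apply: (cl_ext (f := fun z => \sum_j (\sum_i Dt a (J i) z * Gc i j z) * Dt b (J j) z)).
    by move=> z Uz; rewrite gmx_entry.
  by apply: cl_sum => j; apply: clM => //; apply: cl_sum => i; apply: clM => //; exact: cl_Gc.
rewrite wcnt_nil; case: c.
- by apply: cl_ext (cg iu iu 1) => z _; rewrite mxE /= mul1r.
- by apply: cl_ext (cg iu ix1 2) => z _; rewrite mxE /= mulrC divfK ?pnatr_eq0.
- by apply: cl_ext (cg iu ix2 2) => z _; rewrite mxE /= mulrC divfK ?pnatr_eq0.
- by apply: cl_ext (cg ix1 ix1 1) => z _; rewrite mxE /= mul1r.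
- by apply: cl_ext (cg ix1 ix2 1) => z _; rewrite mxE /= mul1r.
- by apply: cl_ext (cg ix2 ix2 1) => z _; rewrite mxE /= mul1r.
Qed.

Definition fib (i : 'I_6) : fibre := nth fH [:: fH; fW1; fW2; fh11; fh12; fh22] i.

Lemma fibP c : exists i, c = fib i.
Proof.
by case: c; [exists (@Ordinal 6 0 isT)|exists (@Ordinal 6 1 isT)|exists (@Ordinal 6 2 isT)
  |exists (@Ordinal 6 3 isT)|exists (@Ordinal 6 4 isT)|exists (@Ordinal 6 5 isT)].
Qed.

(** Finitely many coordinates have order at most l; they are indexed by a finite type so that their
    levels have a maximum. *)
Lemma jcoord_level l : exists m, forall c al, (midx_order al <= l)%N ->
  zt true m (fun z => jcoord z c al).
Proof.
have /choice[m hm] : forall x : 'I_6 * {ffun 'I_4 -> 'I_l.+1}, exists m,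
    zt true m (fun z => jcoord z (fib x.1) [ffun a => nat_of_ord (x.2 a)]).
  by move=> [i al] /=; have := cl_jcoord (wd [ffun a => nat_of_ord (al a)]) (fib i); rewrite wcnt_wd.
exists (\max_x m x)%N => c al alk; have [i ->] := fibP c.
have ala a : (al a <= l)%N by apply: leq_trans alk; rewrite /midx_order (bigD1 a) //= leq_addr.
have e : al = [ffun a => nat_of_ord ([ffun a => inord (al a)] a : 'I_l.+1)].
  by apply/ffunP => a; rewrite !ffunE inordK // ltnS.
rewrite {}e; apply: ztW (hm (i, _)).
exact: (@leq_bigmax_cond _ xpredT m (i, _) isT).
Qed.

(** * Evaluation at a normalized jet *)

Section Evaluation.
Variable z0 : jt.

(** N is the normal form of th relative to the reference jet: invariants of th, prescribable
    derivatives of [z0]. *)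
Definition normalized N th := [/\ U N, forall m f, tresse_gen J m f -> f N = f th &
  forall f, Zf f -> f N = f z0].

Definition Sg0 th : R := Dt iu (J iu) z0 * Gc iu iv th + Dt iu (J ix1) z0 * Gc ix1 iv th +
  Dt iu (J ix2) z0 * Gc ix2 iv th.

(** The value of G_14 Sg at the normal form, written in invariants at th. Its powers clear both
    inverses allowed in [zt], so no other denominator arises. *)
Definition dn th : R := Gc iu iv th * Sg0 th.

Lemma normalized_Sg N th : normalized N th -> Sg N = Sg0 th.
Proof.
move=> [_ hT hZ].
have e0 : Dt iu (J iu) N = Dt iu (J iu) z0 := hZ _ (Zf_u 0).
have e1 : Dt iu (J ix1) N = Dt iu (J ix1) z0 := hZ _ (@Zf_w iu [::] ix1 isT isT).
have e2 : Dt iu (J ix2) N = Dt iu (J ix2) z0 := hZ _ (@Zf_w iu [::] ix2 isT isT).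
have g i : Gc i iv N = Gc i iv th := hT 0%N _ (tresse_gen_G J 0 i iv).
by rewrite /Sg /Sg0 e0 e1 e2 !g.
Qed.

Lemma normalized_dn N th : normalized N th -> dn th = Gc iu iv N * Sg N.
Proof.
move=> h; rewrite /dn (normalized_Sg h); case: h => _ hT _.
by rewrite (hT 0%N (Gc iu iv)) //; constructor.
Qed.

Lemma alg_Sg0 m : alg (tresse_gen J m) Sg0.
Proof.
have t (r : R) i j : alg (tresse_gen J m) (fun th => r * Gc i j th).
  by apply: alg_mul; [exact: alg_cst|apply: alg_gen; exact: tresse_gen_G].
exact: alg_add (alg_add (t _ _ _) (t _ _ _)) (t _ _ _).
Qed.

Lemma alg_dn m : alg (tresse_gen J m) dn.
Proof. by apply: alg_mul (alg_Sg0 m); apply: alg_gen; exact: tresse_gen_G. Qed.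

Lemma alg_dnX m e : alg (tresse_gen J m) (fun th => dn th ^+ e).
Proof. exact/alg_exp/alg_dn. Qed.

Definition evaluable m f := exists P e, alg (tresse_gen J m) P /\
  forall N th, normalized N th -> f N * dn th ^+ e = P th.

Lemma eval_add m f g : evaluable m f -> evaluable m g -> evaluable m (fun z => f z + g z).
Proof.
move=> [P [e [aP hP]]] [Q [d [aQ hQ]]].
exists (fun th => P th * dn th ^+ d + Q th * dn th ^+ e), (e + d)%N; split.
  by apply: alg_add; apply: alg_mul => //; exact: alg_dnX.
by move=> N th h; rewrite -(hP _ _ h) -(hQ _ _ h) exprD; ring.
Qed.

Lemma eval_mul m f g : evaluable m f -> evaluable m g -> evaluable m (fun z => f z * g z).
Proof.
move=> [P [e [aP hP]]] [Q [d [aQ hQ]]].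
exists (fun th => P th * Q th), (e + d)%N; split; first exact: alg_mul.
by move=> N th h; rewrite -(hP _ _ h) -(hQ _ _ h) exprD; ring.
Qed.

Lemma eval_cst m r : evaluable m (fun=> r).
Proof. by exists (fun=> r), 0%N; split=> [|N th _]; [exact: alg_cst|rewrite mulr1]. Qed.

Lemma zt_eval m f : zt true m f -> evaluable m f.
Proof.
elim=> {f} [r|f tf|f Zf||_|f g _ IH1 _ IH2|f g _ IH1 _ IH2|f g fg _ IH].
- exact: eval_cst.
- exists f, 0%N; split; first exact: alg_gen.
  by move=> N th [_ hT _]; rewrite mulr1 (hT m).
- exists (fun=> f z0), 0%N; split; first exact: alg_cst.
  by move=> N th [_ _ hZ]; rewrite mulr1 hZ.
- exists Sg0, 1%N; split; first exact: alg_Sg0.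
  move=> N th h; have [UN _ _] := h.
  by rewrite expr1 (normalized_dn h) (normalized_Sg h) mulKf // G14_neq0.
- exists (Gc iu iv), 1%N; split; first by apply: alg_gen; constructor.
  move=> N th h; have [UN hT _] := h.
  rewrite expr1 (normalized_dn h) mulrCA mulVf ?Sg_neq0 // mulr1.
  by apply: (hT 0%N); constructor.
- exact: eval_add.
- exact: eval_mul.
- have [P [e [aP hP]]] := IH; exists P, e; split=> // N th h.
  by rewrite -fg ?hP //; case: h.
Qed.

(** Base coordinates are not invariants; on normal forms over the fixed point b they are
    constants. *)
Lemma poly_eval (b : V4) k m (pl : jt -> R) :
  (forall c al, (midx_order al <= k)%N -> zt true m (fun z => jcoord z c al)) -> polyfun k pl ->
  exists P e, alg (tresse_gen J m) P /\
  forall N th, normalized N th -> base N = b -> pl N * dn th ^+ e = P th.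
Proof.
move=> hm pp; have D := alg_dnX m.
elim: pp => {pl} [r|f [a|c al alk]|f g _ [P [e [aP hP]]] _ [Q [d [aQ hQ]]]|f g _ [P [e [aP hP]]] _ [Q [d [aQ hQ]]]].
- by exists (fun=> r), 0%N; split=> [|N th _ _]; [exact: alg_cst|rewrite mulr1].
- exists (fun=> b 0 a), 0%N; split; first exact: alg_cst.
  by move=> N th _ ->; rewrite mulr1.
- have [P [e [aP hP]]] := zt_eval (hm c al alk); exists P, e; split=> // N th h _.
  exact: hP.
- exists (fun th => P th * dn th ^+ d + Q th * dn th ^+ e), (e + d)%N; split.
    by apply: alg_add; apply: alg_mul.
  by move=> N th h hb; rewrite -(hP _ _ h hb) -(hQ _ _ h hb) exprD; ring.
- exists (fun th => P th * Q th), (e + d)%N; split; first exact: alg_mul.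
  by move=> N th h hb; rewrite -(hP _ _ h hb) -(hQ _ _ h hb) exprD; ring.
Qed.
End Evaluation.

(** Each coordinate of a normal form of th is P / dn^e evaluated at th, with P and e determined by
    z0, and z0 itself is such a normal form. *)
Lemma normalized_eq N th z0 : normalized z0 N th -> U z0 ->
  (forall m f, tresse_gen J m f -> f z0 = f th) -> base N = base z0 -> N = z0.
Proof.
move=> h U0 hT0 hb; apply: jet_eq => // c al.
have [m hm] := jcoord_level (midx_order al).
have [P [e [aP hP]]] := zt_eval z0 (hm c al (leqnn _)).
have h0 : normalized z0 z0 th by split.
have d0 : dn z0 th ^+ e != 0.
  by rewrite expf_neq0 // (normalized_dn h0) mulf_neq0 ?G14_neq0 ?Sg_neq0.
by apply: (mulIf d0); rewrite (hP _ _ h) (hP _ _ h0).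
Qed.

End Generation.

Section Moving.
Variable R : realType.
Notation V4 := 'rV[R]_4.
Notation jt := (jet R).
Implicit Types (f g : jt -> R) (th : jt) (V : jt -> Prop) (a b k : 'I_4) (F G : V4 -> R)
  (O : set V4) (p q : V4) (w : seq 'I_4).
Notation J := (@kundt_invariants R).
Notation U := (@U R).
Local Opaque Dt.

(** * Normalization of jets by the pseudogroup *)

Lemma Dw_section V O s f w q : good V -> jets_in V O s -> ra V f -> O q ->
  Dw w (fun q => f (jet_of s q)) q = Dtw w f (jet_of s q).
Proof.
move=> gV jO rf; have rw w' : ra V (Dtw w' f) by elim: w' => //= a w' IH; exact: (ra_Dt gV).
have oO : open O by case: jO.
elim: w q => //= a w IH q Oq; rewrite (pder_on a oO IH Oq).
by have [_ ->] := ra_section gV jO (rw w).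
Qed.

(** Derivatives along u and x see only values on a hyperplane v = t. This allows a v-dependent term
    to be added to the map without disturbing the normalization. *)
Lemma Dw_hyperplane O F G w : open O -> forall t : R,
  (forall q, O q -> q 0 iv = t -> F q = G q) -> iv \notin w ->
  forall q, O q -> q 0 iv = t -> Dw w F q = Dw w G q.
Proof.
move=> oO t FG; elim: w => [|a w IH] /=; first by move=> _; exact: FG.
rewrite inE negb_or eq_sym => /andP[av vw] q Oq qt.
pose c (x : R) := Dw w F ((x - q 0 a) *: delta_mx 0 a + q).
rewrite (@pder_line _ (Dw w F) c a q) ?(@pder_line _ (Dw w G) c a q) //.
- apply: filterS (near_line a oO Oq) => h Oh; rewrite /c addrK; apply/esym/IH => //.
  by rewrite !mxE qt eq_sym (negbTE av) mulr0 add0r.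
- by near=> h; rewrite /c addrK.
Unshelve. all: by end_near. Qed.

Lemma open_preimage O' (phi : V4 -> V4) : open O' -> (forall b, smooth_on setT (fun q => phi q 0 b)) ->
  open [set q : V4 | O' (phi q)].
Proof.
move=> oO' sphi; rewrite openE => q O'q.
have c : {for q, continuous phi}.
  apply: differentiable_continuous; apply: differentiable_row => b.
  exact: smooth_on_diff (sphi b) (I : setT q).
exact: (c O' (open_nbhs_nbhs (conj oO' O'q))).
Qed.

Section Solve.
Variable th : jt.
Hypothesis Uth : U th.
Let M b k := Dt b (J k) th.

Lemma solve_all (r : 'I_4 -> R) : exists d : 'I_4 -> R, forall k, \sum_b M b k * d b = r k.
Proof.
have u := dJ_unit Uth; pose d := (\row_k r k) *m invmx (dJ_mx J th).
exists (fun b => d 0 b) => k.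
transitivity ((d *m dJ_mx J th) 0 k); last by rewrite /d mulmxKV // mxE.
by rewrite mxE; apply: eq_bigr => b _; rewrite !mxE mulrC.
Qed.

(** J_2 and J_3 have no v-derivative, so their equations determine the two x-unknowns, with
    determinant D2; the equation of J_4 then gives the v-unknown. *)
Lemma solve_x (r : 'I_4 -> R) : exists d : 'I_4 -> R, d iu = 0 /\
  forall k, k != iu -> \sum_b M b k * d b = r k.
Proof.
have [_ _ n2 _] := Uth; have [_ v1 v2] := Dt_v_J Uth; have n0 := Dt_v_J4 Uth.
have d2' : M ix1 ix1 * M ix2 ix2 - M ix2 ix1 * M ix1 ix2 != 0 by exact: n2.
pose d1 := (r ix1 * M ix2 ix2 - r ix2 * M ix2 ix1) / (M ix1 ix1 * M ix2 ix2 - M ix2 ix1 * M ix1 ix2).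
pose d2 := (r ix2 * M ix1 ix1 - r ix1 * M ix1 ix2) / (M ix1 ix1 * M ix2 ix2 - M ix2 ix1 * M ix1 ix2).
pose d3 := (r iv - M ix1 iv * d1 - M ix2 iv * d2) / M iv iv.
exists (fun b => row4 0 d1 d2 d3 0 b); have [-> e1 e2 e3] := row4E 0 d1 d2 d3.
split=> // k k0; rewrite big_ord4 /= e1 e2 e3; have [-> _ _ _] := row4E 0 d1 d2 d3.
rewrite mulr0 add0r; case: (ord4P k) k0 => -> // _.
- rewrite (v1 : M iv ix1 = 0) mul0r addr0 /d1 /d2; move: d2'; move: M => M' d2'.
  by field.
- rewrite (v2 : M iv ix2 = 0) mul0r addr0 /d1 /d2; move: d2'; move: M => M' d2'.
  by field.
- rewrite /d3 [M iv iv * _]mulrC (divfK (n0 : M iv iv != 0)).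
  by generalize (M ix1 iv * d1) (M ix2 iv * d2) => *; ring.
Qed.

(** The flag says that the multi-index involves x: then C contributes nothing, so the unknown along
    u is 0 and the equation of J_1 is dropped. *)
Lemma solve : exists sol : bool -> ('I_4 -> R) -> 'I_4 -> R, forall (e : bool) r,
  (e -> sol e r iu = 0) /\ forall k, ~~ (e && (k == iu)) -> \sum_b M b k * sol e r b = r k.
Proof.
have /choice[s1 h1] := solve_all; have /choice[s2 h2] := solve_x.
exists (fun e : bool => if e then s2 else s1); case=> r; split=> //=.
- by move=> _; case: (h2 r).
- by move=> k; case: (h2 r) => _; exact.
Qed.
End Solve.

Section Project.
Variable p0 : V4.

(** Composing with this projection freezes at p0 the variables on which a component of the map may
    not depend, and kills exactly the derivatives involving them. *)
Definition prj (m : pred 'I_4) q : V4 := \row_a (if m a then q 0 a else p0 0 a).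

Lemma smooth_prj m b : smooth_on setT (fun q => prj m q 0 b).
Proof.
case mb : (m b).
  by under [fun q => _]eq_fun => q do rewrite mxE mb; exact: smooth_coord.
by under [fun q => _]eq_fun => q do rewrite mxE mb; exact: smooth_cst.
Qed.

Lemma prj_id m : prj m p0 = p0.
Proof. by apply/rowP => a; rewrite mxE if_same. Qed.

Lemma Dw_prj m F w q : smooth_on setT F ->
  Dw w (fun q => F (prj m q)) q = if all m w then Dw w F (prj m q) else 0.
Proof.
have oT : open (@setT V4) by exact: openT.
elim/last_ind: w F q => [//|w a IH] F q sF; rewrite !Dw_rcons all_rcons.
have -> : pder a (fun q => F (prj m q)) = if m a then fun q => pder a F (prj m q) else fun=> 0.
  apply/funext => z; rewrite (@pder_comp _ F (prj m)); last 2 first.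
  - exact: smooth_on_diff sF I.
  - by move=> b; exact: smooth_on_diff (smooth_prj m b) (I : setT z).
  have e b : pder a (fun q => prj m q 0 b) z = (m b && (a == b))%:R.
    case mb : (m b).
      by rewrite (@pder_on _ setT _ (fun q => q 0 b)) ?pder_coord // => y _; rewrite mxE mb.
    by rewrite (@pder_on _ setT _ (fun=> p0 0 b)) ?pder_cst // => y _; rewrite mxE mb.
  under eq_bigr => b _ do rewrite e.
  rewrite (bigD1 a) //= big1 => [|b /negbTE ba]; last by rewrite eq_sym ba andbF mulr0.
  by rewrite eqxx andbT addr0; case: (m a); rewrite ?mulr1 ?mulr0.
case: (m a) => /=; first by apply: IH; exact: smooth_on_pder.
by case: (w) => // c w'; rewrite Dw_cst.
Qed.
End Project.


Lemma borel_fun p : exists bor : (midx -> R) -> V4 -> R,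
  forall c, smooth_on setT (bor c) /\ forall w, Dw w (bor c) p = c (wcnt w).
Proof.
have /choice[bor h] : forall c, exists F : V4 -> R, smooth_on setT F /\
    forall w, Dw w F p = c (wcnt w).
  by move=> c; have [F sF hF] := borel c p; exists F.
by exists bor.
Qed.

(** * The normalizing map between two jets *)

Section Jets.
Variables (z0 th : jt).
Hypotheses (Uz0 : U z0) (Uth : U th).
Notation p0 := (base z0).
Notation p1 := (base th).
Variables (D0 D1 : set V4) (s0 s1 : V4 -> fibre -> R).
Hypotheses (jD0 : jets_in U D0 s0) (D0p : D0 p0) (s0E : jet_of s0 p0 = z0).
Hypotheses (jD1 : jets_in U D1 s1) (D1p : D1 p1) (s1E : jet_of s1 p1 = th).

Definition K0 k q := J k (jet_of s0 q).
Definition K1 k q := J k (jet_of s1 q).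

Let gU := good_U R.
Let oD0 : open D0. Proof. by case: jD0. Qed.
Let oD1 : open D1. Proof. by case: jD1. Qed.
Let sK0 k : smooth_on D0 (K0 k). Proof. by have [] := ra_section gU jD0 (ra_J R k). Qed.
Let sK1 k : smooth_on D1 (K1 k). Proof. by have [] := ra_section gU jD1 (ra_J R k). Qed.

Lemma pder_K1 b k : pder b (K1 k) p1 = Dt b (J k) th.
Proof. by have [_ d] := ra_section gU jD1 (ra_J R k); rewrite d // s1E. Qed.

(* The components of the map are C(u), A^1(u, x), A^2(u, x) and B(u, x). *)
Definition mk b : pred 'I_4 := fun a => if b == iu then a == iu else a != iv.

Variable bor : (midx -> R) -> V4 -> R.
Hypothesis borP : forall c, smooth_on setT (bor c) /\ forall w, Dw w (bor c) p0 = c (wcnt w).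
Variable sol : bool -> ('I_4 -> R) -> 'I_4 -> R.
Hypothesis solP : forall (e : bool) r, (e -> sol e r iu = 0) /\
  forall k, ~~ (e && (k == iu)) -> \sum_b Dt b (J k) th * sol e r b = r k.

Definition mp (c : 'I_4 -> midx -> R) q : V4 := \row_b bor (c b) (prj p0 (mk b) q).

Lemma mpE c b : (fun q => mp c q 0 b) = (fun q => bor (c b) (prj p0 (mk b) q)).
Proof. by apply/funext => q; rewrite mxE. Qed.

Lemma smooth_mp c b : smooth_on setT (fun q => mp c q 0 b).
Proof.
rewrite mpE; apply: (@smooth_comp _ setT setT (bor (c b)) (prj p0 (mk b))) => //.
- exact: openT.
- exact: (borP _).1.
- by move=> a; exact: smooth_prj.
Qed.

Lemma Dw_mp c b w : Dw w (fun q => mp c q 0 b) p0 = if all (mk b) w then c b (wcnt w) else 0.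
Proof. by rewrite mpE Dw_prj ?prj_id ?(borP _).2 //; exact: (borP _).1. Qed.

Lemma mp_base c : (forall b, c b midx0 = p1 0 b) -> mp c p0 = p1.
Proof.
by move=> h; apply/rowP => b; have := Dw_mp c b [::]; rewrite /= wcnt_nil h.
Qed.

Definition xpart (al : midx) := al iu != midx_order al.

(* The jets of the normalizing map, order by order. In the top order the unknowns occur linearly,
   with matrix (D_b J_k); along x the derivatives of C vanish and the equation for I_1 is dropped. *)
Fixpoint cs (n : nat) : 'I_4 -> midx -> R :=
  if n is m.+1 then fun b al =>
    if (midx_order al <= m)%N then cs m b al else
    if midx_order al == m.+1 then
      sol (xpart al) (fun k => Dw (wd al) (K0 k) p0 - Dw (wd al) (fun q => K1 k (mp (cs m) q)) p0) b
    else 0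
  else fun b al => if midx_order al == 0%N then p1 0 b else 0.

Lemma cs_stable n m b al : (midx_order al <= n)%N -> (n <= m)%N -> cs m b al = cs n b al.
Proof.
move=> aln /subnK <-; elim: (m - n)%N => //= d ->.
by rewrite (leq_trans aln) // leq_addl.
Qed.

Lemma cs_high n b al : (n < midx_order al)%N -> cs n b al = 0.
Proof.
case: n => [|n] /= h; first by rewrite gtn_eqF.
by rewrite leqNgt (ltnW h) /= gtn_eqF.
Qed.

Definition cinf b al := cs (midx_order al) b al.

Lemma midx_order0 : midx_order midx0 = 0%N.
Proof. by rewrite /midx_order big1 // => a _; rewrite ffunE. Qed.

Lemma cs_base n b : cs n b midx0 = p1 0 b.
Proof. by rewrite (@cs_stable 0) ?midx_order0 //= midx_order0. Qed.

Lemma cinf_base b : cinf b midx0 = p1 0 b.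
Proof. exact: cs_base. Qed.

Lemma xpart_wcnt w : xpart (wcnt w) = ~~ all (pred1 iu) w.
Proof. by rewrite /xpart midx_order_wcnt ffunE all_count. Qed.

Notation psi0 := (mp cinf).

(** The map of stage n has the same n-jet, so in order n + 1 the composites differ by the matrix
    (D_b J_k) applied to the coefficients added there, and these were chosen to make up the
    defect. *)
Lemma normalize w k : iv \notin w -> (0 < size w)%N -> ~~ (~~ all (pred1 iu) w && (k == iu)) ->
  Dw w (fun q => K1 k (psi0 q)) p0 = Dw w (K0 k) p0.
Proof.
case E : (size w) => [//|n] vw _ wk; pose phi' := mp (cs n).
have b1 : psi0 p0 = p1 by apply: mp_base => b; exact: cinf_base.
have b2 : phi' p0 = p1 by apply: mp_base => b; exact: cs_base.
pose Q := [set q | D1 (psi0 q)] `&` [set q | D1 (phi' q)].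
have oQ : open Q by apply: openI; apply: open_preimage => // b; exact: smooth_mp.
have Qp : Q p0 by rewrite /Q /= b1 b2.
have sQ c b : smooth_on Q (fun q => mp c q 0 b) by apply: smooth_onS (smooth_mp c b).
have agr b : eqjet n.+1 p0 (fun q => psi0 q 0 b) (fun q => phi' q 0 b).
  move=> u un; rewrite !Dw_mp; case: ifP => // _.
  by rewrite /cinf -(@cs_stable _ n) // midx_order_wcnt.
have := @Dw_comp_top _ Q D1 n p0 (K1 k) psi0 phi' w oQ oD1 Qp (sK1 k) (sQ _) (sQ _)
  (fun q => @proj1 _ _) (fun q => @proj2 _ _) agr E.
have sC : smooth_on Q (fun q => K1 k (phi' q)).
  by apply: (smooth_comp oQ (sK1 k) (sQ (cs n))) => q [].
set L := Dw w (fun q => K1 k (phi' q)) p0 => top.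
have e b : Dw w (fun q => psi0 q 0 b) p0 - Dw w (fun q => phi' q 0 b) p0 =
    sol (~~ all (pred1 iu) w) (fun k => Dw w (K0 k) p0 - Dw w (fun q => K1 k (phi' q)) p0) b.
  rewrite !Dw_mp cs_high ?midx_order_wcnt ?E // if_same subr0.
  have -> : cinf b (wcnt w) = sol (~~ all (pred1 iu) w)
      (fun k => Dw w (K0 k) p0 - Dw w (fun q => K1 k (phi' q)) p0) b.
    rewrite /cinf midx_order_wcnt E /= midx_order_wcnt E ltnn eqxx xpart_wcnt.
    congr (sol _ _ b); apply/funext => i.
    have sCi : smooth_on Q (fun q => K1 i (phi' q)).
      by apply: (smooth_comp oQ (sK1 i) (sQ (cs n))) => q [].
    by rewrite -(Dw_wd w oD0 (sK0 i) D0p) -(Dw_wd w oQ sCi Qp).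
  (* The table entry of C counts for words in u alone; for other words the solution has zero
     u-component, as it must. *)
  have [-> | b0] := eqVneq b iu.
    have -> : all (mk iu) w = all (pred1 iu) w by apply: eq_all => a; rewrite /mk eqxx.
    by case: (all _ w) => //=; rewrite (solP _ _).1.
  have -> // : all (mk b) w.
  apply/allP => a aw; rewrite /mk (negbTE b0).
  by apply: contraNneq vw => <-.
move: top; rewrite b1; under eq_bigr => b _ do rewrite e pder_K1.
rewrite (solP _ _).2 // => /eqP; rewrite -/(phi' _) subr_eq => /eqP ->.
by rewrite -/L subrK.
Qed.


Lemma psi0_base : psi0 p0 = p1.
Proof. by apply: mp_base => b; exact: cinf_base. Qed.

Let oT : open (@setT V4). Proof. exact: openT. Qed.

Lemma first_order a k : a != iv -> ~~ ((a != iu) && (k == iu)) ->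
  \sum_b Dt b (J k) th * jac psi0 p0 a b = Dt a (J k) z0.
Proof.
move=> av ak; have := @normalize [:: a] k; rewrite inE eq_sym /= andbT => /(_ av isT ak).
rewrite (@pder_comp _ (K1 k) psi0); last 2 first.
- by apply: smooth_on_diff (sK1 k) _; rewrite psi0_base.
- by move=> b; exact: smooth_on_diff (smooth_mp cinf b) (I : setT p0).
have e b : pder b (K1 k) (psi0 p0) = Dt b (J k) th by rewrite psi0_base pder_K1.
move=> h; apply: etrans (etrans _ h) _.
  by apply: eq_bigr => b _; rewrite e.
by have [_ ->] := ra_section gU jD0 (ra_J R k); rewrite ?s0E.
Qed.

Lemma jac_psi0_masked a b : ~~ mk b a -> jac psi0 p0 a b = 0.
Proof. by move=> /negbTE h; have := Dw_mp cinf b [:: a]; rewrite /= andbT h. Qed.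

Hypothesis sg : Sg0 z0 th != 0.

(** If C' vanished, D_u J_k at z0 would be, for k = 1, 2, 3, one fixed combination of D_x1 J_k and
    D_x2 J_k at th. Pairing with G_k4 and using [G_x] would give [Sg0] = 0, against [sg]. *)
Lemma jac_psi0_uu : jac psi0 p0 iu iu != 0.
Proof.
have f k := @first_order iu k isT isT.
have [v0 v1 v2] := Dt_v_J Uth.
have G1 := G_x (or_introl erefl) Uth; have G2 := G_x (or_intror erefl) Uth.
apply: contraNneq sg => e; rewrite /Sg0.
have := f iu; have := f ix1; have := f ix2; rewrite !big_ord4 /= v0 v1 v2 e.
move: G1 G2; generalize (jac psi0 p0 iu ix1) (jac psi0 p0 iu ix2) (jac psi0 p0 iu iv).
generalize (Gc iu iv th) (Gc ix1 iv th) (Gc ix2 iv th).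
repeat match goal with |- context [Dt ?a ?f ?t] => generalize (Dt a f t) end.
clear => a1 a2 a3 a4 a5 a6 a7 a8 a9 c1 c2 c3 g1 g2 g3 x y z.
move=> h1 h2 <- <- <-; apply/eqP.
transitivity (x * (c3 * g1 + c2 * g2 + c1 * g3) + y * (a9 * g1 + a8 * g2 + a7 * g3)); first by ring.
by rewrite h1 h2 !mulr0 addr0.
Qed.

(** By the chain rule D2 at z0 is this determinant times D2 at th, and D2 is nonzero at z0. *)
Lemma det_psi0 : jac psi0 p0 ix1 ix1 * jac psi0 p0 ix2 ix2 - jac psi0 p0 ix1 ix2 * jac psi0 p0 ix2 ix1 != 0.
Proof.
have f i k (hi : i = ix1 \/ i = ix2) (k0 : k != iu) : 
    Dt ix1 (J k) th * jac psi0 p0 i ix1 + Dt ix2 (J k) th * jac psi0 p0 i ix2 +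
    Dt iv (J k) th * jac psi0 p0 i iv = Dt i (J k) z0.
  rewrite -first_order; last 2 first.
  - by case: hi => ->.
  - by rewrite (negbTE k0) andbF.
  rewrite big_ord4 /= (@jac_psi0_masked i iu) ?mulr0 ?add0r ?addrA //.
  by rewrite /mk eqxx; case: hi => ->.
have [_ v1 v2] := Dt_v_J Uth; have [_ _ d2 _] := Uz0.
have a11 := @f ix1 ix1 (or_introl erefl) isT; have a12 := @f ix1 ix2 (or_introl erefl) isT.
have a21 := @f ix2 ix1 (or_intror erefl) isT; have a22 := @f ix2 ix2 (or_intror erefl) isT.
have D2E (t : jt) : D2 t = Dt ix1 (J ix1) t * Dt ix2 (J ix2) t - Dt ix2 (J ix1) t * Dt ix1 (J ix2) t by [].
move: v1 v2 a11 a12 a21 a22 d2; rewrite D2E.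
generalize (jac psi0 p0 ix1 ix1) (jac psi0 p0 ix1 ix2) (jac psi0 p0 ix2 ix1) (jac psi0 p0 ix2 ix2).
generalize (jac psi0 p0 ix1 iv) (jac psi0 p0 ix2 iv).
repeat match goal with |- context [Dt ?a ?f ?t] => generalize (Dt a f t) end.
clear => x1 x2 x3 x4 x5 x6 x7 x8 x9 y1 y2 y3 j11 j12 j21 j22.
move=> -> -> <- <- <- <-; apply: contra_neq => e.
transitivity ((j11 * j22 - j12 * j21) * (x8 * x4 - x7 * x5)); first by ring.
by rewrite e mul0r.
Qed.

Definition Cder q := pder iu (fun z => psi0 z 0 iu) q.
Definition detA q := \det (\matrix_(i < 2, j < 2) pder (ix j) (fun z => psi0 z 0 (ix i)) q).

(** [psi0] does not depend on v. The summand (v - v0) / C' makes the map an element of the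
    pseudogroup and vanishes on v = v0, which is all that the normalized derivatives see. *)
Definition psi q : V4 := \row_b (if b == iv then psi0 q 0 iv + (q 0 iv - p0 0 iv) / Cder q else psi0 q 0 b).

Lemma psiE q b : psi q 0 b = if b == iv then psi0 q 0 iv + (q 0 iv - p0 0 iv) / Cder q else psi0 q 0 b.
Proof. by rewrite /psi mxE. Qed.

Let s0j a b : smooth_on setT (fun q => pder a (fun z => psi0 z 0 b) q).
Proof. exact/smooth_on_pder/smooth_mp. Qed.

Lemma smooth_Cder : smooth_on setT Cder. Proof. exact: s0j. Qed.

Lemma smooth_detA : smooth_on setT detA.
Proof.
have e q : setT q -> pder ix1 (fun z => psi0 z 0 ix1) q * pder ix2 (fun z => psi0 z 0 ix2) q +
    (-1) * (pder ix2 (fun z => psi0 z 0 ix1) q * pder ix1 (fun z => psi0 z 0 ix2) q) = detA q.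
  by move=> _; rewrite /detA det2 !mxE mulN1r.
apply: (smooth_ext oT e); apply: (smoothD oT); first exact: (smoothM oT).
by apply: (smoothM oT); [exact: smooth_cst|exact: (smoothM oT)].
Qed.

Definition dom := [set q | Cder q != 0] `&` [set q | detA q != 0].

Lemma open_dom : open dom.
Proof.
have oneq : open [set y : R | y != 0] by exact: open_neq.
have h F : smooth_on setT F -> open [set q | F q != 0].
  move=> sF; have := @open_cut _ setT F [set y | y != 0] oT oneq (fun p _ => smooth_on_cont sF (I : setT p)).
  by congr open; apply/seteqP; split=> q /=; tauto.
by apply: openI; apply: h; [exact: smooth_Cder|exact: smooth_detA].
Qed.

Lemma dom_base : dom p0.
Proof.
split; first exact: jac_psi0_uu.
rewrite /= /detA det2 !mxE; have := det_psi0; congr (_ - _ != 0).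
exact: mulrC.
Qed.

Lemma smooth_psi b : smooth_on dom (fun q => psi q 0 b).
Proof.
have sub F : smooth_on setT F -> smooth_on dom F by move=> sF; exact: smooth_onS sF.
have od := open_dom; case: (eqVneq b iv) => [->|bv].
  have e q : dom q -> psi0 q 0 iv + (q 0 iv + (-1) * p0 0 iv) * (Cder q)^-1 = psi q 0 iv.
    by move=> _; rewrite psiE mulN1r.
  apply: (smooth_ext od e); apply: (smoothD od); first exact/sub/smooth_mp.
  apply: (smoothM od); last first.
    by apply: (smoothV od); [exact/sub/smooth_Cder|move=> q []].
  by apply: (smoothD od); [exact: smooth_coord|apply: (smoothM od); exact: smooth_cst].
have e q : dom q -> psi0 q 0 b = psi q 0 b by move=> _; rewrite psiE (negbTE bv).
exact/(smooth_ext od e)/sub/smooth_mp.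
Qed.

Lemma psi_pseudogroup : pseudogroup_at p0 psi.
Proof.
split=> [b|].
  by apply: (near_open open_dom dom_base) => q dq w; exact: (@smooth_psi b q dq w).
pose C (t : R) := bor (cinf iu) (row4 t (p0 0 ix1) (p0 0 ix2) (p0 0 iv)).
pose X i (u x y : R) := bor (cinf i) (row4 u x y (p0 0 iv)).
exists C, (X ix1), (X ix2), (fun u x y => X iv u x y - p0 0 iv / derive1 C u).
have CE q : psi0 q 0 iu = C (q 0 iu).
  rewrite mxE; congr (bor _ _); apply/rowP => a.
  by case: (ord4P a) => ->; rewrite !mxE.
have XE i q : i != iu -> psi0 q 0 i = X i (q 0 iu) (q 0 ix1) (q 0 ix2).
  move=> i0; rewrite mxE; congr (bor _ _); apply/rowP => a.
  by rewrite mxE /mk (negbTE i0); case: (ord4P a) => ->; rewrite !mxE.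
have dC q : Cder q = derive1 C (q 0 iu).
  rewrite /Cder (@pder_line _ _ C) //; near=> h; rewrite CE; congr C.
  by rewrite !mxE /= mulr1.
apply: (near_open open_dom dom_base) => q dq; have [c0 d0] := dq.
split; last by rewrite -dC.
  have [r0 r1 r2 r3] := row4E (C (q 0 iu)) (X ix1 (q 0 iu) (q 0 ix1) (q 0 ix2))
    (X ix2 (q 0 iu) (q 0 ix1) (q 0 ix2))
    (q 0 iv / derive1 C (q 0 iu) + (X iv (q 0 iu) (q 0 ix1) (q 0 ix2) - p0 0 iv / derive1 C (q 0 iu))).
  apply: row4P; rewrite ?r0 ?r1 ?r2 ?r3 psiE /=.
  - exact: CE.
  - exact: XE.
  - exact: XE.
  - by rewrite XE // dC mulrBl addrCA.
rewrite (_ : \matrix_(i, j) _ = \matrix_(i < 2, j < 2) pder (ix j) (fun z => psi0 z 0 (ix i)) q) //.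
apply/matrixP => i l; rewrite !mxE; congr (pder _ _ q); apply/funext => z; rewrite psiE.
by rewrite /ix; case: (i == ord0).
Unshelve. all: by end_near. Qed.

Lemma psi_base : psi p0 = p1.
Proof.
by rewrite -psi0_base; apply/rowP => b; rewrite psiE subrr mul0r addr0; case: eqP => [->|].
Qed.

Lemma psi_normalize w k : iv \notin w -> (0 < size w)%N -> ~~ (~~ all (pred1 iu) w && (k == iu)) ->
  Dw w (fun q => K1 k (psi q)) p0 = Dw w (K0 k) p0.
Proof.
move=> vw w0 wk; rewrite -normalize //.
apply: (@Dw_hyperplane setT _ _ w oT (p0 0 iv)) => // z _ zv; congr (K1 k _).
by apply/rowP => b; rewrite psiE zv subrr mul0r addr0; case: eqP => [->|].
Qed.

End Jets.

Definition moved N th := exists O O' phi s s' p,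
  [/\ isometric (@Eoo R) O O' phi s s', O p, N = jet_of s p, th = jet_of s' (phi p) &
    pseudogroup_at p phi].

(** N is the jet of the section through th pulled back along the normalizing map. It lies in U by
    invariance, and the derivatives of J_k along the pulled back section are those of J_k composed
    with the map. *)
Lemma moving z0 th : U z0 -> U th -> Sg0 z0 th != 0 ->
  exists N, [/\ moved N th, U N, base N = base z0 & forall f, Zf f -> f N = f z0].
Proof.
move=> Uz0 Uth sg; have gU := good_U R; have [_ rU _] := gU.
have [D0 [s0 [jD0 D0p s0E]]] := rU _ Uz0; have [D1 [s1 [jD1 D1p s1E]]] := rU _ Uth.
have [bor borP] := borel_fun (base z0); have [sol solP] := solve Uth.
pose phi := psi z0 th s0 s1 bor sol.
have pphi : pseudogroup_at (base z0) phi.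
  exact: (psi_pseudogroup Uz0 Uth jD0 D0p s0E jD1 D1p s1E borP solP sg).
have phib : phi (base z0) = base th by exact: (psi_base th s0 s1 borP sol).
have [Q [oQ Qp gQ]] := pseudogroup_Gform pphi.
have [oD1 so1 UD1] := jD1.
have D1phi : D1 (phi (base z0)) by rewrite phib.
have [A [oA Ap AQ AD1 gA]] := Gform_near oQ oD1 Qp D1phi gQ.
have jE : jets_in (@Eoo R) D1 s1 by split=> // q /UD1/UE.
have iso := isometric_pullsec oA jE gA AD1.
pose s := pullsec phi s1; exists (jet_of s (base z0)).
have UN : U (jet_of s (base z0)).
  by apply/(U_invariant (good_Eoo R) iso Ap); rewrite phib s1E.
have [B [B' [isoU BU BA]]] := isometric_U iso.
have Bp := BU _ Ap UN.
split=> //; first by exists A, D1, phi, s, s1, (base z0); split; rewrite ?phib.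
have [_ _ jB _ _] := isoU; have [oB _ _] := jB.
have key w k : iv \notin w -> (0 < size w)%N -> ~~ (~~ all (pred1 iu) w && (k == iu)) ->
    Dtw w (J k) (jet_of s (base z0)) = Dtw w (J k) z0.
  move=> vw w0 wk; rewrite -(Dw_section w gU jB (ra_J R k) Bp).
  have e q : B q -> J k (jet_of s q) = J k (jet_of s1 (phi q)) by exact: (J_invariant isoU k).
  rewrite (Dw_on w oB e Bp).
  rewrite -[in RHS]s0E -(Dw_section w gU jD0 (ra_J R k) D0p).
  exact: (psi_normalize jD0 D0p jD1 D1p s1E borP solP).
move=> f [n|a w i vw i0]; apply: key => //.
- by rewrite mem_nseq.
- by rewrite all_pred1_nseq.
- by rewrite (negbTE i0) andbF.
Qed.

End Moving.

(** * Separation of orbits and generation of the algebra *)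

Section Final.
Variable R : realType.
Notation V4 := 'rV[R]_4.
Notation jt := (jet R).
Implicit Types (f g : jt -> R) (th : jt).
Notation J := (@kundt_invariants R).
Notation U := (@U R).

Lemma moved_tresse N th m f : moved N th -> U N -> tresse_gen J m f -> f N = f th.
Proof.
move=> [Q [Q' [phi [s [s' [p [iso Qp -> -> _]]]]]]] UN gf.
have [A [A' [isoU AU _]]] := isometric_U iso.
exact: (tresse_gen_invariant isoU gf (AU p Qp UN)).
Qed.

Lemma moved_orbit N th : moved N th -> same_orbit_oo N th.
Proof.
move=> [Q [Q' [phi [s [s' [p [iso Qp -> -> pphi]]]]]]].
have [gphi QQ' [oQ so EO] [oQ' so' EO'] ss'] := iso.
exists phi; split=> // k; split=> //; exists s, s'.
have sec (A : set V4) (t : V4 -> fibre -> R) q : jets_in (@Eoo R) A t -> A q -> section_at q t.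
  move=> [oA st EA] Aq; split=> [c|]; apply: (near_open oA Aq).
    by move=> z Az w; exact: (st c z Az w).
  by move=> z /EA/EooP[]; rewrite jet0_section.
split=> //; [exact: (sec Q)|by apply: (sec Q') => //; exact: QQ'|].
apply: (near_open oQ Qp) => z Qz.
by rewrite (metric_pull _ gphi Qz) ss'.
Qed.

(** The first jet serves as reference and is its own normal form; the second is moved over it, and
    [normalized_eq] identifies the result with the first. *)
Lemma J_separate : separate J.
Proof.
have [k [u [pu hu]]] := U_poly R; exists k, u; split=> //.
  by exists (pos_jet R); apply/hu; exact: U_nonempty.
move=> th th' Eth Eth' uth uth' eqT.
have [Uth Uth'] : U th /\ U th' by split; apply/hu.
have sg : Sg0 th th' != 0.
  have <- : Sg th = Sg0 th th'; last exact: Sg_neq0.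
  by rewrite /Sg /Sg0 !(fun i j => eqT 0%N (Gc i j) (tresse_gen_G J 0 i j)).
have [N [mN UN bN ZN]] := moving Uth Uth' sg.
have <- : N = th; last exact: moved_orbit.
apply: (@normalized_eq _ N th' th) => //; split=> // m f gf.
exact: moved_tresse mN UN gf.
Qed.

Lemma alg_ra m f : alg (tresse_gen J m) f -> ra U f.
Proof.
elim=> {f} [r|f gf|f g _ IH1 _ IH2|f g _ IH1 _ IH2].
- exact: ra_cst.
- exact: ra_tresse_gen gf.
- exact: raD.
- exact: raM.
Qed.

Lemma generically_neq0 f z : ra U f -> U z -> f z != 0 ->
  generically (fun th => U th /\ f th != 0).
Proof.
have [ku [u [pu hu]]] := U_poly R; move=> [k [p [q [pp pq hpq]]]] Uz fz.
have num th : U th -> (f th != 0) = (p th != 0).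
  by move=> /hpq[q0 ->]; rewrite mulf_eq0 invr_eq0 (negbTE q0) orbF.
exists (maxn k ku), (fun th => p th * u th); split.
- by apply: alg_mul; [apply: polyfunW pp; exact: leq_maxl|apply: polyfunW pu; exact: leq_maxr].
- by have [Ez uz] := (hu z).1 Uz; exists z; split=> //; rewrite mulf_neq0 // -num.
- move=> th Eth; rewrite mulf_eq0 negb_or => /andP[pth uth].
  by have Uth : U th by [apply/hu]; rewrite num.
Qed.

Lemma J_generate : generate J.
Proof.
have [l0 hl0] := tresse_gen_diff_invariant R; exists l0; split=> // l _.
(* The level m for the denominator is fixed by l before f is given; the level n for the numerator
   comes from the order k of f. *)
have [m hm] := jcoord_level R l; exists m => f [k [p [q [lk pp [pq q_neq0] fE inv]]]].
have [n hn] := jcoord_level R k.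
have [ku [u [pu hu]]] := U_poly R.
(* The reference jet depends on f: it is taken in U and off the zeros of q, so that Q does not
   vanish at z0. *)
have [z0 [Ez0 qu0]] : nonzero_on_E (fun th => q th * u th).
  apply: nonzero_mul pq pu q_neq0 _.
  by exists (pos_jet R); apply/hu; exact: U_nonempty.
have [q0 u0] : q z0 != 0 /\ u z0 != 0 by move: qu0; rewrite mulf_eq0 negb_or => /andP.
have Uz0 : U z0 by apply/hu.
have [P [e [aP hP]]] := poly_eval z0 (base z0) hn pp.
have [Q [d [aQ hQ]]] := poly_eval z0 (base z0) hm pq.
exists n, (fun th => P th * dn z0 th ^+ d), (fun th => Q th * dn z0 th ^+ e).
split; [by apply: alg_mul => //; exact: alg_dnX|by apply: alg_mul => //; exact: alg_dnX|].
have n0 : normalized z0 z0 z0 by split.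
have d0 : dn z0 z0 != 0 by rewrite (normalized_dn n0) mulf_neq0 ?G14_neq0 ?Sg_neq0.
have rQ : ra U (fun th => Q th * dn z0 th).
  by apply: raM; [exact: alg_ra aQ|exact: alg_ra (alg_dn z0 0)].
have gQ := generically_neq0 rQ Uz0.
have gq : generically (fun th => q th != 0) by exists l, q; split.
have {}gQ : generically (fun th => U th /\ Q th * dn z0 th != 0).
  by apply: gQ; rewrite -(hQ _ _ n0 erefl) mulf_neq0 // mulf_neq0 // expf_neq0.
have [k' [r [pr rnz hr]]] := generically_and gq gQ; exists k', r; split=> // th Eth rth.
have [qth [Uth]] := hr _ Eth rth; rewrite mulf_eq0 negb_or => /andP[Qth dth].
have sg : Sg0 z0 th != 0 by move: dth; rewrite mulf_eq0 negb_or => /andP[].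
have [N [mN UN bN ZN]] := moving Uz0 Uth sg.
have nN : normalized z0 N th by split=> // i g gi; exact: moved_tresse mN UN gi.
split; first by rewrite mulf_neq0 // expf_neq0.
(* Q(th) = q(N) dn(th)^d, so off the zeros of Q invariance applies at N and gives f(th) = p(N) /
   q(N). *)
have qN : q N != 0.
  by apply: contra_neq Qth => e0; rewrite -(hQ _ _ nN bN) e0 mul0r.
have [EN _ _ _] := UN.
have [chi [pchi ochi]] := moved_orbit mN.
have -> : f th = p N / q N.
  rewrite fE //; apply/esym/inv => //; exists chi; split=> //.
rewrite -(hP _ _ nN bN) -(hQ _ _ nN bN).
have e0 : dn z0 th ^+ e != 0 by rewrite expf_neq0.
have dd0 : dn z0 th ^+ d != 0 by rewrite expf_neq0.
by field; rewrite qN e0 dd0.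
Qed.
End Final.

Theorem theorem19 (R : realType) :
  [/\ forall i : 'I_4, exists l : nat, diff_invariant l (@kundt_invariants R i),
      horizontally_independent (@kundt_invariants R)
    & sufficient_for_equivalence (@kundt_invariants R)].
Proof.
split; [exact: J_diff_invariant|exact: J_independent|].
by split; [exact: J_generate|exact: J_separate].
Qed.
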